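(* (1) Let $P$ be a ProP and $\phi:\mathbf{PGr}_{\mathrm{ind}}\to P$ a morphism of $\mathfrak S\times\mathfrak S^{op}$-modules. There exists a unique ProP morphism $\Phi:\mathbf{PGr}\to P$ such that $\Phi|_{\mathbf{PGr}_{\mathrm{ind}}}=\phi$; that is, $\mathbf{PGr}$ is the free ProP generated by $\mathbf{PGr}_{\mathrm{ind}}$. (2) The planar graphs $PG_{k,l}$, $k,l\ge0$, generate a free $\mathfrak S\times\mathfrak S^{op}$-module $\mathbf{PGr}^{\uparrow}_{\mathrm{ind}}$, and $\mathbf{PGr}^{\uparrow}$ is the free ProP generated by $\mathbf{PGr}^{\uparrow}_{\mathrm{ind}}$.
   Context: $[n]=\{1,\dots,n\}$. Graphs. A graph is a tuple $G=(V(G),E(G),I(G),O(G),IO(G),L(G),s,t,\alpha,\beta)$ where $V(G)$ (vertices), $E(G)$ (internal edges), $I(G)$ (input edges), $O(G)$ (output edges), $IO(G)$ (input-output edges), $L(G)$ (loops) are finite sets, $s:E(G)\sqcup O(G)\to V(G)$, $t:E(G)\sqcup I(G)\to V(G)$, $\alpha:I(G)\sqcup IO(G)\to[i(G)]$ a bijection with $i(G)=|I(G)|+|IO(G)|$, $\beta:O(G)\sqcup IO(G)\to[o(G)]$ a bijection with $o(G)=|O(G)|+|IO(G)|$. Operations on graphs: $\sigma\cdot G$ replaces $\beta$ by $\sigma\circ\beta$, $G\cdot\tau$ replaces $\alpha$ by $\tau^{-1}\circ\alpha$; $G*G'$ is the disjoint union with input/output indices of $G'$ shifted by $i(G)$,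 resp. $o(G)$; for $o(G)=i(G')$, $G'\circ G$ is obtained by gluing, for each $r\in[o(G)]$, the output (or input-output) edge of $G$ with index $r$ to the input (or input-output) edge of $G'$ with index $r$ (an output edge glued to an input edge becomes an internal edge from $s(f)$ to $t'(e)$; gluings involving input-output edges give input, output or input-output edges), vertices and loops being disjoint unions, input indices coming from $G$ and output indices from $G'$. Units: the empty graph and the graph with a single input-output edge. Planar graphs. For $v\in V(G)$, $I(v)=\{e\in I(G)\sqcup E(G):t(e)=v\}$, $O(v)=\{e\in O(G)\sqcup E(G):s(e)=v\}$. A planar graph is a graph with a total order on $I(v)$ and on $O(v)$ for every vertex $v$; isomorphisms of planar graphs are graph isomorphisms preserving these orders. $\mathbf{PGr}(k,l)$ is the vector space spanned by isoclasses of planar graphs with $i(G)=k$, $o(G)=l$; with the operations of the underlying graphs (the orders at the vertices being preserved) it is a ProP. $\mathbf{PGr}^{\uparrow}$ is its sub-ProP spanned by planar graphs with no cycle (sequence $(e_1,\dots,e_k)$, $k\ge1$, of internal edges with $t(e_i)=s(e_{i+1})$ and $t(e_k)=s(e_1)$) and no loop. A (planar) graph is indecomposable if (1) $V(G)\ne\emptyset$; (2) $IO(G)=\emptyset$; (3) $L(G)=\emptyset$ or $G$ is reduced to a single loop; (4) $G=G'\circ G''$ implies $V(G')=\emptyset$ or $V(G'')=\emptyset$; (5) $G=\sigma\cdot(G'*G'')\cdot\tau$ implies $V(G')=\emptyset$ or $V(G'')=\emptyset$. A planar graph is indecomposable if its underlying graph is; $\mathbf{PGr}_{\mathrm{ind}}$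 is the span of indecomposable planar graphs. $PG_{k,l}$ is the planar graph with one vertex $\star$, no internal, input-output edges or loops, input edges $[k]$ and output edges $[l]$ indexed by the identity, with $I(\star)$, $O(\star)$ ordered by the usual order of $[k]$, $[l]$; $\mathbf{PGr}^{\uparrow}_{\mathrm{ind}}$ is the $\mathfrak S\times\mathfrak S^{op}$-submodule spanned by the $\sigma\cdot PG_{k,l}\cdot\tau$. ProP. A ProP is a family $P=(P(k,l))$ of vector spaces with: commuting left $\mathfrak S_l$- and right $\mathfrak S_k$-actions; an associative horizontal concatenation $*$ with unit $I_0\in P(0,0)$; an associative vertical concatenation $\circ:P(l,m)\otimes P(k,l)\to P(k,m)$ with unit $I_1$ ($p\circ I_k=I_l\circ p=p$, $I_n=I_1^{*n}$); $(p*p')\circ(q*q')=(p\circ q)*(p'\circ q')$; $\sigma\cdot(p\circ q)=(\sigma\cdot p)\circ q$, $(p\circ q)\cdot\nu=p\circ(q\cdot\nu)$, $(p\cdot\tau)\circ q=p\circ(\tau\cdot q)$; $(\sigma\cdot p)*(\sigma'\cdot p')=(\sigma\otimes\sigma')\cdot(p*p')$, $(p\cdot\tau)*(p'\cdot\tau')=(p*p')\cdot(\tau\otimes\tau')$, $c_{l,l'}\cdot(p*p')=(p'*p)\cdot c_{k,k'}$, with $\alpha\otimes\beta$ acting as $\alpha$ on $[m]$ and $i\mapsto\beta(i-m)+m$ for $i>m$, and $c_{m,n}(i)=i+n$ ($i\le m$), $i-m$ ($i>m$). ''Free ProP $Q$ generated by a submodule $M$'' means: every module morphism $M\to P$ into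 a ProP extends uniquely to a ProP morphism $Q\to P$.
   Formalization: Condition (1) of indecomposability is read as ''V(G) is nonempty or G is reduced to a single loop'': literally it excludes the loop, contrary to (3), and uniqueness in part (1) then fails, since G -> c^{number of loops} G fixes all loopless indecomposable graphs. *)

(* Defs.v *)
From HB Require Import structures.
From mathcomp Require Import all_boot all_fingroup all_algebra.
From mathcomp Require Import finmap boolp classical_sets.
From mathcomp Require Import monalg.

Set Implicit Arguments.
Unset Strict Implicit.
Unset Printing Implicit Defensive.

Import GRing.Theory.
Local Open Scope ring_scope.
Local Open Scope quotient_scope.
Local Open Scope classical_set_scope.

(* The composite s \o t: the product (s * t)%g applies s first. *)
Definition pcomp n (s t : 'S_n) : 'S_n := (t * s)%g.

Definition map_sum A B A' B' (f : A -> A') (g : B -> B') (x : A + B) : A' + B' :=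
  match x with inl a => inl (f a) | inr b => inr (g b) end.

Lemma tensp_subproof m n (s : 'S_m) (t : 'S_n) :
  injective (fun i : 'I_(m + n) => unsplit (map_sum s t (split i))).
Proof.
move=> i j /(can_inj (@unsplitK m n)) eq_st; apply: (can_inj (@splitK m n)).
by case: (split i) (split j) eq_st => [a|a] [b|b] //= [] /perm_inj ->.
Qed.
Definition tensp m n (s : 'S_m) (t : 'S_n) : 'S_(m + n) := perm (@tensp_subproof m n s t).

Definition swapp_fun m n (i : 'I_(m + n)) : 'I_(m + n) :=
  cast_ord (addnC n m)
    (match split i with inl a => rshift n a | inr b => lshift m b end).
Lemma swapp_subproof m n : injective (@swapp_fun m n).
Proof.
move=> i j /cast_ord_inj eq_st; apply: (can_inj (@splitK m n)).
case: (split i) (split j) eq_st => [a|a] [b|b].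
- by move=> /rshift_inj ->.
- by move=> /eqP; rewrite eq_rlshift.
- by move=> /eqP; rewrite eq_lrshift.
- by move=> /lshift_inj ->.
Qed.
(* With indices starting at 0: i |-> i + n if i < m, and i |-> i - m otherwise. *)
Definition swapp m n : 'S_(m + n) := perm (@swapp_subproof m n).

Record proPData (K : fieldType) := ProPData {
  pcar :> nat -> nat -> lmodType K;
  lact : forall k l, 'S_l -> pcar k l -> pcar k l;
  ract : forall k l, pcar k l -> 'S_k -> pcar k l;
  hcat : forall k l k' l', pcar k l -> pcar k' l' -> pcar (k + k')%N (l + l')%N;
  vcat : forall k l m, pcar l m -> pcar k l -> pcar k m;
  unit0 : pcar 0 0;
  unit1 : pcar 1 1 }.
Arguments lact {K P k l} : rename.
Arguments ract {K P k l} : rename.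
Arguments hcat {K P k l k' l'} : rename.
Arguments vcat {K P k l m} : rename.
Arguments unit0 {K}.
Arguments unit1 {K}.

Definition pcast (K : fieldType) (P : proPData K) k k' l l'
    (ek : k = k') (el : l = l') (x : P k l) : P k' l' :=
  ecast i (P i l') ek (ecast j (P k j) el x).

Fixpoint unitn (K : fieldType) (P : proPData K) (n : nat) : P n n :=
  if n is n'.+1 then hcat (unit1 P) (unitn P n') else unit0 P.

Record isProP (K : fieldType) (P : proPData K) : Prop := IsProP {
  lact_lin : forall k l (s : 'S_l) a (p q : P k l),
    lact s (a *: p + q) = a *: lact s p + lact s q;
  lact1 : forall k l (p : P k l), lact 1%g p = p;
  lact_comp : forall k l (s t : 'S_l) (p : P k l),
    lact (pcomp s t) p = lact s (lact t p);
  ract_lin : forall k l (s : 'S_k) a (p q : P k l),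
    ract (a *: p + q) s = a *: ract p s + ract q s;
  ract1 : forall k l (p : P k l), ract p 1%g = p;
  ract_comp : forall k l (s t : 'S_k) (p : P k l),
    ract p (pcomp s t) = ract (ract p s) t;
  lact_ract : forall k l (s : 'S_l) (t : 'S_k) (p : P k l),
    ract (lact s p) t = lact s (ract p t);

  hcat_linl : forall k l k' l' a (p q : P k l) (r : P k' l'),
    hcat (a *: p + q) r = a *: hcat p r + hcat q r;
  hcat_linr : forall k l k' l' a (p : P k l) (q r : P k' l'),
    hcat p (a *: q + r) = a *: hcat p q + hcat p r;
  hcatA : forall k l k' l' k'' l'' (p : P k l) (q : P k' l') (r : P k'' l''),
    pcast (addnA k k' k'') (addnA l l' l'') (hcat p (hcat q r))
      = hcat (hcat p q) r;
  hcat0l : forall k l (p : P k l), pcast (add0n k) (add0n l) (hcat (unit0 P) p) = p;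
  hcat0r : forall k l (p : P k l), pcast (addn0 k) (addn0 l) (hcat p (unit0 P)) = p;

  vcat_linl : forall k l m a (p q : P l m) (r : P k l),
    vcat (a *: p + q) r = a *: vcat p r + vcat q r;
  vcat_linr : forall k l m a (p : P l m) (q r : P k l),
    vcat p (a *: q + r) = a *: vcat p q + vcat p r;
  vcatA : forall k l m n (p : P m n) (q : P l m) (r : P k l),
    vcat p (vcat q r) = vcat (vcat p q) r;
  vcat1l : forall k l (p : P k l), vcat (unitn P l) p = p;
  vcat1r : forall k l (p : P k l), vcat p (unitn P k) = p;

  interchange : forall k l m k' l' m'
      (p : P l m) (p' : P l' m') (q : P k l) (q' : P k' l'),
    vcat (hcat p p') (hcat q q') = hcat (vcat p q) (vcat p' q');
  lact_vcat : forall k l m (s : 'S_m) (p : P l m) (q : P k l),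
    lact s (vcat p q) = vcat (lact s p) q;
  ract_vcat : forall k l m (p : P l m) (q : P k l) (s : 'S_k),
    ract (vcat p q) s = vcat p (ract q s);
  mact_vcat : forall k l m (p : P l m) (s : 'S_l) (q : P k l),
    vcat (ract p s) q = vcat p (lact s q);
  lact_hcat : forall k l k' l' (s : 'S_l) (s' : 'S_l') (p : P k l) (p' : P k' l'),
    hcat (lact s p) (lact s' p') = lact (tensp s s') (hcat p p');
  ract_hcat : forall k l k' l' (t : 'S_k) (t' : 'S_k') (p : P k l) (p' : P k' l'),
    hcat (ract p t) (ract p' t') = ract (hcat p p') (tensp t t');
  hcat_swap : forall k l k' l' (p : P k l) (p' : P k' l'),
    lact (swapp l l') (hcat p p')
      = ract (pcast (addnC k' k) (addnC l' l) (hcat p' p)) (swapp k k') }.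

(* Submodules, sub-ProPs and their morphisms. As for {morphism D >-> rT} in *)
(* the group library, a morphism defined on a submodule or sub-ProP is a *)
(* function on the ambient ProP, whose values outside the domain are *)
(* irrelevant. *)

Definition family (K : fieldType) (Q : proPData K) := forall k l, set (Q k l).
Definition hom_family (K : fieldType) (Q P : proPData K) :=
  forall k l, Q k l -> P k l.

Definition lspan (K : fieldType) (V : lmodType K) (A : set V) : set V :=
  [set x | exists n (a : 'I_n -> K) (v : 'I_n -> V),
     (forall i, A (v i)) /\ x = \sum_(i < n) a i *: v i].

Record submodule (K : fieldType) (Q : proPData K) (M : family Q) : Prop := {
  sub_0 : forall k l, M k l 0;
  sub_lin : forall k l a (x y : Q k l), M k l x -> M k l y -> M k l (a *: x + y);
  sub_lact : forall k l (s : 'S_l) (x : Q k l), M k l x -> M k l (lact s x);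
  sub_ract : forall k l (s : 'S_k) (x : Q k l), M k l x -> M k l (ract x s) }.

Record subProP (K : fieldType) (Q : proPData K) (S : family Q) : Prop := {
  sub_submodule : submodule S;
  sub_unit0 : S 0 0 (unit0 Q);
  sub_unit1 : S 1 1 (unit1 Q);
  sub_hcat : forall k l k' l' (x : Q k l) (y : Q k' l'),
    S k l x -> S k' l' y -> S _ _ (hcat x y);
  sub_vcat : forall k l m (x : Q l m) (y : Q k l),
    S l m x -> S k l y -> S k m (vcat x y) }.

Record module_morphism (K : fieldType) (Q P : proPData K) (M : family Q)
    (f : hom_family Q P) : Prop := {
  mor_lin : forall k l a (x y : Q k l), M k l x -> M k l y ->
    f k l (a *: x + y) = a *: f k l x + f k l y;
  mor_lact : forall k l (s : 'S_l) (x : Q k l), M k l x ->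
    f k l (lact s x) = lact s (f k l x);
  mor_ract : forall k l (s : 'S_k) (x : Q k l), M k l x ->
    f k l (ract x s) = ract (f k l x) s }.

Record proP_morphism (K : fieldType) (Q P : proPData K) (S : family Q)
    (F : hom_family Q P) : Prop := {
  mor_module : module_morphism S F;
  mor_unit0 : F 0 0 (unit0 Q) = unit0 P;
  mor_unit1 : F 1 1 (unit1 Q) = unit1 P;
  mor_hcat : forall k l k' l' (x : Q k l) (y : Q k' l'), S k l x -> S k' l' y ->
    F _ _ (hcat x y) = hcat (F k l x) (F k' l' y);
  mor_vcat : forall k l m (x : Q l m) (y : Q k l), S l m x -> S k l y ->
    F k m (vcat x y) = vcat (F l m x) (F k l y) }.

Definition eq_on (K : fieldType) (Q P : proPData K) (M : family Q)
    (f g : hom_family Q P) : Prop :=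
  forall k l (x : Q k l), M k l x -> f k l x = g k l x.

Definition full (K : fieldType) (Q : proPData K) : family Q := fun k l => setT.
Arguments full {K} Q.

Definition free_ProP (K : fieldType) (Q : proPData K) (S M : family Q) : Prop :=
  [/\ isProP Q, subProP S, submodule M,
      forall k l (x : Q k l), M k l x -> S k l x
    & forall (P : proPData K) (phi : hom_family Q P),
        isProP P -> module_morphism M phi ->
        exists Phi : hom_family Q P,
          [/\ proP_morphism S Phi, eq_on M Phi phi
            & forall Psi : hom_family Q P,
                proP_morphism S Psi -> eq_on M Psi phi -> eq_on S Psi Phi]].

(* The elements g k l form a basis of the module M: each M k l is free over *)
(* the algebra of 'S_l x ('S_k)^op, with basis the single element g k l. *)
Definition free_module (K : fieldType) (Q : proPData K) (M : family Q)
    (g : forall k l, Q k l) : Prop :=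
  [/\ submodule M, forall k l, M k l (g k l)
    & forall k l (x : Q k l), M k l x ->
        exists! a : {ffun 'S_l * 'S_k -> K},
          x = \sum_st a st *: lact st.1 (ract (g k l) st.2)].

(* Finite types with carrier in Set. Graphs on arbitrary finTypes would form *)
(* a type in too large a universe to index a basis of an lmodType. *)
Record sfin := SFin { sfin_sort :> Set; sfin_class : Finite sfin_sort }.
HB.instance Definition _ (A : sfin) : Finite (sfin_sort A) := sfin_class A.

Definition sfin_void : sfin := @SFin void (Finite.class void).
Definition sfin_unit : sfin := @SFin unit (Finite.class unit).
Definition sfin_sum (A B : sfin) : sfin :=
  @SFin (A + B)%type (Finite.class (A + B)%type).
Definition sfin_sub (A B : sfin) (P : pred (A * B)) : sfin :=
  @SFin {p : A * B | P p} (Finite.class {p : A * B | P p}).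

(* Bounded integers, in Set (MathComp's ordinals are in Type). *)
Definition below (n : nat) : Set := {i : nat | i < n}%N.
Definition ord_below n (i : below n) : 'I_n := Ordinal (svalP i).
Definition below_ord n (i : 'I_n) : below n := exist _ (val i) (ltn_ord i).
Lemma ord_belowK n : cancel (@ord_below n) (@below_ord n).
Proof. by case=> i lt_in; apply: val_inj. Qed.
Lemma below_ordK n : cancel (@below_ord n) (@ord_below n).
Proof. by move=> i; apply: val_inj. Qed.
HB.instance Definition _ n := Choice.on (below n).
HB.instance Definition _ n := Countable.on (below n).
HB.instance Definition _ n : isFinite (below n) := CanIsFinite (@ord_belowK n).
Definition sfin_below (n : nat) : sfin := @SFin (below n) (Finite.class (below n)).

(* graph k l: graphs with k input indices and l output indices. The *)
(* cardinalities i(G) = k and o(G) = l follow from the bijections. *)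
Record graph (k l : nat) := Graph {
  gV : sfin; gE : sfin; gI : sfin; gO : sfin; gIO : sfin; gL : sfin;
  gs : gE + gO -> gV;
  gt : gE + gI -> gV;
  galpha : gI + gIO -> 'I_k;
  gbeta : gO + gIO -> 'I_l;
  galpha_bij : bijective galpha;
  gbeta_bij : bijective gbeta }.
Arguments Graph {k l gV gE gI gO gIO} gL gs gt {galpha gbeta}.
Arguments gs {k l} G : rename.
Arguments gt {k l} G : rename.
Arguments galpha {k l} G : rename.
Arguments gbeta {k l} G : rename.

Lemma inj_surj_bij (A B : finType) (f : A -> B) :
  injective f -> (forall b, exists a, f a = b) -> bijective f.
Proof.
move=> f_inj f_surj.
have f_surjb b : exists a, f a == b by have [a <-] := f_surj b; exists a.
have fK : cancel (fun b => xchoose (f_surjb b)) f.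
  by move=> b; apply/eqP/(xchooseP (f_surjb b)).
by exists (fun b => xchoose (f_surjb b)) => // a; apply: f_inj; rewrite fK.
Qed.

Lemma perm_bij n (s : 'S_n) : bijective s.
Proof. exact: injF_bij perm_inj. Qed.

Lemma map_sum_bij A B A' B' (f : A -> A') (g : B -> B') :
  bijective f -> bijective g -> bijective (map_sum f g).
Proof.
move=> [f' fK f'K] [g' gK g'K]; exists (map_sum f' g').
  by case=> x /=; rewrite ?fK ?gK.
by case=> x /=; rewrite ?f'K ?g'K.
Qed.

Lemma void_bij (A B : Type) : (A -> False) -> (B -> False) ->
  forall f : A -> B, bijective f.
Proof.
by move=> A0 B0 f; exists (fun b => False_rect A (B0 b)) => x; [case: (A0 x) | case: (B0 x)].
Qed.

(* Graphs up to isomorphism. Indices are compared in nat, so that graphs whose *)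
(* numbers of indices are only provably equal can be compared. *)
Record giso k l k' l' (G : graph k l) (G' : graph k' l') : Type := GIso {
  isoV : gV G -> gV G'; isoE : gE G -> gE G'; isoI : gI G -> gI G';
  isoO : gO G -> gO G'; isoIO : gIO G -> gIO G'; isoL : gL G -> gL G';
  isoV_bij : bijective isoV; isoE_bij : bijective isoE;
  isoI_bij : bijective isoI; isoO_bij : bijective isoO;
  isoIO_bij : bijective isoIO; isoL_bij : bijective isoL;
  iso_s : forall x, gs G' (map_sum isoE isoO x) = isoV (gs G x);
  iso_t : forall x, gt G' (map_sum isoE isoI x) = isoV (gt G x);
  iso_alpha : forall x, galpha G' (map_sum isoI isoIO x) = galpha G x :> nat;
  iso_beta : forall x, gbeta G' (map_sum isoO isoIO x) = gbeta G x :> nat }.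

Definition isomorphic k l k' l' (G : graph k l) (G' : graph k' l') : Prop :=
  inhabited (giso G G').

Definition glact k l (s : 'S_l) (G : graph k l) : graph k l :=
  Graph (gL G) (gs G) (gt G) (galpha_bij G) (bij_comp (perm_bij s) (gbeta_bij G)).

Definition gract k l (G : graph k l) (t : 'S_k) : graph k l :=
  Graph (gL G) (gs G) (gt G) (bij_comp (perm_bij t^-1%g) (galpha_bij G)) (gbeta_bij G).

Lemma gunit0_subproof : bijective (fun x : void + void => match x with
  inl v | inr v => match v return 'I_0 with end end).
Proof. by apply: void_bij; [case=> [] [] | case]. Qed.
Definition gunit0 : graph 0 0 :=
  @Graph 0 0 sfin_void sfin_void sfin_void sfin_void sfin_void sfin_void
    (fun x => match x with inl v | inr v => v end)
    (fun x => match x with inl v | inr v => v end)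
    _ _ gunit0_subproof gunit0_subproof.

Lemma gunit1_subproof : bijective (fun _ : void + unit => ord0 : 'I_1).
Proof.
by exists (fun _ => inr tt) => [[[]|[]]|i] //; rewrite (ord1 i).
Qed.
Definition gunit1 : graph 1 1 :=
  @Graph 1 1 sfin_void sfin_void sfin_void sfin_void sfin_unit sfin_void
    (fun x => match x with inl v | inr v => v end)
    (fun x => match x with inl v | inr v => v end)
    _ _ gunit1_subproof gunit1_subproof.

Definition shuffle A B C D (x : (A + B) + (C + D)) : (A + C) + (B + D) :=
  match x with
  | inl (inl a) => inl (inl a) | inl (inr b) => inr (inl b)
  | inr (inl c) => inl (inr c) | inr (inr d) => inr (inr d)
  end.
Lemma shuffleK A B C D : cancel (@shuffle A B C D) (@shuffle A C B D).
Proof. by case=> [] [] x. Qed.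

Lemma ghcat_bij k k' A B A' B' (f : A + B -> 'I_k) (f' : A' + B' -> 'I_k') :
  bijective f -> bijective f' ->
  bijective (fun x => unsplit (map_sum f f' (@shuffle A A' B B' x))).
Proof.
move=> bf bf'; apply: (bij_comp (f := unsplit)).
  by exists (@split k k'); [exact: unsplitK | exact: splitK].
apply: bij_comp; first exact: map_sum_bij.
by exists (@shuffle A B A' B'); exact: shuffleK.
Qed.

Definition ghcat k l k' l' (G : graph k l) (G' : graph k' l') :
    graph (k + k') (l + l') :=
  @Graph _ _ (sfin_sum (gV G) (gV G')) (sfin_sum (gE G) (gE G'))
    (sfin_sum (gI G) (gI G')) (sfin_sum (gO G) (gO G'))
    (sfin_sum (gIO G) (gIO G')) (sfin_sum (gL G) (gL G'))
    (fun x => map_sum (gs G) (gs G') (shuffle x))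
    (fun x => map_sum (gt G) (gt G') (shuffle x))
    _ _
    (ghcat_bij (galpha_bij G) (galpha_bij G'))
    (ghcat_bij (gbeta_bij G) (gbeta_bij G')).

(* Vertical concatenation of H after G. An edge of the composite is either an *)
(* edge of G or H, or a pair (f, e) of an output or input-output edge f of G *)
(* and an input or input-output edge e of H with the same index. *)
Section Vcat.
Variables (k l m : nat) (H : graph l m) (G : graph k l).

Definition glued_E := sfin_sub (fun p : gO G * gI H =>
  gbeta G (inl p.1) == galpha H (inl p.2)).
Definition glued_I := sfin_sub (fun p : gIO G * gI H =>
  gbeta G (inr p.1) == galpha H (inl p.2)).
Definition glued_O := sfin_sub (fun p : gO G * gIO H =>
  gbeta G (inl p.1) == galpha H (inr p.2)).
Definition glued_IO := sfin_sub (fun p : gIO G * gIO H =>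
  gbeta G (inr p.1) == galpha H (inr p.2)).

Definition vE := sfin_sum (sfin_sum (gE G) (gE H)) glued_E.
Definition vI := sfin_sum (gI G) glued_I.
Definition vO := sfin_sum (gO H) glued_O.

(* The edge of G or H by which an edge of the composite enters its target. *)
Definition vin (x : vE + vI) : (gE G + gI G) + (gE H + gI H) :=
  match x with
  | inl (inl (inl e)) => inl (inl e)
  | inl (inl (inr e)) => inr (inl e)
  | inl (inr p) => inr (inr (sval p).2)
  | inr (inl i) => inl (inr i)
  | inr (inr p) => inr (inr (sval p).2)
  end.

(* The edge of G or H by which an edge of the composite leaves its source. *)
Definition vout (x : vE + vO) : (gE G + gO G) + (gE H + gO H) :=
  match x with
  | inl (inl (inl e)) => inl (inl e)
  | inl (inl (inr e)) => inr (inl e)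
  | inl (inr p) => inl (inr (sval p).1)
  | inr (inl o) => inr (inr o)
  | inr (inr p) => inl (inr (sval p).1)
  end.

Definition valpha_edge (x : vI + glued_IO) : gI G + gIO G :=
  match x with
  | inl (inl i) => inl i
  | inl (inr p) => inr (sval p).1
  | inr p => inr (sval p).1
  end.

Definition vbeta_edge (x : vO + glued_IO) : gO H + gIO H :=
  match x with
  | inl (inl o) => inl o
  | inl (inr p) => inr (sval p).2
  | inr p => inr (sval p).2
  end.

Lemma valpha_edge_bij : bijective valpha_edge.
Proof.
have aI := bij_inj (galpha_bij H).
apply: (@inj_surj_bij (vI + glued_IO)%type (gI G + gIO G)%type).
  move=> [[i|[[g e] /= Eg]]|[[g e] /= Eg]] [[j|[[h f] /= Eh]]|[[h f] /= Eh]] //= [].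
  - by move=> ->.
  - move=> gh; case: _ / gh Eh => Eh.
    have [ef] := aI _ _ (etrans (esym (eqP Eg)) (eqP Eh)).
    by case: _ / ef Eh => Eh; rewrite (bool_irrelevance Eg Eh).
  - move=> gh; case: _ / gh Eh => Eh.
    by have := aI _ _ (etrans (esym (eqP Eg)) (eqP Eh)).
  - move=> gh; case: _ / gh Eh => Eh.
    by have := aI _ _ (etrans (esym (eqP Eg)) (eqP Eh)).
  - move=> gh; case: _ / gh Eh => Eh.
    have [ef] := aI _ _ (etrans (esym (eqP Eg)) (eqP Eh)).
    by case: _ / ef Eh => Eh; rewrite (bool_irrelevance Eg Eh).
move=> [i|g]; first by exists (inl (inl i)).
have [a' _ a'K] := galpha_bij H; have := a'K (gbeta G (inr g)).
case: (a' _) => e /esym/eqP Eg.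
  by exists (inl (inr (exist _ (g, e) Eg))).
by exists (inr (exist _ (g, e) Eg)).
Qed.

Lemma vbeta_edge_bij : bijective vbeta_edge.
Proof.
have bI := bij_inj (gbeta_bij G).
apply: (@inj_surj_bij (vO + glued_IO)%type (gO H + gIO H)%type).
  move=> [[i|[[f g] /= Ef]]|[[f g] /= Ef]] [[j|[[e h] /= Ee]]|[[e h] /= Ee]] //= [].
  - by move=> ->.
  - move=> gh; case: _ / gh Ee => Ee.
    have [fe] := bI _ _ (etrans (eqP Ef) (esym (eqP Ee))).
    by case: _ / fe Ee => Ee; rewrite (bool_irrelevance Ef Ee).
  - move=> gh; case: _ / gh Ee => Ee.
    by have := bI _ _ (etrans (eqP Ef) (esym (eqP Ee))).
  - move=> gh; case: _ / gh Ee => Ee.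
    by have := bI _ _ (etrans (eqP Ef) (esym (eqP Ee))).
  - move=> gh; case: _ / gh Ee => Ee.
    have [fe] := bI _ _ (etrans (eqP Ef) (esym (eqP Ee))).
    by case: _ / fe Ee => Ee; rewrite (bool_irrelevance Ef Ee).
move=> [o|h]; first by exists (inl (inl o)).
have [b' _ b'K] := gbeta_bij G; have := b'K (galpha H (inr h)).
case: (b' _) => f /eqP Ef.
  by exists (inl (inr (exist _ (f, h) Ef))).
by exists (inr (exist _ (f, h) Ef)).
Qed.

Definition gvcat : graph k m :=
  @Graph k m (sfin_sum (gV G) (gV H)) vE vI vO glued_IO
    (sfin_sum (gL G) (gL H))
    (fun x => map_sum (gs G) (gs H) (vout x))
    (fun x => map_sum (gt G) (gt H) (vin x))
    _ _
    (bij_comp (galpha_bij G) valpha_edge_bij)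
    (bij_comp (gbeta_bij H) vbeta_edge_bij).

Lemma vin_inj : injective vin.
Proof.
have bI := bij_inj (gbeta_bij G).
move=> [[[d|d]|[[f e] /= Ee]]|[i|[[f e] /= Ee]]]
       [[[d'|d']|[[h c] /= Ec]]|[j|[[h c] /= Ec]]] //= [].
- by move=> ->.
- by move=> ->.
- move=> ec; case: _ / ec Ec => Ec.
  have [fh] := bI _ _ (etrans (eqP Ee) (esym (eqP Ec))).
  by case: _ / fh Ec => Ec; rewrite (bool_irrelevance Ee Ec).
- move=> ec; case: _ / ec Ec => Ec.
  by have := bI _ _ (etrans (eqP Ee) (esym (eqP Ec))).
- by move=> ->.
- move=> ec; case: _ / ec Ec => Ec.
  by have := bI _ _ (etrans (eqP Ee) (esym (eqP Ec))).
- move=> ec; case: _ / ec Ec => Ec.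
  have [fh] := bI _ _ (etrans (eqP Ee) (esym (eqP Ec))).
  by case: _ / fh Ec => Ec; rewrite (bool_irrelevance Ee Ec).
Qed.

Lemma vout_inj : injective vout.
Proof.
have aI := bij_inj (galpha_bij H).
move=> [[[d|d]|[[f e] /= Ee]]|[i|[[f e] /= Ee]]]
       [[[d'|d']|[[h c] /= Ec]]|[j|[[h c] /= Ec]]] //= [].
- by move=> ->.
- by move=> ->.
- move=> fh; case: _ / fh Ec => Ec.
  have [ec] := aI _ _ (etrans (esym (eqP Ee)) (eqP Ec)).
  by case: _ / ec Ec => Ec; rewrite (bool_irrelevance Ee Ec).
- move=> fh; case: _ / fh Ec => Ec.
  by have := aI _ _ (etrans (esym (eqP Ee)) (eqP Ec)).
- by move=> ->.
- move=> fh; case: _ / fh Ec => Ec.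
  by have := aI _ _ (etrans (esym (eqP Ee)) (eqP Ec)).
- move=> fh; case: _ / fh Ec => Ec.
  have [ec] := aI _ _ (etrans (esym (eqP Ee)) (eqP Ec)).
  by case: _ / ec Ec => Ec; rewrite (bool_irrelevance Ee Ec).
Qed.

End Vcat.

(* Planar graphs. A family of total orders on the fibres of t is given by a *)
(* single relation comparing only elements of the same fibre. *)
Record fiber_order (T V : Type) (t : T -> V) (r : rel T) : Prop := FiberOrder {
  fib_same : forall x y, r x y -> t x = t y;
  fib_total : forall x y, t x = t y -> r x y || r y x;
  fib_anti : antisymmetric r;
  fib_trans : transitive r }.

Definition sum_rel A B (r : rel A) (r' : rel B) : rel (A + B) := fun x y =>
  match x, y with
  | inl a, inl a' => r a a'
  | inr b, inr b' => r' b b'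
  | _, _ => false
  end.

Lemma fiber_order_sum T V T' V' (t : T -> V) (t' : T' -> V') r r' :
  fiber_order t r -> fiber_order t' r' ->
  fiber_order (map_sum t t') (sum_rel r r').
Proof.
case=> s tt a tr [s' tt' a' tr']; split.
- by move=> [x|x] [y|y] //= ?; congr (_ _); [exact: s | exact: s'].
- by move=> [x|x] [y|y] //= []; [exact: tt | exact: tt'].
- by move=> [x|x] [y|y] //= ?; congr (_ _); [exact: a | exact: a'].
- by move=> [x|x] [y|y] [z|z] //=; [exact: tr | exact: tr'].
Qed.

Lemma fiber_order_pull T V T' (t : T -> V) r (h : T' -> T) :
  injective h -> fiber_order t r ->
  fiber_order (fun x => t (h x)) (fun x y => r (h x) (h y)).
Proof.
move=> hI [s tt a tr]; split.
- by move=> x y /s.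
- by move=> x y /tt.
- by move=> x y /a/hI.
- by move=> x y z; exact: tr.
Qed.

Record pgraph (k l : nat) := PGraph {
  pgr :> graph k l;
  ord_in : rel (gE pgr + gI pgr)%type;
  ord_out : rel (gE pgr + gO pgr)%type;
  ord_inP : fiber_order (gt pgr) ord_in;
  ord_outP : fiber_order (gs pgr) ord_out }.
Arguments ord_in {k l} G : rename.
Arguments ord_out {k l} G : rename.

Definition piso k l (G G' : pgraph k l) : Prop :=
  exists f : giso G G',
    (forall x y, ord_in G' (map_sum (isoE f) (isoI f) x) (map_sum (isoE f) (isoI f) y)
       = ord_in G x y) /\
    (forall x y, ord_out G' (map_sum (isoE f) (isoO f) x) (map_sum (isoE f) (isoO f) y)
       = ord_out G x y).

Definition plact k l (s : 'S_l) (G : pgraph k l) : pgraph k l :=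
  @PGraph k l (glact s G) (ord_in G) (ord_out G) (ord_inP G) (ord_outP G).

Definition pract k l (G : pgraph k l) (t : 'S_k) : pgraph k l :=
  @PGraph k l (gract G t) (ord_in G) (ord_out G) (ord_inP G) (ord_outP G).

Lemma void_order (A V : Type) (t : A -> V) (r : rel A) :
  (A -> False) -> fiber_order t r.
Proof. by move=> A0; split=> x; case: (A0 x). Qed.

Lemma sum_void : (void + void)%type -> False.
Proof. by case=> [] []. Qed.

Definition punit0 : pgraph 0 0 :=
  @PGraph 0 0 gunit0 (fun _ _ => false) (fun _ _ => false)
    (void_order _ _ sum_void) (void_order _ _ sum_void).

Definition punit1 : pgraph 1 1 :=
  @PGraph 1 1 gunit1 (fun _ _ => false) (fun _ _ => false)
    (void_order _ _ sum_void) (void_order _ _ sum_void).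

Definition phcat k l k' l' (G : pgraph k l) (G' : pgraph k' l') :
    pgraph (k + k') (l + l') :=
  @PGraph _ _ (ghcat G G') _ _
    (fiber_order_pull (can_inj (@shuffleK _ _ _ _))
      (fiber_order_sum (ord_inP G) (ord_inP G')))
    (fiber_order_pull (can_inj (@shuffleK _ _ _ _))
      (fiber_order_sum (ord_outP G) (ord_outP G'))).

Definition pvcat k l m (H : pgraph l m) (G : pgraph k l) : pgraph k m :=
  @PGraph k m (gvcat H G) _ _
    (fiber_order_pull (@vin_inj k l m H G)
      (fiber_order_sum (ord_inP G) (ord_inP H)))
    (fiber_order_pull (@vout_inj k l m H G)
      (fiber_order_sum (ord_outP G) (ord_outP H))).

Lemma corolla_bij k : bijective (fun x : below k + void =>
  match x with inl i => ord_below i | inr v => match v with end end).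
Proof.
exists (fun i => inl (below_ord i)) => [[i|[]]|i].
  by rewrite ord_belowK.
exact: below_ordK.
Qed.

Definition corolla_graph k l : graph k l :=
  @Graph k l sfin_unit sfin_void (sfin_below k) (sfin_below l) sfin_void sfin_void
    (fun _ => tt) (fun _ => tt) _ _ (corolla_bij k) (corolla_bij l).

Definition corolla_rel k : rel (void + below k) := fun x y =>
  match x, y with
  | inr i, inr j => (ord_below i <= ord_below j)%N
  | _, _ => false
  end.

Lemma corolla_order k : fiber_order (fun _ : void + below k => tt) (@corolla_rel k).
Proof.
split=> //.
- by move=> [[]|i] [[]|j] _; exact: leq_total.
- move=> [[]|i] [[]|j] /anti_leq ij; congr inr.
  by apply: (can_inj (@ord_belowK k)); apply: val_inj.
- by move=> [[]|i] [[]|j] [[]|h]; exact: leq_trans.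
Qed.

Definition corolla k l : pgraph k l :=
  @PGraph k l (corolla_graph k l) _ _ (corolla_order k) (corolla_order l).

Definition card_sfin (A : sfin) : nat := #|{: A}|.

Definition single_loop k l (G : graph k l) : Prop :=
  [/\ card_sfin (gV G) = 0, card_sfin (gE G) = 0, card_sfin (gI G) = 0,
      card_sfin (gO G) = 0 & card_sfin (gIO G) = 0 /\ card_sfin (gL G) = 1]%N.

(* Equality of graphs in the last two conditions is isomorphism. The graph *)
(* reduced to a single loop has no vertex, but it must count as indecomposable: *)
(* no composite of loopless graphs has a loop, so that without it the *)
(* indecomposable graphs would not generate all graphs. *)
Record indecomposable k l (G : graph k l) : Prop := Indecomposable {
  ind_vertex : card_sfin (gV G) <> 0%N \/ single_loop G;
  ind_IO : card_sfin (gIO G) = 0%N;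
  ind_loop : card_sfin (gL G) = 0%N \/ single_loop G;
  ind_vcat : forall m (G' : graph m l) (G'' : graph k m),
    isomorphic G (gvcat G' G'') ->
    card_sfin (gV G') = 0%N \/ card_sfin (gV G'') = 0%N;
  ind_hcat : forall k' l' k'' l'' (G' : graph k' l') (G'' : graph k'' l'')
      (s : 'S_(l' + l'')) (t : 'S_(k' + k'')),
    isomorphic G (glact s (gract (ghcat G' G'') t)) ->
    card_sfin (gV G') = 0%N \/ card_sfin (gV G'') = 0%N }.

Definition has_cycle k l (G : graph k l) : Prop :=
  exists2 c : seq (gE G), c != [::] &
    path.cycle (fun e e' => gt G (inl e) == gs G (inl e')) c.

Definition acyclic k l (G : graph k l) : Prop :=
  ~ has_cycle G /\ card_sfin (gL G) = 0%N.

HB.instance Definition _ k l := gen_eqMixin (pgraph k l).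
HB.instance Definition _ k l := gen_choiceMixin (pgraph k l).

Definition pisob k l : rel (pgraph k l) := fun G G' => `[< piso G G' >].

Lemma map_sum_comp A B A' B' A'' B'' (f : A -> A') (g : B -> B')
    (f' : A' -> A'') (g' : B' -> B'') x :
  map_sum (fun a => f' (f a)) (fun b => g' (g b)) x = map_sum f' g' (map_sum f g x).
Proof. by case: x. Qed.

Lemma map_sum_id A B (x : A + B) : map_sum id id x = x.
Proof. by case: x. Qed.

Lemma piso_refl k l (G : pgraph k l) : piso G G.
Proof.
have idb T : bijective (@id T) by exists id.
unshelve eexists.
  by refine (@GIso _ _ _ _ G G id id id id id id _ _ _ _ _ _ _ _ _ _) => // x;
     rewrite map_sum_id.
by split=> x y; rewrite /= !map_sum_id.
Qed.

Lemma piso_sym k l (G G' : pgraph k l) : piso G G' -> piso G' G.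
Proof.
case=> [[fV fE fI fO fIO fL [gV VK KV] [gE EK KE] [gI IK KI] [gO OK KO]
  [gIO IOK KIO] [gL LK KL] fs ft fa fb]] /= [oi oo].
have mK A B A' B' (f : A -> A') (g : B -> B') f' g' :
    cancel f' f -> cancel g' g -> cancel (map_sum f' g') (map_sum f g).
  by move=> fK gK [] x /=; rewrite ?fK ?gK.
unshelve eexists.
  refine (@GIso _ _ _ _ G' G gV gE gI gO gIO gL _ _ _ _ _ _ _ _ _ _);
    try by [exists fV | exists fE | exists fI | exists fO | exists fIO | exists fL].
  - by move=> x; apply: (can_inj VK); rewrite -fs mK.
  - by move=> x; apply: (can_inj VK); rewrite -ft mK.
  - by move=> x; rewrite -fa mK.
  - by move=> x; rewrite -fb mK.
by split=> x y; rewrite /= -?oi -?oo !mK.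
Qed.

Lemma piso_trans k l (G G' G'' : pgraph k l) : piso G G' -> piso G' G'' -> piso G G''.
Proof.
case=> f [fi fo] [g [gi go]].
unshelve eexists.
  refine (@GIso _ _ _ _ G G'' (isoV g \o isoV f) (isoE g \o isoE f)
   (isoI g \o isoI f) (isoO g \o isoO f) (isoIO g \o isoIO f) (isoL g \o isoL f)
   _ _ _ _ _ _ _ _ _ _).
  1-6: by apply: bij_comp; [case: g {gi go} | case: f {fi fo}].
  1-4: move=> x; rewrite map_sum_comp.
  - by rewrite (iso_s g) (iso_s f).
  - by rewrite (iso_t g) (iso_t f).
  - by rewrite (iso_alpha g) (iso_alpha f).
  - by rewrite (iso_beta g) (iso_beta f).
split=> x y /=.
- by rewrite !(map_sum_comp (isoE f) (isoI f) (isoE g) (isoI g)) gi fi.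
- by rewrite !(map_sum_comp (isoE f) (isoO f) (isoE g) (isoO g)) go fo.
Qed.

Lemma pisob_equiv k l : equiv_class_of (@pisob k l).
Proof.
split.
- by move=> G; apply/asboolP/piso_refl.
- by move=> G G'; apply/asboolP/asboolP; exact: piso_sym.
- by move=> G' G G'' /asboolP h /asboolP h'; apply/asboolP/(piso_trans h h').
Qed.
Canonical pisob_rel k l := EquivRelPack (@pisob_equiv k l).

Definition isoclass k l := {eq_quot (@pisob_rel k l)}.
HB.instance Definition _ k l := Choice.on (isoclass k l).
HB.instance Definition _ k l := EqQuotient.on (isoclass k l).

Definition rep k l (c : isoclass k l) : pgraph k l := generic_quotient.repr c.

Section PGr.
Variable K : fieldType.

Definition lin_ext (A B : choiceType) (f : A -> B) (x : {malg K[A]}) : {malg K[B]} :=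
  \sum_(a <- msupp x) << x@_a *g f a >>.

Definition bilin_ext (A B C : choiceType) (f : A -> B -> C)
    (x : {malg K[A]}) (y : {malg K[B]}) : {malg K[C]} :=
  \sum_(a <- msupp x) \sum_(b <- msupp y) << x@_a * y@_b *g f a b >>.

Definition pgr_vec k l (G : pgraph k l) : {malg K[isoclass k l]} :=
  << \pi_(isoclass k l) G >>.

(* Operations on isoclasses are computed on chosen representatives; the result *)
(* does not depend on the choice. *)
Definition PGr : proPData K := @ProPData K
  (fun k l => {malg K[isoclass k l]})
  (fun k l s => lin_ext (fun c : isoclass k l => \pi_(isoclass k l) (plact s (rep c))))
  (fun k l x t =>
    lin_ext (fun c : isoclass k l => \pi_(isoclass k l) (pract (rep c) t)) x)
  (fun k l k' l' => bilin_ext (fun (c : isoclass k l) (d : isoclass k' l') =>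
    \pi_(isoclass (k + k') (l + l')) (phcat (rep c) (rep d))))
  (fun k l m => bilin_ext (fun (c : isoclass l m) (d : isoclass k l) =>
    \pi_(isoclass k m) (pvcat (rep c) (rep d))))
  (pgr_vec punit0)
  (pgr_vec punit1).

Definition PGr_ind : family PGr := fun k l =>
  lspan [set x | exists2 G : pgraph k l, indecomposable G & x = pgr_vec G].

Definition PGr_up : family PGr := fun k l =>
  lspan [set x | exists2 G : pgraph k l, acyclic G & x = pgr_vec G].

Definition PG k l : PGr k l := pgr_vec (corolla k l).

Definition PGr_up_ind : family PGr := fun k l =>
  lspan [set x | exists (s : 'S_l) (t : 'S_k), x = lact s (ract (PG k l) t)].

End PGr.

(* Main.v *)
(** A planar graph is encoded by its vertices, its half-edges and one bijection,
    from inputs and outgoing half-edges to outputs and incoming half-edges; composing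
    graphs composes these bijections, and isomorphisms reduce to bijections of vertices
    and half-edges that commute with them. Loops become vertices without half-edges, so
    that the indecomposable graphs are exactly the strongly connected ones without
    input-output edges.

    Inputs and outputs are indexed by finite sets rather than by integers, for graphs and,
    by relabelling, for an arbitrary ProP. A minimal nonempty set of vertices closed under
    predecessors can be peeled off a graph G, that is, G = H o (a * id) with a
    indecomposable; iterating, G is evaluated in the target ProP. The value does not
    depend on the choices: two such sets coincide or are disjoint; in the first case the
    two decompositions differ by a relabelling, and in the second case both sets can be
    peeled off, in either order, with the same value by the interchange law. That a
    decomposition is determined by the peeled set up to relabelling is seen by marking
    the vertices of this set, isomorphisms preserving marks. For acyclic graphs the
    strongly connected components are single vertices, and the order at a vertex leaves no
    symmetry to a corolla, whence the free module. *)
From mathcomp Require Import all_boot all_fingroup all_algebra.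
From mathcomp Require Import finmap boolp monalg.
Require Import Defs.

Set Implicit Arguments.
Unset Strict Implicit.
Unset Printing Implicit Defensive.

Import GRing.Theory.
Local Open Scope ring_scope.
Local Open Scope quotient_scope.

(** * Bijections and set-indexed ProPs *)

(** Peeling cuts the inputs into a part [A] that feeds the peeled atom and a part [R] that passes
    beside it. Neither has a preferred numbering, hence the indexing by finite sets. An atom may
    also have symmetries that permute its inputs and outputs; no choice is canonical there, and the
    equivariance of the given module morphism is what makes any choice harmless. Evaluation is
    therefore a relation, proved total and single-valued by induction on the number of vertices,
    rather than a recursive function that chooses at each stage. Decompositions are rigid because no
    wire crosses an atom from input to output: [A] consists of the inputs that enter the peeled set,
    [B] of the outgoing half-edges that leave it, and [R] is the rest. The argument is run once, for
    a class of graphs stable under the operations and under taking both parts of a peeling; all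
    graphs, and the graphs with a rank function, are its two instances. Bijections carry their
    inverses as data because wirings are read in both directions. *)

Record bij (A B : Type) := Bij {
  bfun :> A -> B; binv : B -> A; bK : cancel bfun binv; bVK : cancel binv bfun }.

Lemma bij_ext A B (f g : bij A B) : f =1 g -> f = g.
Proof.
case: f g => [f f' fK fVK] [g g' gK gVK] /= /funext fg; subst g.
have e : f' = g' by apply/funext => x; rewrite -[x in LHS]gVK fK.
subst g'; by rewrite (Prop_irrelevance fK gK) (Prop_irrelevance fVK gVK).
Qed.

Lemma bij_inj_fun A B (f : bij A B) : injective f.
Proof. exact: can_inj (bK f). Qed.

Lemma bij_bijective A B (f : bij A B) : bijective f.
Proof. exists (binv f); [exact: bK | exact: bVK]. Qed.

Lemma bijectiveP A B (f : A -> B) : bijective f -> {g : bij A B | bfun g = f}.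
Proof.
move=> bf; apply: cid; case: bf => g fK gK.
by exists (Bij fK gK).
Qed.

Definition bid A : bij A A := @Bij A A id id (fun=> erefl) (fun=> erefl).
Definition bcomp A B C (g : bij B C) (f : bij A B) : bij A C :=
  Bij (can_comp (bK g) (bK f)) (can_comp (bVK f) (bVK g)).
Definition bsym A B (f : bij A B) : bij B A := Bij (bVK f) (bK f).

Lemma map_sumK A B A' B' (f : A -> A') (g : B -> B') f' g' :
  cancel f f' -> cancel g g' -> cancel (map_sum f g) (map_sum f' g').
Proof. by move=> fK gK [] x /=; rewrite ?fK ?gK. Qed.

Definition bsum A B A' B' (f : bij A A') (g : bij B B') : bij (A + B) (A' + B') :=
  Bij (map_sumK (bK f) (bK g)) (map_sumK (bVK f) (bVK g)).

Definition sumA A B C (x : A + (B + C)) : (A + B) + C :=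
  match x with
  | inl a => inl (inl a) | inr (inl b) => inl (inr b) | inr (inr c) => inr c
  end.
Definition sumAV A B C (x : (A + B) + C) : A + (B + C) :=
  match x with
  | inl (inl a) => inl a | inl (inr b) => inr (inl b) | inr c => inr (inr c)
  end.
Lemma sumAK A B C : cancel (@sumA A B C) (@sumAV A B C).
Proof. by case=> [|[]]. Qed.
Lemma sumAVK A B C : cancel (@sumAV A B C) (@sumA A B C).
Proof. by case=> [[]|]. Qed.
Definition bsumA A B C : bij (A + (B + C)) ((A + B) + C) :=
  Bij (@sumAK A B C) (@sumAVK A B C).

Definition sumC A B (x : A + B) : B + A :=
  match x with inl a => inr a | inr b => inl b end.
Lemma sumCK A B : cancel (@sumC A B) (@sumC B A).
Proof. by case. Qed.
Definition bsumC A B : bij (A + B) (B + A) := Bij (@sumCK A B) (@sumCK B A).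

Definition sum0 A (x : void + A) : A :=
  match x with inl v => match v with end | inr a => a end.
Lemma sum0K A : cancel (@sum0 A) inr.
Proof. by case=> [[]|]. Qed.
Definition bsum0 A : bij (void + A) A := Bij (@sum0K A) (fun=> erefl).

Definition sumCA A B C (x : A + (B + C)) : B + (A + C) :=
  match x with
  | inl a => inr (inl a) | inr (inl b) => inl b | inr (inr c) => inr (inr c)
  end.
Lemma sumCAK A B C : cancel (@sumCA A B C) (@sumCA B A C).
Proof. by case=> [|[]]. Qed.
Definition bsumCA A B C : bij (A + (B + C)) (B + (A + C)) :=
  Bij (@sumCAK A B C) (@sumCAK B A C).

(** Indices are [finType] structures and not carriers, so the structures themselves need names in
    statements. *)
Notation fsum := Datatypes_sum__canonical__fintype_Finite.
Notation fvoid := Datatypes_Empty_set__canonical__fintype_Finite.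
Notation ford := fintype_ordinal__canonical__fintype_Finite.

(* A ProP whose inputs and outputs are indexed by finite sets, the symmetric *)
(* group actions being replaced by relabelling along bijections. *)
Record setProP := SetProP {
  sD :> finType -> finType -> Type;
  srl : forall (X Y X' Y' : finType), bij X X' -> bij Y Y' -> sD X Y -> sD X' Y';
  shc : forall (X Y X' Y' : finType), sD X Y -> sD X' Y' -> sD (fsum X X') (fsum Y Y');
  svc : forall (X Y Z : finType), sD Y Z -> sD X Y -> sD X Z;
  sid : forall X, sD X X;
  srl1 : forall (X Y : finType) (p : sD X Y), srl (bid X) (bid Y) p = p;
  srlM : forall (X Y X' Y' X'' Y'' : finType) (f' : bij X' X'') (g' : bij Y' Y'')
    (f : bij X X') (g : bij Y Y') (p : sD X Y),
    srl f' g' (srl f g p) = srl (bcomp f' f) (bcomp g' g) p;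
  svc_rl : forall (X Y Z X' Y' Z' : finType) (f : bij X X') (g : bij Y Y') (h : bij Z Z') p q,
    svc (srl g h p) (srl f g q) = srl f h (svc p q);
  shc_rl : forall (X Y X' Y' U V U' V' : finType) (f : bij X X') (g : bij Y Y')
    (f' : bij U U') (g' : bij V V') p q,
    shc (srl f g p) (srl f' g' q) = srl (bsum f f') (bsum g g') (shc p q);
  srl_id : forall (X Y : finType) (f : bij X Y), srl f f (sid X) = sid Y;
  svcA : forall (X Y Z T : finType) (p : sD Z T) (q : sD Y Z) (r : sD X Y),
    svc p (svc q r) = svc (svc p q) r;
  svc1l : forall (X Y : finType) (p : sD X Y), svc (sid Y) p = p;
  svc1r : forall (X Y : finType) (p : sD X Y), svc p (sid X) = p;
  shc_id : forall (X Y : finType), shc (sid X) (sid Y) = sid (fsum X Y);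
  sxch : forall (X Y Z X' Y' Z' : finType) (p : sD Y Z) (p' : sD Y' Z') (q : sD X Y)
      (q' : sD X' Y'),
    svc (shc p p') (shc q q') = shc (svc p q) (svc p' q');
  shcA : forall (X Y X' Y' X'' Y'' : finType) (p : sD X Y) (q : sD X' Y') (r : sD X'' Y''),
    srl (bsumA X X' X'') (bsumA Y Y' Y'') (shc p (shc q r)) = shc (shc p q) r;
  shc0l : forall (X Y : finType) (p : sD X Y), srl (bsum0 X) (bsum0 Y) (shc (sid fvoid) p) = p;
  shcC : forall (X Y X' Y' : finType) (p : sD X Y) (q : sD X' Y'),
    srl (bsumC X X') (bsumC Y Y') (shc p q) = shc q p }.

Arguments srl {s X Y X' Y'}.
Arguments shc {s X Y X' Y'}.
Arguments svc {s X Y Z}.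
Arguments sid {s}.

Ltac sum_case := repeat match goal with
  | x : ?T |- _ => let T' := eval hnf in T in
      match T' with (_ + _)%type => destruct x | Empty_set => destruct x end end.
Ltac bij_bash := apply: bij_ext => x; sum_case; rewrite /= ?bK ?bVK //=.

(** * Relabelling and peeling in a set-indexed ProP *)

Section SPropTheory.
Variable D : setProP.
Implicit Types X Y Z R S : finType.

Lemma bcomp1r A B (f : bij A B) : bcomp f (bid A) = f. Proof. exact: bij_ext. Qed.
Lemma bcomp1l A B (f : bij A B) : bcomp (bid B) f = f. Proof. exact: bij_ext. Qed.
Lemma bcompVr A B (f : bij A B) : bcomp f (bsym f) = bid B.
Proof. by apply: bij_ext => x /=; rewrite bVK. Qed.
Lemma bcompVl A B (f : bij A B) : bcomp (bsym f) f = bid A.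
Proof. by apply: bij_ext => x /=; rewrite bK. Qed.

Lemma srlK (X Y X' Y' : finType) (f : bij X X') (g : bij Y Y') (p : D X Y) :
  srl (bsym f) (bsym g) (srl f g p) = p.
Proof. by rewrite srlM !bcompVl srl1. Qed.

Lemma svc_lrl (X Y Z Z' : finType) (h : bij Z Z') (p : D Y Z) (q : D X Y) :
  svc (srl (bid Y) h p) q = srl (bid X) h (svc p q).
Proof. by rewrite -(svc_rl (bid X) (bid Y)) srl1. Qed.

Lemma svc_rrl (X Y Z X' : finType) (f : bij X X') (p : D Y Z) (q : D X Y) :
  svc p (srl f (bid Y) q) = srl f (bid Z) (svc p q).
Proof. by rewrite -(svc_rl f (bid Y)) srl1. Qed.

(** The set-indexed form of [(p . tau) o q = p o (tau . q)]: a renaming of the middle interface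
    passes from one factor to the other. *)
Lemma svc_mrl (X Y Y' Z : finType) (f : bij Y Y') (p : D Y' Z) (q : D X Y) :
  svc p (srl (bid X) f q) = svc (srl (bsym f) (bid Z) p) q.
Proof.
rewrite -[RHS]srl1 -(svc_rl (bid X) f (bid Z)) srlM.
by rewrite bcompVr bcomp1l srl1.
Qed.

Lemma srl_split (X Y X' Y' : finType) (f : bij X X') (g : bij Y Y') (p : D X Y) :
  srl f g p = srl f (bid _) (srl (bid _) g p).
Proof. by rewrite srlM bcomp1r bcomp1l. Qed.

(** A bijection seen as an operation. Among graphs these are the classes without vertices
    ([gsize0]), the base case of evaluation. *)
Definition sperm (X Y : finType) (f : bij X Y) : D X Y := srl (bid X) f (sid X).

Lemma srl_sperm (X Y X' Y' : finType) (f : bij X X') (g : bij Y Y') (h : bij X Y) :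
  srl f g (sperm h) = sperm (bcomp (bcomp g h) (bsym f)).
Proof.
rewrite /sperm srlM bcomp1r -(srl_id D f) srlM bcomp1l; congr srl.
by bij_bash.
Qed.

Lemma svc_sperm (X Y Z : finType) (p : D Y Z) (f : bij X Y) :
  svc p (sperm f) = srl (bsym f) (bid Z) p.
Proof. by rewrite /sperm svc_mrl svc1r. Qed.

Lemma shc_sperm_id (X Y R : finType) (f : bij X Y) :
  shc (sperm f) (sid R) = sperm (bsum f (bid R)).
Proof.
rewrite /sperm -[sid R](srl1) shc_rl shc_id; congr srl; bij_bash.
Qed.

(* h after a, the edges in R avoiding a; f names the inputs. *)
Definition scons (X Y A B R : finType) (f : bij (A + R) X) (h : D (fsum B R) Y) (a : D A B) :
    D X Y :=
  srl f (bid Y) (svc h (shc a (sid R))).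

Lemma srl_scons (X Y X' Y' A B R : finType) (f : bij (A + R) X) (h : D (fsum B R) Y) (a : D A B)
    (u : bij X X') (v : bij Y Y') :
  srl u v (scons f h a) = scons (bcomp u f) (srl (bid _) v h) a.
Proof. by rewrite /scons srlM svc_lrl srlM !bcomp1r bcomp1l. Qed.

Lemma svc_scons (X Y Z A B R : finType) (f : bij (A + R) X) (h : D (fsum B R) Y) (a : D A B)
    (p : D Y Z) :
  svc p (scons f h a) = scons f (svc p h) a.
Proof. by rewrite /scons svc_rrl svcA. Qed.

(** The names of the three interfaces [A], [B], [R] of a peeling are arbitrary, and this is the
    invariance under their change; it is what makes [same_dec] preserve values. *)
Lemma scons_rl (X Y A B R A' B' R' : finType) (f : bij (A + R) X) (h : D (fsum B R) Y) (a : D A B)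
    (u : bij A A') (v : bij B B') (w : bij R R') :
  scons (bcomp f (bsym (bsum u w))) (srl (bsum v w) (bid Y) h) (srl u v a) = scons f h a.
Proof.
rewrite /scons -(srl_id D w) shc_rl svc_rl srlM bcomp1l; congr srl.
by apply: bij_ext => x /=; rewrite (map_sumK (bK u) (bK w)).
Qed.

Lemma scons_rlr (X Y A B R R' : finType) (f : bij (A + R) X) (h : D (fsum B R) Y)
    (a : D A B) (w : bij R' R) :
  scons f h a =
  scons (bcomp f (bsum (bid A) w)) (srl (bsum (bid B) (bsym w)) (bid Y) h) a.
Proof.
rewrite -[LHS](scons_rl f h a (bid A) (bid B) (bsym w)) srl1.
congr scons; exact: bij_ext.
Qed.

(** By interchange, the wires [S] placed on the side join the wires [R] that avoid [a], so a peeling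
    beside an identity is again a peeling of the same [a]. *)
Lemma shc_scons_id (X Y A B R S : finType) (f : bij (A + R) X) (h : D (fsum B R) Y) (a : D A B) :
  shc (scons f h a) (sid S) =
  scons (bcomp (bsum f (bid S)) (bsumA A R S))
    (srl (bsym (bsumA B R S)) (bid _) (shc h (sid S))) a.
Proof.
rewrite /scons -{1}[sid S]srl1 shc_rl -{1}[sid S](svc1l) -sxch.
rewrite -shcA shc_id.
rewrite [in X in svc _ X]srl_split. rewrite svc_rrl svc_mrl.
rewrite srlM bcomp1r; congr srl.
by bij_bash.
Qed.

(** Acting with [q] and then with [p], each beside an identity, turns horizontal concatenation into
    a vertical one; evaluation then has to be compared only with [shc _ (sid _)]. *)
Lemma shc_split (X Y X' Y' : finType) (p : D X Y) (q : D X' Y') :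
  shc p q = svc (shc p (sid Y')) (srl (bsumC _ _) (bsumC _ _) (shc q (sid X))).
Proof. by rewrite shcC sxch svc1r svc1l. Qed.

Lemma shcCA (X1 Y1 X2 Y2 X3 Y3 : finType) (p : D X1 Y1) (q : D X2 Y2) (r : D X3 Y3) :
  shc q (shc p r) = srl (bsumCA _ _ _) (bsumCA _ _ _) (shc p (shc q r)).
Proof.
apply: (can_inj (srlK (bsumA _ _ _) (bsumA _ _ _))).
rewrite shcA -(shcC p q) -[r in LHS]srl1 shc_rl -shcA !srlM.
by congr srl; bij_bash.
Qed.

(* Vertices peeled off one after the other commute when the second ones are not fed *)
(* by the first ones. *)
Lemma scons_swap (Y A B A' B' S : finType) (z : D (fsum B' (fsum B S)) Y) (a : D A B)
    (b : D A' B') :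
  scons (bid _) (scons (bsumCA A' B S) z b) a =
  scons (bsumCA A' A S)
    (scons (bsumCA A B' S) (srl (bsumCA B' B S) (bid Y) z) a) b.
Proof.
(* Two successive peelings merge, by interchange, into one composite with [p], [q] and [sid S] side
   by side. After this, both sides of the lemma differ only by the exchange [shcCA]. *)
have key (A1 B1 A2 B2 : finType) (p : D A1 B1) (q : D A2 B2) (y : D (fsum B2 (fsum B1 S)) Y) :
    svc (srl (bsumCA A2 B1 S) (bid Y) (svc y (shc q (sid (fsum B1 S)))))
       (shc p (sid (fsum A2 S)))
    = svc (srl (bsumCA _ _ _) (bid Y) y) (shc p (shc q (sid S))).
  have -> : shc q (sid (fsum B1 S)) =
      srl (bsumCA _ _ _) (bsumCA _ _ _) (shc (sid B1) (shc q (sid S))).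
    rewrite -shc_id.
    by rewrite shcCA.
  rewrite [in svc y _]srl_split svc_rrl svc_mrl srlM bcomp1r.
  rewrite (_ : bcomp _ _ = bid _); last by bij_bash.
  rewrite srl1 -shc_id -svcA sxch svc1l.
  rewrite (_ : bsym _ = bsumCA _ _ _); last by bij_bash.
  by rewrite sxch svc1l svc1r.
rewrite /scons !key !srlM bcomp1r (_ : bcomp _ _ = bid _); last by bij_bash.
rewrite !srl1.
rewrite (_ : shc b (shc a (sid S)) =
  srl (bsumCA _ _ _) (bsumCA _ _ _) (shc a (shc b (sid S)))).
  rewrite (srl_split (bsumCA _ _ _) (bsumCA _ _ _)) svc_rrl svc_mrl srlM (_ : bcomp _ _ = bid _);
      last by bij_bash.
  by rewrite bcomp1r srl1 (_ : bsym _ = bsumCA _ _ _); last by bij_bash.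
exact: shcCA.
Qed.

Lemma scons_swap_at (X Y A B A' B' S : finType) (F : bij (A + (A' + S)) X)
    (z : D (fsum B' (fsum B S)) Y) (a : D A B) (b : D A' B') :
  scons F (scons (bsumCA A' B S) z b) a =
  scons (bcomp F (bsumCA A' A S))
    (scons (bsumCA A B' S) (srl (bsumCA B' B S) (bid Y) z) a) b.
Proof.
have := congr1 (srl F (bid Y)) (scons_swap z a b).
by rewrite !srl_scons bcomp1r !bcomp1l !srl1.
Qed.

End SPropTheory.

(** * Port graphs *)

Definition sum_case A B C (f : A -> C) (g : B -> C) (x : A + B) : C :=
  match x with inl a => f a | inr b => g b end.

(* The vertices of a graph with their half-edges: the loops are kept as *)
(* additional vertices, without half-edges and flagged by bloop. The marks *)
(* are used to follow sets of vertices through isomorphisms. *)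
Record body (C : Type) := Body {
  bU : finType; bOut : finType; bIn : finType;
  bmark : bU -> C; bloop : pred bU;
  bsrc : bOut -> bU; btgt : bIn -> bU; bro : rel bOut; bri : rel bIn;
  bsrcP : forall o, ~~ bloop (bsrc o); btgtP : forall i, ~~ bloop (btgt i);
  broP : fiber_order bsrc bro; briP : fiber_order btgt bri }.

Record biso C (B B' : body C) := BIso {
  fU : bij (bU B) (bU B'); fO : bij (bOut B) (bOut B'); fI : bij (bIn B) (bIn B');
  fmark : forall u, bmark (fU u) = bmark u;
  floop : forall u, bloop (fU u) = bloop u;
  fsrc : forall o, bsrc (fO o) = fU (bsrc o);
  ftgt : forall i, btgt (fI i) = fU (btgt i);
  fro : forall o o', bro (fO o) (fO o') = bro o o';
  fri : forall i i', bri (fI i) (fI i') = bri i i' }.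

Lemma void_fiber (V : Type) (t : void -> V) (r : rel void) : fiber_order t r.
Proof. by split=> [[]|[]|[]|[]]. Qed.

Definition bbody0 C : body C :=
  @Body C fvoid fvoid fvoid (fun v => match v with end) xpred0
    (fun v => match v with end) (fun v => match v with end)
    (fun _ _ => false) (fun _ _ => false)
    (fun v => match v with end) (fun v => match v with end)
    (void_fiber _ _) (void_fiber _ _).

Lemma sum_loopP A B U V (s : A -> U) (s' : B -> V) (l : pred U) (l' : pred V) :
  (forall o, ~~ l (s o)) -> (forall o, ~~ l' (s' o)) ->
  forall o, ~~ sum_case l l' (map_sum s s' o).
Proof. by move=> h h' []. Qed.

Definition bbodyD C (B B' : body C) : body C :=
  @Body C (fsum (bU B) (bU B')) (fsum (bOut B) (bOut B')) (fsum (bIn B) (bIn B'))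
    (sum_case (@bmark C B) (@bmark C B')) (sum_case (@bloop C B) (@bloop C B'))
    (map_sum (@bsrc C B) (@bsrc C B')) (map_sum (@btgt C B) (@btgt C B'))
    (sum_rel (@bro C B) (@bro C B')) (sum_rel (@bri C B) (@bri C B'))
    (sum_loopP (@bsrcP C B) (@bsrcP C B')) (sum_loopP (@btgtP C B) (@btgtP C B'))
    (fiber_order_sum (@broP C B) (@broP C B')) (fiber_order_sum (@briP C B) (@briP C B')).

Section BodyIso.
Variable C : Type.
Implicit Types B : body C.

Definition biso1 B : biso B B.
Proof. by exists (bid _) (bid _) (bid _). Defined.

Definition bisoV B B' (f : biso B B') : biso B' B.
Proof.
exists (bsym (fU f)) (bsym (fO f)) (bsym (fI f)) => [u|u|o|i|o o'|i i'] /=.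
- by rewrite -(fmark f) bVK.
- by rewrite -(floop f) bVK.
- by apply: (bij_inj_fun (f := fU f)); rewrite -fsrc !bVK.
- by apply: (bij_inj_fun (f := fU f)); rewrite -ftgt !bVK.
- by rewrite -(fro f) !bVK.
- by rewrite -(fri f) !bVK.
Defined.

Definition bisoM B B' B'' (g : biso B' B'') (f : biso B B') : biso B B''.
Proof.
exists (bcomp (fU g) (fU f)) (bcomp (fO g) (fO f)) (bcomp (fI g) (fI f))
  => [u|u|o|i|o o'|i i'] /=.
- by rewrite !fmark.
- by rewrite !floop.
- by rewrite !fsrc.
- by rewrite !ftgt.
- by rewrite !fro.
- by rewrite !fri.
Defined.

Definition bisoD B1 B1' B2 B2' (f : biso B1 B1') (g : biso B2 B2') :
  biso (bbodyD B1 B2) (bbodyD B1' B2').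
Proof.
exists (bsum (fU f) (fU g)) (bsum (fO f) (fO g)) (bsum (fI f) (fI g))
  => [[u|u]|[u|u]|[o|o]|[i|i]|[o|o] [o'|o']|[i|i] [i'|i']] //=.
all: rewrite ?fmark ?floop ?fsrc ?ftgt ?fro ?fri //.
Defined.

Definition bisoA B1 B2 B3 : biso (bbodyD B1 (bbodyD B2 B3)) (bbodyD (bbodyD B1 B2) B3).
Proof.
by exists (bsumA _ _ _) (bsumA _ _ _) (bsumA _ _ _)
  => [[u|[u|u]]|[u|[u|u]]|[o|[o|o]]|[i|[i|i]]|[o|[o|o]] [o'|[o'|o']]|[i|[i|i]] [i'|[i'|i']]].
Defined.

Definition bisoC B1 B2 : biso (bbodyD B1 B2) (bbodyD B2 B1).
Proof.
by exists (bsumC _ _) (bsumC _ _) (bsumC _ _)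
  => [[u|u]|[u|u]|[o|o]|[i|i]|[o|o] [o'|o']|[i|i] [i'|i']].
Defined.

Definition biso0 B : biso (bbodyD (bbody0 C) B) B.
Proof.
by exists (bsum0 _) (bsum0 _) (bsum0 _)
  => [[[]|u]|[[]|u]|[[]|o]|[[]|i]|[[]|o] [[]|o']|[[]|i] [[]|i']].
Defined.

Definition bshuffle U1 U2 U3 U4 : bij ((U1 + U2) + (U3 + U4)) ((U1 + U3) + (U2 + U4)) :=
  Bij (@shuffleK U1 U2 U3 U4) (@shuffleK U1 U3 U2 U4).

Definition bisoX B1 B2 B3 B4 :
  biso (bbodyD (bbodyD B1 B2) (bbodyD B3 B4)) (bbodyD (bbodyD B1 B3) (bbodyD B2 B4)).
Proof.
by exists (bshuffle _ _ _ _) (bshuffle _ _ _ _) (bshuffle _ _ _ _)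
  => [[[u|u]|[u|u]]|[[u|u]|[u|u]]|[[o|o]|[o|o]]|[[i|i]|[i|i]]
     |[[o|o]|[o|o]] [[o'|o']|[o'|o']]|[[i|i]|[i|i]] [[i'|i']|[i'|i']]].
Defined.
End BodyIso.

Record port_graph C (X Y : finType) := PortGraph {
  pg_body :> body C; wiring : bij (X + bOut pg_body) (Y + bIn pg_body) }.
Arguments PortGraph {C X Y} pg_body wiring.

Definition port_iso C X Y (G G' : port_graph C X Y) : Prop :=
  exists f : biso G G',
    forall x, wiring G' (map_sum id (fO f) x) = map_sum id (fI f) (wiring G x).

Lemma port_iso_refl C X Y (G : port_graph C X Y) : port_iso G G.
Proof. by exists (biso1 G) => x; rewrite !map_sum_id. Qed.

Lemma port_iso_sym C X Y (G G' : port_graph C X Y) : port_iso G G' -> port_iso G' G.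
Proof.
case=> f fw; exists (bisoV f) => x.
have /= fIK := map_sumK (bK (bid Y)) (bK (fI f)).
have /= fOK := map_sumK (bVK (bid X)) (bVK (fO f)).
by rewrite -[LHS]fIK -fw fOK.
Qed.

Lemma port_iso_trans C X Y (G G' G'' : port_graph C X Y) : port_iso G G' -> port_iso G' G'' ->
    port_iso G G''.
Proof.
case=> f fw [g gw]; exists (bisoM g f) => x.
have e A (y : A + _) : map_sum id (fO (bisoM g f)) y = map_sum id (fO g) (map_sum id (fO f) y).
  by case: y.
have e' A (y : A + _) : map_sum id (fI (bisoM g f)) y = map_sum id (fI g) (map_sum id (fI f) y).
  by case: y.
by rewrite e e' gw fw.
Qed.

Definition bsumAC A B C : bij ((A + B) + C) ((A + C) + B).
Proof.
exists (fun x => match x with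
  inl (inl a) => inl (inl a) | inl (inr b) => inr b | inr c => inl (inr c) end)
 (fun x => match x with
  inl (inl a) => inl (inl a) | inl (inr b) => inr b | inr c => inl (inr c) end).
by case=> [[]|]. by case=> [[]|].
Defined.

Definition grl C (X Y X' Y' : finType) (f : bij X X') (g : bij Y Y') (G : port_graph C X Y) :
    port_graph C X' Y' :=
  PortGraph G (bcomp (bsum g (bid _)) (bcomp (wiring G) (bsum (bsym f) (bid _)))).

Definition ghc C (X Y X' Y' : finType) (G : port_graph C X Y) (G' : port_graph C X' Y') :
    port_graph C (fsum X X') (fsum Y Y') :=
  PortGraph (bbodyD G G') (bcomp (bshuffle _ _ _ _)
      (bcomp (bsum (wiring G) (wiring G')) (bshuffle _ _ _ _))).

(** A point leaving [G] through [Y] is carried on by the wiring of [H]. No set of glued pairs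
    appears: the half-edges of the composite are those of the two graphs, and only the wiring
    changes. *)
Definition gvc C (X Y Z : finType) (H : port_graph C Y Z) (G : port_graph C X Y) :
    port_graph C X Z :=
  PortGraph (bbodyD G H)
   (bcomp (bsym (bsumA _ _ _)) (bcomp (bsumAC _ _ _) (bcomp (bsum (wiring H) (bid _))
     (bcomp (bsumAC _ _ _) (bcomp (bsum (wiring G) (bid _)) (bsumA _ _ _)))))).

Definition gid C (X : finType) : port_graph C X X := PortGraph (bbody0 C) (bid _).

(** Each law below says that two composites of wirings agree at every point; this follows by
    computation, with a case analysis on every value of a wiring that is met. *)
Ltac wire := repeat (simpl; rewrite ?bK ?bVK; first [reflexivity | match goal with
  | |- context [bfun ?w ?e] =>
    lazymatch w with wiring _ => case: (bfun w e) => ? end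
  end]).
Ltac wire_all := move=> x; sum_case; wire.

(** * The ProP laws for port graphs, up to isomorphism *)

Section Laws.
Variable C : Type.
Implicit Types X Y Z : finType.

Lemma grl_iso X Y X' Y' (f : bij X X') (g : bij Y Y') (G K : port_graph C X Y) :
  port_iso G K -> port_iso (grl f g G) (grl f g K).
Proof.
case=> h hw; exists h => x /=.
have := hw (map_sum (binv f) id x); rewrite -[bOut G]/(bOut (grl f g G)).
have -> : map_sum id (fO h) (map_sum (binv f) id x) = map_sum (binv f) id (map_sum id (fO h) x).
  by case: x.
by move=> ->; case: (wiring G _).
Qed.

Lemma ghc_iso X Y X' Y' (G K : port_graph C X Y) (G' K' : port_graph C X' Y') :
  port_iso G K -> port_iso G' K' -> port_iso (ghc G G') (ghc K K').
Proof.
case=> h hw [h' hw']; exists (bisoD h h') => x.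
have := hw (inl _); have := hw (inr _); have := hw' (inl _); have := hw' (inr _).
move=> /= e1 e2 e3 e4.
sum_case; rewrite /= ?e1 ?e2 ?e3 ?e4; wire.
Qed.

Lemma gvc_iso X Y Z (G K : port_graph C Y Z) (G' K' : port_graph C X Y) :
  port_iso G K -> port_iso G' K' -> port_iso (gvc G G') (gvc K K').
Proof.
case=> h hw [h' hw']; exists (bisoD h' h) => x.
have := hw (inl _); have := hw (inr _); have := hw' (inl _); have := hw' (inr _).
move=> /= e1 e2 e3 e4.
sum_case; rewrite /= ?e1 ?e2 ?e3 ?e4.
- by case: (wiring G' (inl s)) => a /=; rewrite ?e3 ?e4; wire.
- by case: (wiring G' (inr s)) => a /=; rewrite ?e3 ?e4; wire.
- by wire.
Qed.

Lemma grl1 X Y (p : port_graph C X Y) : port_iso (grl (bid X) (bid Y) p) p.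
Proof. by exists (biso1 _) => x /=; rewrite !map_sum_id. Qed.

Lemma grlM X Y X' Y' X'' Y'' (f' : bij X' X'') (g' : bij Y' Y'')
    (f : bij X X') (g : bij Y Y') (p : port_graph C X Y) :
  port_iso (grl f' g' (grl f g p)) (grl (bcomp f' f) (bcomp g' g) p).
Proof. by exists (biso1 _); wire_all. Qed.

Lemma gvc_rl X Y Z X' Y' Z' (f : bij X X') (g : bij Y Y') (h : bij Z Z')
    (p : port_graph C Y Z) (q : port_graph C X Y) :
  port_iso (gvc (grl g h p) (grl f g q)) (grl f h (gvc p q)).
Proof. by exists (biso1 _) => x; sum_case; wire. Qed.

Lemma ghc_rl (X Y X' Y' U V U' V' : finType) (f : bij X X') (g : bij Y Y')
    (f' : bij U U') (g' : bij V V') (p : port_graph C X Y) (q : port_graph C U V) :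
  port_iso (ghc (grl f g p) (grl f' g' q)) (grl (bsum f f') (bsum g g') (ghc p q)).
Proof. by exists (biso1 _); wire_all. Qed.

Lemma grl_id X Y (f : bij X Y) : port_iso (grl f f (gid C X)) (gid C Y).
Proof. by exists (biso1 _) => x; sum_case; rewrite //= bVK. Qed.

Lemma gvcA X Y Z T (p : port_graph C Z T) (q : port_graph C Y Z) (r : port_graph C X Y) :
  port_iso (gvc p (gvc q r)) (gvc (gvc p q) r).
Proof. by exists (bisoV (bisoA _ _ _)); wire_all. Qed.

Lemma gvc1r X Y (p : port_graph C X Y) : port_iso (gvc p (gid C X)) p.
Proof. by exists (biso0 _); wire_all. Qed.

Lemma gvc1l X Y (p : port_graph C X Y) : port_iso (gvc (gid C Y) p) p.
Proof. by exists (bisoM (biso0 _) (bisoC _ _)); wire_all. Qed.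

Lemma ghc_id X Y : port_iso (ghc (gid C X) (gid C Y)) (gid C (fsum X Y)).
Proof. by exists (biso0 _); wire_all. Qed.

Lemma gxch X Y Z X' Y' Z' (p : port_graph C Y Z) (p' : port_graph C Y' Z') (q : port_graph C X Y)
    (q' : port_graph C X' Y') :
  port_iso (gvc (ghc p p') (ghc q q')) (ghc (gvc p q) (gvc p' q')).
Proof. by exists (bisoX _ _ _ _); wire_all. Qed.

Lemma ghcA X Y X' Y' X'' Y'' (p : port_graph C X Y) (q : port_graph C X' Y')
    (r : port_graph C X'' Y'') :
  port_iso (grl (bsumA X X' X'') (bsumA Y Y' Y'') (ghc p (ghc q r))) (ghc (ghc p q) r).
Proof. by exists (bisoA _ _ _); wire_all. Qed.

Lemma ghc0l X Y (p : port_graph C X Y) : port_iso (grl (bsum0 X) (bsum0 Y) (ghc (gid C fvoid) p)) p.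
Proof. by exists (biso0 _); wire_all. Qed.

Lemma ghcC X Y X' Y' (p : port_graph C X Y) (q : port_graph C X' Y') :
  port_iso (grl (bsumC X X') (bsumC Y Y') (ghc p q)) (ghc q p).
Proof. by exists (bisoC _ _); wire_all. Qed.
End Laws.

(** A class is the predicate of being isomorphic to one of its members, so that equality of classes
    is isomorphism ([clP]); representatives come from choice. *)
Definition port_class C X Y := {c : port_graph C X Y -> Prop | exists G, c = port_iso G}.
Definition cl C X Y (G : port_graph C X Y) : port_class C X Y := exist _ (port_iso G)
    (ex_intro _ G erefl).
Definition clrep C X Y (c : port_class C X Y) : port_graph C X Y := sval (cid (svalP c)).

Lemma clrepK C X Y : cancel (@clrep C X Y) (@cl C X Y).
Proof.
move=> [c hc]; rewrite /clrep /=; case: (cid _) => G /= e.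
by apply: eq_exist; rewrite /= e.
Qed.

Lemma clP C X Y (G K : port_graph C X Y) : cl G = cl K <-> port_iso G K.
Proof.
split=> [[] e|GK]; first by rewrite e; exact: port_iso_refl.
apply: eq_exist; apply/funext => L; apply/propext; split=> h.
  exact: port_iso_trans (port_iso_sym GK) h.
exact: port_iso_trans GK h.
Qed.

Lemma clrepP C X Y (G : port_graph C X Y) : port_iso (clrep (cl G)) G.
Proof. by apply/clP; rewrite clrepK. Qed.

Definition crl C (X Y X' Y' : finType) (f : bij X X') (g : bij Y Y') (c : port_class C X Y) :
    port_class C X' Y' :=
  cl (grl f g (clrep c)).
Definition chc C (X Y X' Y' : finType) (c : port_class C X Y) (d : port_class C X' Y') :
  port_class C (fsum X X') (fsum Y Y') := cl (ghc (clrep c) (clrep d)).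
Definition cvc C (X Y Z : finType) (c : port_class C Y Z) (d : port_class C X Y) :
  port_class C X Z := cl (gvc (clrep c) (clrep d)).

Lemma crl_cl C X Y X' Y' f g (G : port_graph C X Y) : @crl C X Y X' Y' f g (cl G) = cl (grl f g G).
Proof. by apply/clP/grl_iso/clrepP. Qed.
Lemma chc_cl C X Y X' Y' (G : port_graph C X Y) (K : port_graph C X' Y') : chc (cl G) (cl K) = cl
    (ghc G K).
Proof. by apply/clP/ghc_iso; exact: clrepP. Qed.
Lemma cvc_cl C X Y Z (G : port_graph C Y Z) (K : port_graph C X Y) : cvc (cl G) (cl K) = cl
    (gvc G K).
Proof. by apply/clP/gvc_iso; exact: clrepP. Qed.

Lemma cl_ind C X Y (Pr : port_class C X Y -> Prop) : (forall G, Pr (cl G)) -> forall c, Pr c.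
Proof. by move=> h c; rewrite -[c]clrepK. Qed.

Definition port_setProP (C : Type) : setProP.
Proof.
exists (port_class C) (@crl C) (@chc C) (@cvc C) (fun X => cl (gid C X)); intros;
repeat match goal with c : port_class _ _ _ |- _ => elim/cl_ind: c => c end;
rewrite ?(crl_cl, chc_cl, cvc_cl); apply/clP.
- exact: grl1. - exact: grlM. - exact: gvc_rl. - exact: ghc_rl. - exact: grl_id.
- exact: gvcA. - exact: gvc1l. - exact: gvc1r. - exact: ghc_id. - exact: gxch.
- exact: ghcA. - exact: ghc0l. - exact: ghcC.
Defined.

(** * The set-indexed ProP of a ProP *)

Lemma bij_ord_eq k k' (f : bij 'I_k 'I_k') : k = k'.
Proof. by rewrite -(card_ord k) -(card_ord k'); exact: bij_eq_card (bij_bijective f). Qed.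

Definition permb k (s : 'S_k) : bij 'I_k 'I_k := Bij (permK s) (permKV s).

(** Once the two cardinals are identified, a bijection between ordinals is a permutation. This
    eliminates at once the casts and the general bijections from statements about [brl]. *)
Lemma bij_ordP k (Pr : forall k', bij 'I_k 'I_k' -> Prop) :
  (forall s : 'S_k, Pr k (permb s)) -> forall k' f, Pr k' f.
Proof.
move=> h k' f; have e := bij_ord_eq f; subst k'.
have -> : f = permb (perm (bij_inj_fun (f := f))) by apply: bij_ext => i; rewrite /= permE.
exact: h.
Qed.

Definition bcast k k' (e : k = k') : bij 'I_k 'I_k' :=
  Bij (cast_ordK e) (cast_ordKV e).
Definition bsplit m n : bij 'I_(m + n) ('I_m + 'I_n) := Bij (@splitK m n) (@unsplitK m n).

Definition perm_of k k' (f : bij 'I_k 'I_k') : 'S_k :=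
  perm (bij_inj_fun (f := bcomp (bcast (esym (bij_ord_eq f))) f)).

Lemma perm_of_permb k (s : 'S_k) : perm_of (permb s) = s.
Proof. by apply/permP => i; rewrite permE; apply: val_inj. Qed.

Lemma permb1 k : permb (1%g : 'S_k) = bid _.
Proof. by apply: bij_ext => i; rewrite /= perm1. Qed.

Lemma permbM k (s t : 'S_k) : bcomp (permb s) (permb t) = permb (t * s)%g.
Proof. by apply: bij_ext => i; rewrite /= permM. Qed.

Definition bordD k l k' l' (f : bij 'I_k 'I_l) (g : bij 'I_k' 'I_l') :
  bij 'I_(k + k') 'I_(l + l') := bcomp (bsym (bsplit _ _)) (bcomp (bsum f g) (bsplit _ _)).

Lemma bordD_permb k k' (s : 'S_k) (t : 'S_k') : bordD (permb s) (permb t) = permb (tensp s t).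
Proof. by apply: bij_ext => i; rewrite /= permE. Qed.

Section Brl.
Variables (K : fieldType) (P : proPData K).

(** Both symmetric group actions as one relabelling. The inverse on the input side turns the right
    action into a covariant renaming. *)
Definition brl k l k' l' (f : bij 'I_k 'I_k') (g : bij 'I_l 'I_l') (p : P k l) : P k' l' :=
  pcast (bij_ord_eq f) (bij_ord_eq g) (lact (perm_of g) (ract p (perm_of f)^-1%g)).

Lemma pcast_id k l (e : k = k) (e' : l = l) (p : P k l) : pcast e e' p = p.
Proof. by rewrite (eq_irrelevance e erefl) (eq_irrelevance e' erefl). Qed.

Lemma brlE k l (s : 'S_k) (t : 'S_l) (p : P k l) :
  brl (permb s) (permb t) p = lact t (ract p s^-1%g).
Proof. by rewrite /brl pcast_id !perm_of_permb. Qed.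

Hypothesis ax : isProP P.

Lemma brl1 k l (p : P k l) : brl (bid _) (bid _) p = p.
Proof. by rewrite -!permb1 brlE invg1 (ract1 ax) (lact1 ax). Qed.

Lemma brlM k l k' l' k'' l'' (f' : bij 'I_k' 'I_k'') (g' : bij 'I_l' 'I_l'')
    (f : bij 'I_k 'I_k') (g : bij 'I_l 'I_l') (p : P k l) :
  brl f' g' (brl f g p) = brl (bcomp f' f) (bcomp g' g) p.
Proof.
elim/bij_ordP: k' / f f' => s; elim/bij_ordP: l' / g g' => t g' f'.
elim/bij_ordP: k'' / f' => s'; elim/bij_ordP: l'' / g' => t'.
by rewrite !permbM !brlE (lact_ract ax) -(lact_comp ax) -(ract_comp ax) /pcomp invMg.
Qed.

Lemma brl_vcat k l m k' l' m' (f : bij 'I_k 'I_k') (g : bij 'I_l 'I_l')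
    (h : bij 'I_m 'I_m') (p : P l m) (q : P k l) :
  vcat (brl g h p) (brl f g q) = brl f h (vcat p q).
Proof.
elim/bij_ordP: k' / f => s; elim/bij_ordP: l' / g => t; elim/bij_ordP: m' / h => u.
rewrite !brlE (ract_vcat ax) (lact_vcat ax) -(lact_ract ax) (mact_vcat ax).
by rewrite -(lact_comp ax) /pcomp mulgV (lact1 ax).
Qed.

Lemma brl_hcat k l k' l' m n m' n' (f : bij 'I_k 'I_k') (g : bij 'I_l 'I_l')
    (f' : bij 'I_m 'I_m') (g' : bij 'I_n 'I_n') (p : P k l) (q : P m n) :
  hcat (brl f g p) (brl f' g' q) = brl (bordD f f') (bordD g g') (hcat p q).
Proof.
elim/bij_ordP: k' / f => s; elim/bij_ordP: l' / g => t.
elim/bij_ordP: m' / f' => s'; elim/bij_ordP: n' / g' => t'.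
rewrite !bordD_permb !brlE (lact_hcat ax) (ract_hcat ax); congr (lact _ (ract _ _)).
apply/permP => i; rewrite permE; apply: (canRL (permK _)); rewrite permE unsplitK.
rewrite (map_sumK (permKV s) (permKV s')); exact: splitK.
Qed.

Lemma pcast_brl k l k' l' (e : k = k') (e' : l = l') (p : P k l) :
  pcast e e' p = brl (bcast e) (bcast e') p.
Proof.
subst k' l'; rewrite pcast_id.
have bc n : bcast (erefl n) = bid _ by apply: bij_ext => i; exact: val_inj.
by rewrite !bc brl1.
Qed.

(** The right action crosses the middle of a vertical composite, becomes a left action and cancels
    against the other one. *)
Lemma brl_unitn k k' (f : bij 'I_k 'I_k') : brl f f (unitn P k) = unitn P k'.
Proof.
elim/bij_ordP: k' / f => s.
rewrite brlE -[ract _ _](vcat1r ax) (mact_vcat ax) (vcat1l ax) -(lact_comp ax).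
by rewrite /pcomp mulVg (lact1 ax).
Qed.

Lemma hcat_unitn m n : hcat (unitn P m) (unitn P n) = unitn P (m + n).
Proof.
elim: m => [|m IHm] /=.
  by rewrite -[RHS](hcat0l ax) pcast_id.
have := hcatA ax (unit1 P) (unitn P m) (unitn P n).
by rewrite IHm pcast_id => /esym.
Qed.

Lemma unitn_1 : unitn P 1 = unit1 P.
Proof. by rewrite /= -[RHS](hcat0r ax) pcast_id. Qed.

Lemma brl_hcatA k l k' l' k'' l'' (p : P k l) (q : P k' l') (r : P k'' l'') :
  hcat (hcat p q) r =
  brl (bcast (addnA k k' k'')) (bcast (addnA l l' l'')) (hcat p (hcat q r)).
Proof. by rewrite -(hcatA ax) pcast_brl. Qed.

Definition bordC m n : bij 'I_(m + n) 'I_(n + m) :=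
  bcomp (bsym (bsplit _ _)) (bcomp (bsumC _ _) (bsplit _ _)).

Lemma brl_hcatC k l k' l' (p : P k l) (q : P k' l') :
  hcat q p = brl (bordC k k') (bordC l l') (hcat p q).
Proof.
have := brlE (swapp k k') (swapp l l') (hcat p q).
rewrite -(lact_ract ax) (hcat_swap ax) -(ract_comp ax) /pcomp mulVg (ract1 ax) pcast_brl.
move/(congr1 (brl (bsym (bcast (addnC k' k))) (bsym (bcast (addnC l' l))))).
rewrite !brlM !bcompVl brl1 => <-; congr brl; apply: bij_ext => i; apply: val_inj => /=.
  by rewrite permE /=; case: (split i).
by rewrite permE /=; case: (split i).
Qed.

Definition er (X : finType) : bij X 'I_#|X| := Bij (@enum_rankK X) (@enum_valK X).
Definition bcardD (X Y : finType) : bij 'I_(#|X| + #|Y|) 'I_#|fsum X Y| :=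
  bcomp (er _) (bcomp (bsum (bsym (er X)) (bsym (er Y))) (bsplit _ _)).
Definition ber (X Y : finType) (f : bij X Y) : bij 'I_#|X| 'I_#|Y| :=
  bcomp (er Y) (bcomp f (bsym (er X))).

Lemma split_lshift m n (i : 'I_m) : split (lshift n i) = inl i.
Proof. exact: unsplitK (inl i). Qed.
Lemma split_rshift m n (i : 'I_n) : split (rshift m i) = inr i.
Proof. exact: unsplitK (inr i). Qed.
Lemma cast_lshift m n p (i : 'I_m) :
  cast_ord (addnA m n p) (lshift _ i) = lshift _ (lshift _ i).
Proof. exact: val_inj. Qed.
Lemma cast_rlshift m n p (i : 'I_n) :
  cast_ord (addnA m n p) (rshift _ (lshift _ i)) = lshift _ (rshift _ i).
Proof. exact: val_inj. Qed.
Lemma cast_rrshift m n p (i : 'I_p) :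
  cast_ord (addnA m n p) (rshift _ (rshift _ i)) = rshift _ i.
Proof. by apply: val_inj => /=; rewrite addnA. Qed.
Definition cast_shift := (cast_lshift, cast_rlshift, cast_rrshift).

Lemma ord_addP m n (Pr : 'I_(m + n) -> Prop) :
  (forall i, Pr (lshift n i)) -> (forall i, Pr (rshift m i)) -> forall i, Pr i.
Proof. by move=> hl hr i; rewrite -[i]splitK; case: (split i). Qed.

Ltac ord_simp := do ?rewrite /= ?(split_lshift, split_rshift, enum_rankK, enum_valK, bK, bVK) //.

Lemma bcardDA (X Y Z : finType) :
  bcomp (bcomp (ber (bsumA X Y Z)) (bcardD X (fsum Y Z))) (bordD (bid _) (bcardD Y Z)) =
  bcomp (bcomp (bcardD (fsum X Y) Z) (bordD (bcardD X Y) (bid _))) (bcast (addnA #|X| #|Y| #|Z|)).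
Proof.
apply: bij_ext; apply: ord_addP => [x|]; first by rewrite /= cast_shift; ord_simp.
apply: ord_addP => x; rewrite /= cast_shift; ord_simp.
Qed.

Ltac ord_bash := apply: bij_ext; apply: ord_addP => x; ord_simp.

(** Every finite set is numbered by its enumeration [er]. The sum [X + X'] is not enumerated by
    concatenating the two enumerations, hence the correction [bcardD] in horizontal
    concatenation. *)
Definition ProP_setProP : setProP.
Proof.
exists (fun X Y : finType => P #|X| #|Y|)
  (fun (X Y X' Y' : finType) (f : bij X X') (g : bij Y Y') p => brl (ber f) (ber g) p)
  (fun (X Y X' Y' : finType) p q => brl (bcardD X X') (bcardD Y Y') (hcat p q))
  (fun (X Y Z : finType) p q => vcat p q)
  (fun X : finType => unitn P #|X|).
- move=> X Y p; rewrite -[RHS]brl1; congr brl; apply: bij_ext => x; exact: enum_valK.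
- move=> X Y X' Y' X'' Y'' f' g' f g p; rewrite brlM; congr brl;
  by apply: bij_ext => x; rewrite /= enum_rankK.
- by move=> *; rewrite brl_vcat.
- by move=> *; rewrite brl_hcat !brlM; congr brl; ord_bash.
- by move=> *; rewrite brl_unitn.
- by move=> *; rewrite (vcatA ax).
- by move=> *; rewrite (vcat1l ax).
- by move=> *; rewrite (vcat1r ax).
- by move=> X Y; rewrite hcat_unitn brl_unitn.
- by move=> X Y Z X' Y' Z' p p' q q'; rewrite brl_vcat (interchange ax).
- move=> X Y X' Y' X'' Y'' p q r.
  rewrite -{1}[p]brl1 -{2}[r]brl1 !brl_hcat brl_hcatA !brlM.
  by rewrite !bcardDA.
- move=> X Y p.
  rewrite -[RHS](hcat0l ax) pcast_id.
  have e : #|fvoid| = 0%N by rewrite card_void.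
  have -> : unitn P #|fvoid| = brl (bcast (esym e)) (bcast (esym e)) (unitn P 0).
    by rewrite brl_unitn.
  rewrite -{1}[p]brl1 brl_hcat !brlM -[RHS]brl1; congr brl;
    apply: bij_ext; apply: ord_addP => [[]//|x]; ord_simp; exact: val_inj.
- move=> X Y X' Y' p q; rewrite (brl_hcatC p q) !brlM; congr brl; ord_bash.
Defined.

End Brl.

(** * From planar graphs to port graphs *)

(** Since both summands are preserved, the inverse preserves them too; this gives surjectivity on
    each summand. *)
Lemma bij_split A1 A2 B1 B2 (h : bij (A1 + B1) (A2 + B2)) :
  (forall a, exists a', h (inl a) = inl a') -> (forall b, exists b', h (inr b) = inr b') ->
  exists (f : bij A1 A2) (g : bij B1 B2), h = bsum f g.
Proof.
move=> hl hr.
have hl' a' : exists a, h (inl a) = inl a'.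
  have := bVK h (inl a'); case: (binv h _) => [a|b] e; first by exists a.
  by have [b' eb] := hr b; rewrite eb in e.
have hr' b' : exists b, h (inr b) = inr b'.
  have := bVK h (inr b'); case: (binv h _) => [a|b] e; last by exists b.
  by have [a' ea] := hl a; rewrite ea in e.
have [f fE] := choice hl; have [f' fE'] := choice hl'.
have [g gE] := choice hr; have [g' gE'] := choice hr'.
have fK : cancel f f' by move=> a; have [] : inl (f' (f a)) = inl a :> A1 + B1
  by apply: (bij_inj_fun (f := h)); rewrite fE' fE.
have f'K : cancel f' f by move=> a; have := fE (f' a); rewrite fE' => -[].
have gK : cancel g g' by move=> a; have [] : inr (g' (g a)) = inr a :> A1 + B1
  by apply: (bij_inj_fun (f := h)); rewrite gE' gE.
have g'K : cancel g' g by move=> a; have := gE (g' a); rewrite gE' => -[].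
exists (Bij fK f'K), (Bij gK g'K); apply: bij_ext.
by case=> a /=; rewrite ?fE ?gE.
Qed.

Lemma fiber_order_eq T V V' (t : T -> V) (t' : T -> V') r :
  (forall x y, t x = t y <-> t' x = t' y) -> fiber_order t r -> fiber_order t' r.
Proof.
move=> tt' [s tot a tr]; split=> // x y.
  by move/s/tt'.
by move/tt'/tot.
Qed.

Notation fsfin := Defs_sfin_sort__canonical__fintype_Finite.

Definition bijc A B (f : A -> B) (h : bijective f) : bij A B := sval (bijectiveP h).
Lemma bijcE A B (f : A -> B) (h : bijective f) : bfun (bijc h) = f.
Proof. by rewrite /bijc; case: (bijectiveP h). Qed.
Arguments bijc : simpl never.

(** An internal edge is both an outgoing and an incoming half-edge, wired to itself; an input
    becomes an incoming half-edge, an outgoing half-edge becomes an output, and an input-output edge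
    joins the boundary to itself. *)
Definition bports I IO E O : bij ((I + IO) + (E + O)) ((O + IO) + (E + I)).
Proof.
pose f X Y (x : (X + IO) + (E + Y)) : (Y + IO) + (E + X) := match x with
  | inl (inl i) => inr (inr i) | inl (inr io) => inl (inr io)
  | inr (inl e) => inr (inl e) | inr (inr o) => inl (inl o) end.
by exists (f I O) (f O I); case=> [[]|[]].
Defined.

Section PortGraph.
Variables (k l : nat).
Implicit Types G : pgraph k l.

Lemma inl_fiber T V L (t : T -> V) r : fiber_order t r ->
  fiber_order (fun x => inl (t x) : V + L) r.
Proof. by apply: fiber_order_eq => x y; split=> [->|[]]. Qed.

Definition port_body G : body unit :=
  @Body unit (fsum (fsfin (gV G)) (fsfin (gL G))) (fsum (fsfin (gE G)) (fsfin (gO G)))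
    (fsum (fsfin (gE G)) (fsfin (gI G))) (fun=> tt) (sum_case xpred0 xpredT)
    (fun o => inl (gs G o)) (fun i => inl (gt G i)) (ord_out G) (ord_in G)
    (fun=> isT) (fun=> isT) (inl_fiber _ (ord_outP G)) (inl_fiber _ (ord_inP G)).

Definition port G : port_graph unit (ford k) (ford l) :=
  @PortGraph unit (ford k) (ford l) (port_body G)
   (bcomp (bsum (bijc (gbeta_bij G)) (bid _)) (bcomp (bports _ _ _ _)
     (bsum (bsym (bijc (galpha_bij G))) (bid _)))).

Lemma balphaK G x : binv (bijc (galpha_bij G)) (galpha G x) = x.
Proof. by rewrite -[in X in binv _ X](bijcE (galpha_bij G)) bK. Qed.

Lemma portI G e : wiring (port G) (inl (galpha G (inl e))) = inr (inr e).
Proof. by rewrite /= balphaK. Qed.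
Lemma portIO G e : wiring (port G) (inl (galpha G (inr e))) = inl (gbeta G (inr e)).
Proof. by rewrite /= balphaK /= bijcE. Qed.
Lemma portE G e : wiring (port G) (inr (inl e)) = inr (inl e).
Proof. by []. Qed.
Lemma portO G e : wiring (port G) (inr (inr e)) = inl (gbeta G (inl e)).
Proof. by rewrite /= bijcE. Qed.

Lemma port_ind G (Pr : 'I_k + (gE G + gO G) -> Prop) :
  (forall e, Pr (inl (galpha G (inl e)))) -> (forall e, Pr (inl (galpha G (inr e)))) ->
  (forall e, Pr (inr (inl e))) -> (forall e, Pr (inr (inr e))) -> forall x, Pr x.
Proof.
move=> hI hIO hE hO [i|[e|o]] //.
by rewrite -[i](bVK (bijc (galpha_bij G))) bijcE; case: (binv _ _).
Qed.

Lemma port_piso G G' : piso G G' -> port_iso (port G) (port G').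
Proof.
case=> f [fi fo].
pose V := bijc (isoV_bij f); pose E := bijc (isoE_bij f); pose I := bijc (isoI_bij f).
pose O := bijc (isoO_bij f); pose L := bijc (isoL_bij f).
have eI x : map_sum E I x = map_sum (isoE f) (isoI f) x by rewrite !bijcE.
have eO x : map_sum E O x = map_sum (isoE f) (isoO f) x by rewrite !bijcE.
unshelve eexists.
  exists (bsum V L) (bsum E O) (bsum E I) => [u|u|o|i|o o'|i i'] //.
  - by case: u.
  - by rewrite /= eO iso_s /V bijcE.
  - by rewrite /= eI iso_t /V bijcE.
  - by rewrite /= !eO fo.
  - by rewrite /= !eI fi.
have ea y : galpha G y = galpha G' (map_sum (isoI f) (isoIO f) y).
  by apply: val_inj; rewrite /= iso_alpha.
have eb y : gbeta G y = gbeta G' (map_sum (isoO f) (isoIO f) y).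
  by apply: val_inj; rewrite /= iso_beta.
elim/port_ind => e.
- by rewrite portI [map_sum _ _ (inl _)]/= ea portI /= /I bijcE.
- by rewrite portIO [map_sum _ _ (inl _)]/= ea portIO /= eb.
- by [].
- by rewrite !portO /= /O bijcE eb.
Qed.

(** The wiring reveals the kind of each edge: a half-edge wired to a half-edge is internal, one
    wired to the boundary is an output. An isomorphism therefore splits along kinds. It fixes the
    boundary, so on input and input-output edges it must be the composite of [galpha G] with the
    inverse of [galpha G']. *)
Lemma piso_port G G' : port_iso (port G) (port G') -> piso G G'.
Proof.
case=> f fw.
have [V [L eU]] : exists (V : bij (gV G) (gV G')) (L : bij (gL G) (gL G')), fU f = bsum V L.
  apply: bij_split => u.
    by have /= := floop f (inl u); case: (fU f _) => // v _; exists v.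
  by have /= := floop f (inr u); case: (fU f _) => // v _; exists v.
have [E [O eO]] : exists (E : bij (gE G) (gE G')) (O : bij (gO G) (gO G')), fO f = bsum E O.
  apply: bij_split => e.
    have := fw (inr (inl e)); rewrite portE [map_sum _ _ _]/=.
    by case: (fO f _) => e'; [exists e' | rewrite portO].
  have := fw (inr (inr e)); rewrite portO [map_sum _ _ _]/=.
  by case: (fO f _) => e'; [rewrite portE | exists e'].
have eIE e : fI f (inl e) = inl (E e).
  have := fw (inr (inl e)); rewrite portE [map_sum _ _ _]/= eO [bfun _ (inl e)]/= portE /=.
  by move=> [].
have [I [IO eh]] : exists (I : bij (gI G) (gI G')) (IO : bij (gIO G) (gIO G')),
    bcomp (bsym (bijc (galpha_bij G'))) (bijc (galpha_bij G)) = bsum I IO.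
  apply: bij_split => e; rewrite /= bijcE.
    have /= := fw (inl (galpha G (inl e))); rewrite balphaK /=.
    by case: (binv _ _) => e' //; exists e'.
  have /= := fw (inl (galpha G (inr e))); rewrite balphaK /=.
  by case: (binv _ _) => e' //; exists e'.
have ea x : galpha G' (map_sum I IO x) = galpha G x.
  have /(congr1 (fun h => bfun h x)) /= := eh; rewrite bijcE => <-.
  by rewrite -[X in X _ = _](bijcE (galpha_bij G')) bVK.
have eII e : fI f (inr e) = inr (I e).
  have := fw (inl (galpha G (inl e))); rewrite portI [map_sum _ _ _]/= -ea portI.
  by case.
have eI x : fI f x = map_sum E I x by case: x.
have eb x : gbeta G' (map_sum O IO x) = gbeta G x.
  case: x => e /=.
    have := fw (inr (inr e)); rewrite portO [map_sum _ _ (inr (inr e))]/= eO.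
    by rewrite [bfun _ (inr e)]/= portO => -[].
  have := fw (inl (galpha G (inr e))); rewrite portIO [map_sum _ _ (inl _)]/= -ea portIO.
  by case.
have eO' x : fO f x = map_sum E O x by rewrite eO.
unshelve eexists.
  exists V E I O IO L; try exact: bij_bijective.
  - move=> x; have := fsrc f x; rewrite eU eO /=; by case.
  - move=> x; have := ftgt f x; rewrite eU eI /=; by case.
  - by move=> x; rewrite ea.
  - by move=> x; rewrite eb.
split=> x y; first by have := fri f x y; rewrite !eI.
by have := fro f x y; rewrite !eO'.
Qed.
End PortGraph.

Lemma port_lact k l (s : 'S_l) (G : pgraph k l) :
  port_iso (port (plact s G)) (grl (bid _) (permb s) (port G)).
Proof.
exists (biso1 (port G)); elim/port_ind => e.
- by rewrite portI map_sum_id /= (@balphaK _ _ G (inl e)).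
- by rewrite portIO map_sum_id /= (@balphaK _ _ G (inr e)) /= bijcE.
- by [].
- by rewrite portO map_sum_id /= bijcE.
Qed.

Lemma port_ract k l (s : 'S_k) (G : pgraph k l) :
  port_iso (port (pract G s)) (grl (permb s^-1%g) (bid _) (port G)).
Proof.
exists (biso1 (port G)); elim/port_ind => e.
- by rewrite portI map_sum_id /= permK (@balphaK _ _ G (inl e)).
- by rewrite portIO map_sum_id /= permK (@balphaK _ _ G (inr e)) /= bijcE.
- by [].
- by rewrite portO map_sum_id /= bijcE.
Qed.

Definition bunsplit m n : bij ('I_m + 'I_n) 'I_(m + n) := bsym (bsplit m n).

Definition port_hcat_body k l k' l' (G : pgraph k l) (G' : pgraph k' l') :
  biso (port (phcat G G')) (bbodyD (port G) (port G')).
Proof.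
exists (bshuffle _ _ _ _) (bshuffle _ _ _ _) (bshuffle _ _ _ _) => [u|u|o|i|o o'|i i'] //.
- by case: u => [[]|[]].
- by case: u => [[]|[]].
- by case: o => [[]|[]].
- by case: i => [[]|[]].
Defined.

Lemma port_hcat k l k' l' (G : pgraph k l) (G' : pgraph k' l') :
  port_iso (port (phcat G G')) (grl (bunsplit _ _) (bunsplit _ _) (ghc (port G) (port G'))).
Proof.
exists (port_hcat_body G G'); elim/port_ind => e.
- by rewrite portI; case: e => e; rewrite /= ?split_lshift ?split_rshift /=
    ?(@balphaK _ _ G (inl e)) ?(@balphaK _ _ G' (inl e)).
- by rewrite portIO; case: e => e; rewrite /= ?split_lshift ?split_rshift /=
    ?(@balphaK _ _ G (inr e)) ?(@balphaK _ _ G' (inr e)) /= bijcE.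
- by rewrite portE; case: e => e.
- by rewrite portO; case: e => e; rewrite /= bijcE.
Qed.

Section PortVcat.
Variables (k l m : nat) (H : pgraph l m) (G : pgraph k l).

Lemma alphaP (j : 'I_l) : exists e, j = galpha H e.
Proof. by have := bVK (bijc (galpha_bij H)) j; rewrite bijcE => <-; eexists. Qed.
Lemma betaP (j : 'I_l) : exists e, j = gbeta G e.
Proof. by have := bVK (bijc (gbeta_bij G)) j; rewrite bijcE => <-; eexists. Qed.

(** An output edge of [G] is glued to exactly one edge of [H], the one with its index; so gluing
    neither loses nor creates outgoing half-edges. *)
Lemma vout_bij : bijective (@vout k l m H G).
Proof.
apply: (@inj_surj_bij (fsum (fsfin (vE H G)) (fsfin (vO H G)))
   (fsum (fsum (fsfin (gE G)) (fsfin (gO G))) (fsum (fsfin (gE H)) (fsfin (gO H))))).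
  exact: vout_inj.
move=> [[e|o]|[e|o]].
- by exists (inl (inl (inl e))).
- have [[e|e] /eqP E] := alphaP (gbeta G (inl o)).
    by exists (inl (inr (exist _ (o, e) E))).
  by exists (inr (inr (exist _ (o, e) E))).
- by exists (inl (inl (inr e))).
- by exists (inr (inl o)).
Qed.

Lemma vin_bij : bijective (@vin k l m H G).
Proof.
apply: (@inj_surj_bij (fsum (fsfin (vE H G)) (fsfin (vI H G)))
   (fsum (fsum (fsfin (gE G)) (fsfin (gI G))) (fsum (fsfin (gE H)) (fsfin (gI H))))).
  exact: vin_inj.
move=> [[e|o]|[e|o]].
- by exists (inl (inl (inl e))).
- by exists (inr (inl o)).
- by exists (inl (inl (inr e))).
- have [[e|e] /esym/eqP E] := betaP (galpha H (inl o)).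
    by exists (inl (inr (exist _ (e, o) E))).
  by exists (inr (inr (exist _ (e, o) E))).
Qed.

Definition port_vcat_body : biso (port (pvcat H G)) (bbodyD (port G) (port H)).
Proof.
exists (bshuffle _ _ _ _) (bijc vout_bij) (bijc vin_bij) => [u|u|o|i|o o'|i i'].
- by case: u => [[]|[]].
- by case: u => [[]|[]].
- by rewrite bijcE /=; case: (vout o).
- by rewrite bijcE /=; case: (vin i).
- by rewrite bijcE.
- by rewrite bijcE.
Defined.

Lemma port_vcat : port_iso (port (pvcat H G)) (gvc (port H) (port G)).
Proof.
have hG := @balphaK k l G; have hH := @balphaK l m H.
have aE x : galpha (pvcat H G) x = galpha G (valpha_edge x) by [].
have bE x : gbeta (pvcat H G) x = gbeta H (vbeta_edge x) by [].
exists port_vcat_body; elim/port_ind => e; rewrite ?(portI, portIO, portE, portO) /= ?bijcE ?bE ?aE.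
- case: e => [i|[[g e] /= /eqP E]]; rewrite /= hG //=.
  by rewrite ?bijcE E hH.
- by case: e => [[g e] /= /eqP E]; rewrite /= hG /= ?bijcE E hH /= ?bijcE.
- case: e => [[e|e]|[[o e] /= /eqP E]] //=.
  by rewrite ?bijcE E hH.
- case: e => [o|[[o e] /= /eqP E]] /=; first by rewrite ?bijcE.
  by rewrite ?bijcE E hH /= ?bijcE.
Qed.
End PortVcat.

Definition bvoid (A B : Type) (fA : A -> False) (fB : B -> False) : bij A B.
Proof.
by exists (fun a => False_rect B (fA a)) (fun b => False_rect A (fB b)) => x;
  [case: (fA x)|case: (fB x)].
Defined.

Lemma fvv : (void + void)%type -> False. Proof. by case=> [[]|[]]. Qed.

Lemma port_unit0 (f : bij void 'I_0) : port_iso (port punit0) (grl f f (gid unit fvoid)).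
Proof.
unshelve eexists.
  exists (bvoid fvv (@id False \o Empty_set_rect (fun=> False)))
         (bvoid fvv (@id False \o Empty_set_rect (fun=> False)))
         (bvoid fvv (@id False \o Empty_set_rect (fun=> False))) => x; by case: (fvv x).
by case=> [[]|[[]|[]]].
Qed.

Lemma port_unit1 : port_iso (port punit1) (gid unit (ford 1)).
Proof.
unshelve eexists.
  exists (bvoid fvv (@id False \o Empty_set_rect (fun=> False)))
         (bvoid fvv (@id False \o Empty_set_rect (fun=> False)))
         (bvoid fvv (@id False \o Empty_set_rect (fun=> False))) => x; by case: (fvv x).
by elim/port_ind => [[]|e|[]|[]]; rewrite portIO /= !(ord1 (_ : 'I_1)).
Qed.

(** A copy of a finite type in [Set], where the vertices and edges of a [graph] must live. *)
Definition sfin_of (T : finType) : sfin := sfin_below #|T|.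
Definition sfin_of_bij (T : finType) : bij (sfin_of T) T :=
  bcomp (bsym (er T)) (Bij (@ord_belowK #|T|) (@below_ordK #|T|)).

Lemma pred_split (T : finType) (p : pred T) :
  exists (A B : sfin) (f : bij (A + B) T),
    (forall a, p (f (inl a))) /\ (forall b, ~~ p (f (inr b))).
Proof.
pose g (x : {x | p x} + {x | ~~ p x}) := match x with inl a => val a | inr b => val b end.
have gb : bijective g.
  apply: inj_surj_bij => [[[x px]|[x px]] [[y py]|[y py]] /= e|x].
  - by congr inl; apply: val_inj.
  - by exfalso; move: py; rewrite -e px.
  - by exfalso; move: px; rewrite e py.
  - by congr inr; apply: val_inj.
  - by case px : (p x); [exists (inl (exist _ x px)) | exists (inr (exist _ x (negbT px)))].
exists (sfin_of {x | p x}), (sfin_of {x | ~~ p x}),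
  (bcomp (bijc gb) (bsum (sfin_of_bij _) (sfin_of_bij _))).
split=> x; rewrite /= bijcE; exact: (svalP (sfin_of_bij _ x)).
Qed.

Definition is_inl A B (x : A + B) := if x is inl _ then true else false.

(** The kinds are recovered from the wiring: outgoing half-edges wired to a half-edge become
    internal edges and the others outputs, inputs wired to an output become input-output edges, and
    the flagged vertices become loops. *)
Lemma port_surj k l (G : port_graph unit (ford k) (ford l)) : exists H : pgraph k l, port_iso
    (port H) G.
Proof.
have [V [L [bU [V1 L1]]]] := pred_split (fun u => ~~ @bloop _ G u).
have [E [O [bO [E1 O1]]]] := pred_split (fun o => ~~ is_inl (wiring G (inr o))).
have [I [IO [bA [I1 IO1]]]] := pred_split (fun i => ~~ is_inl (wiring G (inl i))).
(* The incoming half-edges are not cut by a predicate: the rearranged wiring itself splits into an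
   indexing of the outputs and a bijection of [E + I] with the incoming half-edges. *)
have [bB [bI bBI]] : exists (bB : bij (O + IO) 'I_l) (bI : bij (E + I) (bIn G)),
    bcomp (bcomp (wiring G) (bsum bA bO)) (bsym (bports I IO E O)) = bsum bB bI.
  apply: bij_split => [[x|x]|[x|x]] /=.
  - by move: (O1 x); case: (wiring G _) => // y _; exists y.
  - by move: (IO1 x); case: (wiring G _) => // y _; exists y.
  - by move: (E1 x); case: (wiring G _) => // y _; exists y.
  - by move: (I1 x); case: (wiring G _) => // y _; exists y.
have {}bBI x : wiring G (bsum bA bO x) = bsum bB bI (bports I IO E O x).
  by have := congr1 (fun h => bfun h (bports I IO E O x)) bBI; case: x => [[]|[]] x; exact.
have /choice[s sE] (x : E + O) : exists v, bU (inl v) = bsrc (bO x).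
  have := bVK bU (bsrc (bO x)).
  case: (binv bU _) => [v|v] e; first by exists v.
  by have := L1 v; rewrite e bsrcP.
have /choice[t tE] (x : E + I) : exists v, bU (inl v) = btgt (bI x).
  have := bVK bU (btgt (bI x)).
  case: (binv bU _) => [v|v] e; first by exists v.
  by have := L1 v; rewrite e btgtP.
have ordO : fiber_order s (fun x y => bro (bO x) (bO y)).
  apply: fiber_order_eq (fiber_order_pull (bij_inj_fun (f := bO)) (@broP _ G)) => x y.
  by rewrite -!sE; split=> [/(@bij_inj_fun _ _ bU) []|->].
have ordI : fiber_order t (fun x y => bri (bI x) (bI y)).
  apply: fiber_order_eq (fiber_order_pull (bij_inj_fun (f := bI)) (@briP _ G)) => x y.
  by rewrite -!tE; split=> [/(@bij_inj_fun _ _ bU) []|->].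
pose H := @PGraph k l (Graph L s t (bij_bijective bA) (bij_bijective bB)) _ _ ordI ordO.
exists H.
unshelve eexists.
  exists bU bO bI => //.
  - by move=> u; case: (bmark _).
  - case=> u /=; last by have := L1 u; rewrite negbK => ->.
    by apply: negbTE; have := V1 u.
  - by move=> o; rewrite -sE.
  - by move=> o; rewrite -tE.
apply: (@port_ind _ _ H (fun x => wiring G (map_sum id bO x) = map_sum id bI (wiring (port H) x)))
    => e.
- by rewrite portI; exact: bBI (inl (inl e)).
- by rewrite portIO; exact: bBI (inl (inr e)).
- by rewrite portE; exact: bBI (inr (inl e)).
- by rewrite portO; exact: bBI (inr (inr e)).
Qed.

(** * Planar graphs form a ProP *)

Lemma malgUZ (K : fieldType) (A : choiceType) (c : A) (z : K) : << z *g c >> = z *: << c >> :>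
    {malg K[A]}.
Proof. by apply/malgP => k; rewrite mcoeffZ !mcoeffU mulrnAr mulr1. Qed.

(** * Linear maps determined by their values on a basis *)

Section LinearExtension.
Variables (K : fieldType).

Definition lin (V W : lmodType K) (L : V -> W) :=
  forall a x y, L (a *: x + y) = a *: L x + L y.

Lemma lin0 (V W : lmodType K) (L : V -> W) : lin L -> L 0 = 0.
Proof. by move=> h; have := h (-1) 0 0; rewrite scaler0 addr0 scaleN1r addNr. Qed.

Lemma lin_sum (V W : lmodType K) (L : V -> W) I (r : seq I) (a : I -> K) (v : I -> V) :
  lin L -> L (\sum_(i <- r) a i *: v i) = \sum_(i <- r) a i *: L (v i).
Proof.
move=> h; elim: r => [|i r IHr]; first by rewrite !big_nil (lin0 h).
by rewrite !big_cons h IHr.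
Qed.

Variable (A : choiceType).

Definition lext (V : lmodType K) (f : A -> V) (x : {malg K[A]}) : V :=
  \sum_(a <- msupp x) x@_a *: f a.

Lemma lextw (V : lmodType K) (f : A -> V) (x : {malg K[A]}) (d : {fset A}) :
  (msupp x `<=` d)%fset -> lext f x = \sum_(a <- d) x@_a *: f a.
Proof.
move=> le_xd; apply: big_fset_incl => // a _ /mcoeff_outdom ->.
by rewrite scale0r.
Qed.

Lemma lext_lin (V : lmodType K) (f : A -> V) : lin (lext f).
Proof.
move=> a x y; pose d := (msupp x `|` msupp y)%fset.
have xd : (msupp x `<=` d)%fset by apply: fsubsetUl.
have yd : (msupp y `<=` d)%fset by apply: fsubsetUr.
have xyd : (msupp (a *: x + y) `<=` d)%fset.
  apply: fsubset_trans (msuppD_le _ _) _; apply: fsetSU; exact: msuppZ_le.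
rewrite (lextw _ xd) (lextw _ yd) (lextw _ xyd) scaler_sumr -big_split /=.
by apply: eq_bigr => i _; rewrite mcoeffD mcoeffZ scalerDl scalerA.
Qed.

Lemma lextU (V : lmodType K) (f : A -> V) c : lext f << c >> = f c.
Proof. by rewrite /lext msuppU oner_eq0 big_seq_fset1 mcoeffUU scale1r. Qed.

Lemma malg_lin (x : {malg K[A]}) : x = \sum_(c <- msupp x) x@_c *: << c >>.
Proof. by rewrite [LHS]monalgE; apply: eq_bigr => c _; rewrite malgUZ. Qed.

Lemma lin_eq (V : lmodType K) (L L' : {malg K[A]} -> V) :
  lin L -> lin L' -> (forall c, L << c >> = L' << c >>) -> L =1 L'.
Proof.
move=> h h' e x; rewrite (malg_lin x) !lin_sum //.
by apply: eq_bigr => c _; rewrite e.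
Qed.

Lemma lin_ext_lext (B : choiceType) (f : A -> B) (x : {malg K[A]}) :
  lin_ext f x = lext (fun a => << f a >>) x.
Proof. by apply: eq_bigr => a _; rewrite malgUZ. Qed.
End LinearExtension.

Lemma bilin_ext_lext (K : fieldType) (A B C : choiceType) (f : A -> B -> C)
    (x : {malg K[A]}) (y : {malg K[B]}) :
  bilin_ext f x y = lext (fun a => lext (fun b => << f a b >>) y) x.
Proof.
apply: eq_bigr => a _; rewrite /lext scaler_sumr; apply: eq_bigr => b _.
by rewrite scalerA malgUZ.
Qed.

Lemma lext_lin2 (K : fieldType) (A B : choiceType) (V : lmodType K) (f : A -> B -> V)
    (x : {malg K[A]}) : lin (fun y => lext (fun a => lext (f a) y) x).
Proof.
move=> a y z; rewrite /lext scaler_sumr -big_split /=; apply: eq_bigr => i _.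
by rewrite -/(lext _ _) (lext_lin (f i)) scalerDr !scalerA mulrC.
Qed.

Notation G1 := (port_setProP unit).

Definition cls k l (G : pgraph k l) : G1 (ford k) (ford l) := cl (port G).

Lemma cls_surj k l (c : G1 (ford k) (ford l)) : exists G : pgraph k l, cls G = c.
Proof.
by elim/cl_ind: c => G; have [H HG] := port_surj G; exists H; apply/clP.
Qed.

Lemma clsP k l (G G' : pgraph k l) : cls G = cls G' <-> piso G G'.
Proof. by split=> [/clP/piso_port|/port_piso/clP]. Qed.

Lemma piP k l (G G' : pgraph k l) :
  \pi_(isoclass k l) G = \pi_(isoclass k l) G' <-> cls G = cls G'.
Proof. by rewrite clsP; split=> [/eqmodP/asboolP|h] //; apply/eqmodP/asboolP. Qed.

Lemma cls_rep k l (G : pgraph k l) : cls (rep (\pi_(isoclass k l) G)) = cls G.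
Proof. by apply/piP; rewrite /rep reprK. Qed.

Lemma cls_lact k l (s : 'S_l) (G : pgraph k l) : cls (plact s G) = srl (bid _) (permb s) (cls G).
Proof. by rewrite /srl /= crl_cl; apply/clP/port_lact. Qed.
Lemma cls_ract k l (s : 'S_k) (G : pgraph k l) :
  cls (pract G s) = srl (permb s^-1%g) (bid _) (cls G).
Proof. by rewrite /srl /= crl_cl; apply/clP/port_ract. Qed.
Lemma cls_hcat k l k' l' (G : pgraph k l) (G' : pgraph k' l') :
  cls (phcat G G') = srl (bunsplit _ _) (bunsplit _ _) (shc (cls G) (cls G')).
Proof. by rewrite /srl /shc /= chc_cl crl_cl; apply/clP/port_hcat. Qed.
Lemma cls_vcat k l m (H : pgraph l m) (G : pgraph k l) :
  cls (pvcat H G) = svc (cls H) (cls G).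
Proof. by rewrite /svc /= cvc_cl; apply/clP/port_vcat. Qed.
Lemma ord0F : 'I_0 -> False. Proof. by case. Qed.

Lemma cls_unit0 : cls punit0 = sid (ford 0).
Proof.
pose f : bij void 'I_0 := bvoid (Empty_set_rect (fun=> False)) ord0F.
rewrite -(srl_id G1 (X := fvoid) f) /srl /sid /= crl_cl.
by apply/clP/port_unit0.
Qed.
Lemma cls_unit1 : cls punit1 = sid (ford 1).
Proof. by apply/clP/port_unit1. Qed.

Section IsProP.
Variable (K : fieldType).

(** The basis vectors, indexed by classes of port graphs instead of [isoclass]; the two index sets
    correspond by [piP] and [cls_surj]. Identities between basis vectors thus become identities in
    [G1]. *)
Definition vec k l (c : G1 (ford k) (ford l)) : PGr K k l :=
  pgr_vec K (sval (cid (cls_surj c))).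

Lemma vecE k l (G : pgraph k l) : vec (cls G) = pgr_vec K G.
Proof. by rewrite /vec; case: (cid _) => H /= /piP e; rewrite /pgr_vec e. Qed.

Lemma vec_basis k l (c : isoclass k l) : << c >> = vec (cls (rep c)) :> {malg K[isoclass k l]}.
Proof. by rewrite vecE /pgr_vec /rep reprK. Qed.

Lemma vec_ind k l (Pr : G1 (ford k) (ford l) -> Prop) :
  (forall G, Pr (cls G)) -> forall c, Pr c.
Proof. by move=> h c; have [G <-] := cls_surj c. Qed.

Lemma vec_lact k l (s : 'S_l) (c : G1 (ford k) (ford l)) :
  lact s (vec c) = vec (srl (bid _) (permb s) c).
Proof.
elim/vec_ind: c => G; rewrite -cls_lact !vecE /lact /= lin_ext_lext lextU.
by congr << _ >>; apply/piP; rewrite !cls_lact cls_rep.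
Qed.
Lemma vec_ract k l (s : 'S_k) (c : G1 (ford k) (ford l)) :
  ract (vec c) s = vec (srl (permb s^-1%g) (bid _) c).
Proof.
elim/vec_ind: c => G; rewrite -cls_ract !vecE /ract /= lin_ext_lext lextU.
by congr << _ >>; apply/piP; rewrite !cls_ract cls_rep.
Qed.
Lemma vec_hcat k l k' l' (c : G1 (ford k) (ford l)) (d : G1 (ford k') (ford l')) :
  hcat (vec c) (vec d) = vec (srl (bunsplit _ _) (bunsplit _ _) (shc c d)).
Proof.
elim/vec_ind: c => G; elim/vec_ind: d => H.
rewrite -cls_hcat !vecE /hcat /= bilin_ext_lext !lextU.
by congr << _ >>; apply/piP; rewrite !cls_hcat !cls_rep.
Qed.
Lemma vec_vcat k l m (c : G1 (ford l) (ford m)) (d : G1 (ford k) (ford l)) :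
  vcat (vec c) (vec d) = vec (svc c d).
Proof.
elim/vec_ind: c => G; elim/vec_ind: d => H.
rewrite -cls_vcat !vecE /vcat /= bilin_ext_lext !lextU.
by congr << _ >>; apply/piP; rewrite !cls_vcat !cls_rep.
Qed.
Lemma vec_pcast k l k' l' (e : k = k') (e' : l = l') (c : G1 (ford k) (ford l)) :
  pcast e e' (vec c) = vec (srl (bcast e) (bcast e') c).
Proof.
subst k' l'; rewrite pcast_id.
have bc n : bcast (erefl n) = bid _ by apply: bij_ext => i; exact: val_inj.
by rewrite !bc srl1.
Qed.
Lemma vec_unit0 : unit0 (PGr K) = vec (sid (ford 0)).
Proof. by rewrite -cls_unit0 vecE. Qed.
Lemma vec_unit1 : unit1 (PGr K) = vec (sid (ford 1)).
Proof. by rewrite -cls_unit1 vecE. Qed.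
Lemma vec_unitn n : unitn (PGr K) n = vec (sid (ford n)).
Proof.
elim: n => [|n IHn]; first exact: vec_unit0.
rewrite -[unitn _ _]/(hcat (unit1 (PGr K)) (unitn (PGr K) n)).
by rewrite IHn vec_unit1 vec_hcat shc_id srl_id.
Qed.

Lemma pgr_lact_lin k l (s : 'S_l) a (p q : PGr K k l) :
  lact s (a *: p + q) = a *: lact s p + lact s q.
Proof. by rewrite /lact /= !lin_ext_lext lext_lin. Qed.
Lemma pgr_ract_lin k l (s : 'S_k) a (p q : PGr K k l) :
  ract (a *: p + q) s = a *: ract p s + ract q s.
Proof. by rewrite /ract /= !lin_ext_lext lext_lin. Qed.
Lemma pgr_hcat_linl k l k' l' a (p q : PGr K k l) (r : PGr K k' l') :
  hcat (a *: p + q) r = a *: hcat p r + hcat q r.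
Proof. by rewrite /hcat /= !bilin_ext_lext lext_lin. Qed.
Lemma pgr_hcat_linr k l k' l' a (p : PGr K k l) (q r : PGr K k' l') :
  hcat p (a *: q + r) = a *: hcat p q + hcat p r.
Proof. by rewrite /hcat /= !bilin_ext_lext lext_lin2. Qed.
Lemma pgr_vcat_linl k l m a (p q : PGr K l m) (r : PGr K k l) :
  vcat (a *: p + q) r = a *: vcat p r + vcat q r.
Proof. by rewrite /vcat /= !bilin_ext_lext lext_lin. Qed.
Lemma pgr_vcat_linr k l m a (p : PGr K l m) (q r : PGr K k l) :
  vcat p (a *: q + r) = a *: vcat p q + vcat p r.
Proof. by rewrite /vcat /= !bilin_ext_lext lext_lin2. Qed.
Lemma pcast_lin (P : proPData K) k l k' l' (e : k = k') (e' : l = l') a (p q : P k l) :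
  pcast e e' (a *: p + q) = a *: pcast e e' p + pcast e e' q.
Proof. by subst k' l'; rewrite !pcast_id. Qed.

Definition pgr_lin := (pgr_lact_lin, pgr_ract_lin, pgr_hcat_linl, pgr_hcat_linr,
  pgr_vcat_linl, pgr_vcat_linr, pcast_lin).
Definition vec_op := (vec_lact, vec_ract, vec_hcat, vec_vcat, vec_pcast, vec_unit0,
  vec_unit1, vec_unitn).

Lemma vec_lin_eq k l (V : lmodType K) (L L' : PGr K k l -> V) :
  lin L -> lin L' -> (forall c, L (vec c) = L' (vec c)) -> L =1 L'.
Proof. by move=> h h' e; apply: lin_eq => // c; rewrite vec_basis. Qed.

(** By multilinearity an axiom has to be checked on basis vectors only, where it is a law of [G1] up
    to the numbering of sums of ordinals. *)
Ltac to_vec := repeat match goal with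
  | p : GRing.Lmodule.sort (pcar (PGr K) _ _) |- _ =>
     let c := fresh "c" in
     move: p; apply: vec_lin_eq => [? ? ?|? ? ?|c]; rewrite ?pgr_lin //
  end; rewrite ?vec_op; congr vec.

Ltac shift_simp := rewrite /= ?(split_lshift, split_rshift, cast_shift) /=.

Lemma isProP_PGr : isProP (PGr K).
Proof.
split; intros; rewrite ?pgr_lin //.
all: to_vec.
- by rewrite permb1 srl1.
- by rewrite srlM permbM bcomp1l.
- by rewrite invg1 permb1 srl1.
- by rewrite srlM permbM bcomp1l /pcomp invMg.
- by rewrite !srlM !bcomp1r !bcomp1l.
- rewrite -{1}[c1]srl1 -[in RHS](srl1 c) !shc_rl -shcA !srlM.
  by congr srl; apply: bij_ext => [[x|[x|x]]]; shift_simp.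
- rewrite -(srl_id G1 (bvoid (Empty_set_rect (fun=> False)) ord0F)).
  rewrite -{1}[c]srl1 shc_rl !srlM -[RHS](shc0l c).
  by congr srl; apply: bij_ext => [[[]|x]]; apply: val_inj.
- rewrite -(srl_id G1 (bvoid (Empty_set_rect (fun=> False)) ord0F)).
  rewrite -{1}[c]srl1 shc_rl !srlM -[RHS](shc0l c) -shcC srlM.
  by congr srl; apply: bij_ext => [[[]|x]]; apply: val_inj.
- exact: svcA.
- exact: svc1l.
- exact: svc1r.
- by rewrite svc_rl sxch.
- by rewrite svc_lrl.
- by rewrite svc_rrl.
- rewrite svc_mrl; congr (svc (srl _ _ _) _); exact: bij_ext.
- by rewrite shc_rl !srlM; congr srl; apply: bij_ext => [[x|x]]; shift_simp; rewrite ?permE;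
    shift_simp.
- rewrite shc_rl !srlM; congr srl; apply: bij_ext => [[x|x]] /=; do ?[by []];
  by apply: (canRL (permK _)); rewrite permE; shift_simp; rewrite permKV.
- rewrite -(shcC c c0) !srlM; congr srl; apply: bij_ext => [[x|x]] /=;
  first [apply: (canRL (permK _)) | idtac]; rewrite permE; apply: val_inj; rewrite /= /swapp_fun;
      shift_simp; by [].
Qed.
End IsProP.

(** * Peeling off a set of vertices *)

Definition sum_rot A B C D : bij (((A + B) + C) + D) (((A + C) + D) + B).
Proof.
exists (fun x => match x with
  | inl (inl (inl a)) => inl (inl (inl a)) | inl (inl (inr b)) => inr b
  | inl (inr c) => inl (inl (inr c)) | inr d => inl (inr d) end)
 (fun x => match x with
  | inl (inl (inl a)) => inl (inl (inl a)) | inr b => inl (inl (inr b))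
  | inl (inl (inr c)) => inl (inr c) | inl (inr d) => inr d end).
by case=> [[[]|]|]. by case=> [[[]|]|].
Defined.

Section Peel.
Variable C : Type.
Implicit Types X Y A B R : finType.

(* Represents scons f H a, without the empty set of vertices that sid R would add. *)
Definition gpeel X Y A B R (f : bij (A + R) X) (H : port_graph C (fsum B R) Y)
    (a : port_graph C A B) : port_graph C X Y :=
  @PortGraph C X Y (bbodyD a H)
   (bcomp (bsum (bid _) (bsumC _ _)) (bcomp (bsym (bsumA _ _ _))
   (bcomp (bsum (wiring H) (bid _)) (bcomp (sum_rot _ _ _ _)
   (bcomp (bsum (bsum (wiring a) (bid _)) (bid _)) (bcomp (bsum (bsumAC _ _ _) (bid _))
   (bcomp (bsumA _ _ _) (bsum (bsym f) (bid _))))))))).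

Lemma gpeel_cons X Y A B R (f : bij (A + R) X) (H : port_graph C (fsum B R) Y)
    (a : port_graph C A B) :
  cl (gpeel f H a) = scons (D := port_setProP C) f (cl H) (cl a).
Proof.
rewrite /scons /shc /svc /srl /sid /= chc_cl cvc_cl crl_cl; apply/clP/port_iso_sym.
exists (bisoD (bisoM (biso0 _) (bisoC _ _)) (biso1 H)).
move=> x; destruct x as [x|[[o|[]]|o]]; last by wire.
  simpl; case: (binv f x) => z; wire.
by wire.
Qed.

Definition initial X Y (G : port_graph C X Y) (P : pred (bU G)) :=
  forall o i, wiring G (inr o) = inr i -> P (btgt i) -> P (bsrc o).
Definition noIO X Y (G : port_graph C X Y) := forall x, exists i, wiring G (inl x) = inr i.
(* Strong connectivity, without paths: no proper nonempty set of vertices is *)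
(* closed under predecessors. *)
Definition connected X Y (G : port_graph C X Y) :=
  (exists u : bU G, True) /\
  forall P : pred (bU G), initial P -> (exists u, P u) -> forall u, P u.
Definition atom X Y (G : port_graph C X Y) := noIO G /\ connected G.

Lemma atom_iso X Y (G K : port_graph C X Y) : port_iso G K -> atom G -> atom K.
Proof.
move=> [f fw] [nio [[u0 _] con]]; split.
  move=> x; have [i e] := nio x; exists (fI f i).
  by have := fw (inl x); rewrite e.
split; first by exists (fU f u0).
move=> P iP [u Pu] v; rewrite -[v](bVK (fU f)).
apply: (con (fun u => P (fU f u))); last by exists (binv (fU f) u); rewrite bVK.
move=> o i e; rewrite -ftgt -fsrc; apply: iP.
by have := fw (inr o); rewrite e.
Qed.

Lemma atom_rl X Y X' Y' (f : bij X X') (g : bij Y Y') (G : port_graph C X Y) :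
  atom G -> atom (grl f g G).
Proof.
move=> [nio [ne con]]; split.
  by move=> x; have [i e] := nio (binv f x); exists i; rewrite /= e.
split=> // P iP; apply: con => o i e; apply: iP => /=.
by rewrite e.
Qed.

(** Half-edges follow their vertices, so once the marks force the vertices to split, the half-edges
    split as well. *)
Lemma biso_split (B1 B2 B1' B2' : body C) (f : biso (bbodyD B1 B2) (bbodyD B1' B2')) (p : pred C) :
  (forall u : bU B1, p (bmark u)) -> (forall u : bU B1', p (bmark u)) ->
  (forall u : bU B2, ~~ p (bmark u)) -> (forall u : bU B2', ~~ p (bmark u)) ->
  exists (f1 : biso B1 B1') (f2 : biso B2 B2'),
    fO f = bsum (fO f1) (fO f2) /\ fI f = bsum (fI f1) (fI f2).
Proof.
move=> p1 p1' p2 p2'.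
have [U1 [U2 eU]] : exists (g : bij (bU B1) (bU B1')) (h : bij (bU B2) (bU B2')), fU f = bsum g h.
  apply: bij_split => u.
    have /= := fmark f (inl u); case: (fU f _) => [v _|v /= e]; first by exists v.
    by have := p2' v; rewrite e p1.
  have /= := fmark f (inr u); case: (fU f _) => [v /= e|v _]; last by exists v.
  by have := p2 u; rewrite -e p1'.
have [O1 [O2 eO]] : exists (g : bij (bOut B1) (bOut B1')) (h : bij (bOut B2) (bOut B2')), fO f
    = bsum g h.
  apply: bij_split => u.
    by have /= := fsrc f (inl u); rewrite eU; case: (fO f _) => // v _; exists v.
  by have /= := fsrc f (inr u); rewrite eU; case: (fO f _) => // v _; exists v.
have [I1 [I2 eI]] : exists (g : bij (bIn B1) (bIn B1')) (h : bij (bIn B2) (bIn B2')), fI f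
    = bsum g h.
  apply: bij_split => u.
    by have /= := ftgt f (inl u); rewrite eU; case: (fI f _) => // v _; exists v.
  by have /= := ftgt f (inr u); rewrite eU; case: (fI f _) => // v _; exists v.
case: f eU eO eI => fU fO fI fm fl fs ft fo fi /= eU eO eI; subst fU fO fI.
unshelve eexists.
  exists U1 O1 I1 => [u|u|o|i|o o'|i i'].
  - exact: (fm (inl u)). - exact: (fl (inl u)).
  - by case: (fs (inl o)). - by case: (ft (inl i)).
  - exact: (fo (inl o) (inl o')). - exact: (fi (inl i) (inl i')).
unshelve eexists.
  exists U2 O2 I2 => [u|u|o|i|o o'|i i'].
  - exact: (fm (inr u)). - exact: (fl (inr u)).
  - by case: (fs (inr o)). - by case: (ft (inr i)).
  - exact: (fo (inr o) (inr o')). - exact: (fi (inr i) (inr i')).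
by [].
Qed.

Definition set_marks C' X Y (G : port_graph C X Y) (m : bU G -> C') : port_graph C' X Y :=
  @PortGraph C' X Y (Body m (@bsrcP C G) (@btgtP C G) (@broP C G) (@briP C G)) (wiring G).

End Peel.

(** * The marked set determines the decomposition *)

Section DecUniq.
Variables (C : Type) (X Y A B R A' B' R' : finType).
Variables (f : bij (A + R) X) (H : port_graph C (fsum B R) Y) (a : port_graph C A B).
Variables (f' : bij (A' + R') X) (H' : port_graph C (fsum B' R') Y) (a' : port_graph C A' B').
Variable p : pred C.
Hypotheses (pa : forall u : bU a, p (bmark u)) (pa' : forall u : bU a', p (bmark u)).
Hypotheses (pH : forall u : bU H, ~~ p (bmark u)) (pH' : forall u : bU H', ~~ p (bmark u)).
Hypotheses (na : noIO a) (na' : noIO a').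
Hypothesis eq_peel : port_iso (gpeel f H a) (gpeel f' H' a').

(** As no wire crosses [a], the interface [A] is read off as the inputs entering a marked vertex,
    and [B] as the half-edges leaving the marked part; an isomorphism respecting the marks then
    matches all the interfaces and both wirings. *)
Lemma dec_uniq : exists (u : bij A A') (v : bij B B') (w : bij R R'),
  [/\ f' = bcomp f (bsym (bsum u w)), port_iso (grl u v a) a'
    & port_iso (grl (bsum v w) (bid Y) H) H'].
Proof.
case: eq_peel => g gw.
have [g1 [g2 [eO eI]]] := biso_split g pa pa' pH pH'.
have wI x : wiring (gpeel f' H' a') (inl (f x)) = map_sum id (bsum (fI g1) (fI g2))
    (wiring (gpeel f H a) (inl (f x))).
  by rewrite -eI; exact: (gw (inl (f x))).
have wO o : wiring (gpeel f' H' a') (inr (bsum (fO g1) (fO g2) o)) =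
    map_sum id (bsum (fI g1) (fI g2)) (wiring (gpeel f H a) (inr o)).
  by rewrite -eI -eO; exact: (gw (inr o)).
(* A wire from [A] stops at a marked vertex since [a] has no through wire, while a wire from [R]
   goes to [H]; so an isomorphism cannot mix the two. *)
have [u [w euw]] : exists (u : bij A A') (w : bij R R'), bcomp (bsym f') f = bsum u w.
  apply: bij_split => x /=.
    have [i e] := na x; have /= := wI (inl x); rewrite bK /= e /=.
    case: (binv f' _) => [x' _|r]; first by exists x'.
    by simpl; case: (wiring H' _).
  have /= := wI (inr x); rewrite bK /=.
  case: (binv f' _) => [x'|r _]; last by exists r.
  have [i e] := na' x'; rewrite /= e /=.
  by case: (wiring H _).
have fE x : binv f' (f x) = bsum u w x by rewrite -euw.
have aI x i : wiring a (inl x) = inr i -> wiring a' (inl (u x)) = inr (fI g1 i).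
  move=> e; have /= := wI (inl x); rewrite bK /= e /= fE /=.
  by case: (wiring a' _) => /= [b|j [->]] //; case: (wiring H' _).
have aO o i : wiring a (inr o) = inr i -> wiring a' (inr (fO g1 o)) = inr (fI g1 i).
  move=> e; have /= := wO (inl o); rewrite e /=.
  by case: (wiring a' _) => /= [b|j [->]] //; case: (wiring H' _).
have aB o b : wiring a (inr o) = inl b -> exists b', wiring a' (inr (fO g1 o)) = inl b'.
  move=> e; have /= := wO (inl o); rewrite e /=.
  case: (wiring a' _) => /= [b' _|j]; first by exists b'.
  by case: (wiring H _).
(* Every point of [B] is the end of an outgoing half-edge of [a], the wires from [A] all stopping at
   vertices; [v] follows that half-edge. *)
have [v [v' ev]] : exists (v : bij B B') (v' : bij (bIn a) (bIn a')),
    bcomp (wiring a') (bcomp (bsum u (fO g1)) (bsym (wiring a))) = bsum v v'.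
  apply: bij_split => [b|i] /=.
    have := bVK (wiring a) (inl b); case: (binv _ _) => [x|o] e /=.
      by have [i e'] := na x; rewrite e' in e.
    exact: aB e.
  have := bVK (wiring a) (inr i); case: (binv _ _) => [x|o] e /=.
    by exists (fI g1 i); apply: aI.
  by exists (fI g1 i); apply: aO.
have aw x : wiring a' (bsum u (fO g1) x) = bsum v v' (wiring a x) by rewrite -ev /= bK.
have v'E i : v' i = fI g1 i.
  have := bVK (wiring a) (inr i); case: (binv _ _) => [x|o] e /=.
    by have := aw (inl x); rewrite e [bsum _ _ (inl x)]/= (aI _ _ e) => -[].
  by have := aw (inr o); rewrite e [bsum _ _ (inr o)]/= (aO _ _ e) => -[].
have Hw z : wiring H' (map_sum (bsum v w) (fO g2) z) = map_sum id (fI g2) (wiring H z).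
  case: z => [[b|r]|o].
  - have := bVK (wiring a) (inl b); case: (binv _ _) => [x|o] e /=.
      by have [i e'] := na x; rewrite e' in e.
    have := aw (inr o); rewrite e /= => e'.
    have /= := wO (inl o); rewrite e e' /=.
    by case: (wiring H' _) => [y|i]; case: (wiring H _) => [y'|i'] //= [] ->.
  - have /= := wI (inr r); rewrite bK fE /=.
    by case: (wiring H' _) => [y|i]; case: (wiring H _) => [y'|i'] //= [] ->.
  - have /= := wO (inr o).
    by case: (wiring H' _) => [y|i]; case: (wiring H _) => [y'|i'] //= [] ->.
exists u, v, w; split.
- by rewrite -euw; apply: bij_ext => x /=; rewrite bVK.
- exists g1 => x; have := aw (map_sum (binv u) id x).
  have -> : bsum u (fO g1) (map_sum (binv u) id x) = map_sum id (fO g1) x.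
    by case: x => y //=; rewrite bVK.
  by move=> /= ->; case: (wiring a _) => y //=; rewrite v'E.
- exists g2 => x; have := Hw (map_sum (binv (bsum v w)) id x).
  have -> : map_sum (bsum v w) (fO g2) (map_sum (binv (bsum v w)) id x) = map_sum id (fO g2) x.
    by case: x => y //; rewrite [LHS]/= -[map_sum v w _]/(bsum v w (binv (bsum v w) y)) bVK.
  by move=> ->; rewrite /=; case: (wiring H _).
Qed.
End DecUniq.

(** * Peeling off a set closed under predecessors *)

Section DecExists.
Variable C : Type.

Definition pull_body (B : body C) (U O I : finType) (jU : U -> bU B) (jO : O -> bOut B)
   (jI : I -> bIn B) (s : O -> U) (t : I -> U)
   (U_inj : injective jU) (O_inj : injective jO) (I_inj : injective jI)
   (sE : forall o, jU (s o) = bsrc (jO o)) (tE : forall i, jU (t i) = btgt (jI i)) : body C.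
Proof.
refine (@Body C U O I (fun u => bmark (jU u)) (fun u => bloop (jU u)) s t
  (fun x y => bro (jO x) (jO y)) (fun x y => bri (jI x) (jI y)) _ _ _ _).
- by move=> o; rewrite sE bsrcP.
- by move=> i; rewrite tE btgtP.
- apply: fiber_order_eq (fiber_order_pull O_inj (@broP _ B)) => x y.
  by rewrite -!sE; split=> [/U_inj|->].
- apply: fiber_order_eq (fiber_order_pull I_inj (@briP _ B)) => x y.
  by rewrite -!tE; split=> [/U_inj|->].
Defined.

Definition in_part X Y (G : port_graph C X Y) (p : pred C) (y : Y + bIn G) :=
  match y with inl _ => false | inr i => p (bmark (btgt i)) end.

Definition dec_src A N B R O : bij ((A + N) + ((B + R) + O)) ((A + R) + ((N + B) + O)).
Proof.
exists (fun z => match z with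
  | inl (inl x) => inl (inl x) | inl (inr n) => inr (inl (inl n))
  | inr (inl (inl b)) => inr (inl (inr b)) | inr (inl (inr r)) => inl (inr r)
  | inr (inr o) => inr (inr o) end)
 (fun z => match z with
  | inl (inl x) => inl (inl x) | inr (inl (inl n)) => inl (inr n)
  | inr (inl (inr b)) => inr (inl (inl b)) | inl (inr r) => inr (inl (inr r))
  | inr (inr o) => inr (inr o) end).
by case=> [[]|[[]|]]. by case=> [[]|[[]|]].
Defined.

(** The inputs are cut into those entering the part ([A]) and the others ([R]), the outgoing
    half-edges of the part into those staying inside ([N]) and those leaving it ([B]). The wiring of
    [G] then restricts to a bijection from [A + N] to the incoming half-edges of the part and to
    another from [(B + R) + O2] to the remaining targets, which is the wiring of [H]. *)
Lemma dec_ex (X Y : finType) (G : port_graph C X Y) (p : pred C) :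
  initial (fun u : bU G => p (bmark u)) ->
  exists (A B R : finType) (f : bij (A + R) X) (H : port_graph C (fsum B R) Y)
      (a : port_graph C A B),
    [/\ port_iso G (gpeel f H a), noIO a, forall u : bU a, p (bmark u)
      & forall u : bU H, ~~ p (bmark u)].
Proof.
move=> ini.
have [U1 [U2 [jU [U1p U2p]]]] := pred_split (fun u : bU G => p (bmark u)).
have [O1 [O2 [jO [O1p O2p]]]] := pred_split (fun o : bOut G => p (bmark (bsrc o))).
have [I1 [I2 [jI [I1p I2p]]]] := pred_split (fun i : bIn G => p (bmark (btgt i))).
have [A [R [jX [Ap Rp]]]] := pred_split (fun x : X => in_part p (wiring G (inl x))).
have [N [B [jN [Np Bp]]]] := pred_split (fun o : fsfin O1 => in_part p
    (wiring G (inr (jO (inl o))))).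
pose W : bij ((A + N) + ((B + R) + O2)) (I1 + (Y + I2)) :=
  bcomp (bsumCA Y I1 I2) (bcomp (bsum (bid Y) (bsym jI)) (bcomp (wiring G)
   (bcomp (bsum jX (bcomp jO (bsum jN (bid O2)))) (dec_src _ _ _ _ _)))).
have Wl y : in_part p y -> exists i, bsumCA Y I1 I2 (bsum (bid Y) (bsym jI) y) = inl i.
  case: y => [//|i] /=; have := bVK jI i; case: (binv jI i) => j; first by exists j.
  by move=> <- pj; have := I2p j; rewrite pj.
have Wr y : ~~ in_part p y -> exists i, bsumCA Y I1 I2 (bsum (bid Y) (bsym jI) y) = inr i.
  case: y => [y|i] /=; first by exists (inl y).
  have := bVK jI i; case: (binv jI i) => j; last by exists (inr j).
  by move=> <-; rewrite I1p.
have [w1 [w2 eW]] : exists (w1 : bij (A + N) I1) (w2 : bij ((B + R) + O2) (Y + I2)), W = bsum w1 w2.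
  apply: bij_split => [[x|n]|[[b|r]|o]]; rewrite /W.
  - exact/Wl/Ap.
  - exact/Wl/Np.
  - exact/Wr/Bp.
  - exact/Wr/Rp.
  (* Here closure under predecessors enters: an edge starting outside the part cannot end in it. *)
  - apply: Wr; apply/negP => /= h; have /negP := O2p o; apply.
    by move: h; case e: (wiring G _) => [//|i] /= h; apply: (ini _ _ e).
have wE z : wiring G (bsum jX (bcomp jO (bsum jN (bid O2))) (dec_src _ _ _ _ _ z)) =
    bsum (bid Y) jI (bsumCA I1 Y I2 (bsum w1 w2 z)).
  rewrite -eW /W /=; case: (wiring G _) => [y|i] //=.
  by have := bVK jI i; case: (binv jI i) => j /= <-.
have /choice[s1 s1E] (o : O1) : exists u : U1, jU (inl u) = bsrc (jO (inl o)).
  have := bVK jU (bsrc (jO (inl o))); case: (binv jU _) => u e; first by exists u.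
  by have := U2p u; rewrite e O1p.
have /choice[s2 s2E] (o : O2) : exists u : U2, jU (inr u) = bsrc (jO (inr o)).
  have := bVK jU (bsrc (jO (inr o))); case: (binv jU _) => u e; last by exists u.
  by have := O2p o; rewrite -e U1p.
have /choice[t1 t1E] (i : I1) : exists u : U1, jU (inl u) = btgt (jI (inl i)).
  have := bVK jU (btgt (jI (inl i))); case: (binv jU _) => u e; first by exists u.
  by have := U2p u; rewrite e I1p.
have /choice[t2 t2E] (i : I2) : exists u : U2, jU (inr u) = btgt (jI (inr i)).
  have := bVK jU (btgt (jI (inr i))); case: (binv jU _) => u e; last by exists u.
  by have := I2p i; rewrite -e U1p.
have linj T1 T2 T (j : bij (T1 + T2) T) : injective (fun x => j (inl x)) by move=>
    x y /(@bij_inj_fun _ _ j) [].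
have rinj T1 T2 T (j : bij (T1 + T2) T) : injective (fun x => j (inr x)) by move=>
    x y /(@bij_inj_fun _ _ j) [].
pose B1 := @pull_body G (fsfin U1) (fsfin O1) (fsfin I1) _ _ _ s1 t1 (linj _ _ _ jU)
    (linj _ _ _ jO) (linj _ _ _ jI) s1E t1E.
pose B2 := @pull_body G (fsfin U2) (fsfin O2) (fsfin I2) _ _ _ s2 t2 (rinj _ _ _ jU)
    (rinj _ _ _ jO) (rinj _ _ _ jI) s2E t2E.
pose wa : bij (A + O1) (B + I1) := bcomp (bsumC _ _) (bcomp (bsum w1 (bid B))
  (bcomp (bsumA _ _ _) (bsum (bid A) (bsym jN)))).
exists (fsfin A), (fsfin B), (fsfin R), jX, (@PortGraph C (fsum (fsfin B) (fsfin R)) Y B2 w2),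
  (@PortGraph C (fsfin A) (fsfin B) B1 wa); split => //; last 1 first.
- by move=> x; exists (w1 (inl x)).
apply: port_iso_sym.
have o12 o o' : bro (jO (inl o)) (jO (inr o')) = false.
  by apply/negP => /(fib_same (@broP _ G)); rewrite -s1E -s2E => /(@bij_inj_fun _ _ jU).
have o21 o o' : bro (jO (inr o)) (jO (inl o')) = false.
  by apply/negP => /(fib_same (@broP _ G)); rewrite -s1E -s2E => /(@bij_inj_fun _ _ jU).
have i12 o o' : bri (jI (inl o)) (jI (inr o')) = false.
  by apply/negP => /(fib_same (@briP _ G)); rewrite -t1E -t2E => /(@bij_inj_fun _ _ jU).
have i21 o o' : bri (jI (inr o)) (jI (inl o')) = false.
  by apply/negP => /(fib_same (@briP _ G)); rewrite -t1E -t2E => /(@bij_inj_fun _ _ jU).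
unshelve eexists.
  by exists jU jO jI => [[u|u]|[u|u]|[o|o]|[i|i]|[o|o] [o'|o']|[i|i] [i'|i']] //=.
case=> [x|[o|o]].
- rewrite -[x](bVK jX); case: (binv jX x) => y.
    by rewrite (wE (inl (inl y))) /= bK.
  rewrite (wE (inr (inl (inr y)))) /= bK /=.
  by case: (w2 _).
- rewrite -[o](bVK jN); case: (binv jN o) => y.
    by rewrite (wE (inl (inr y))) /= bK.
  rewrite (wE (inr (inl (inl y)))) /= bK /=.
  by case: (w2 _).
- rewrite (wE (inr (inr o))) /=.
  by case: (w2 _).
Qed.
End DecExists.

(** [g] tells how the second peeling reads the wires left by the first. If its inputs [A'] all lie
    in [R], then [R] is [A'] together with a set [S] of wires avoiding both peeled parts, and
    counting the wires that come from [B] identifies [R'] with [B + S]. *)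
Lemma swap_split (A' R' B R : finType) (g : bij (A' + R') (B + R)) :
  (forall x, exists r, g (inl x) = inr r) ->
  exists (S : finType) (rho : bij (A' + S) R) (sigma : bij (B + S) R'),
    bcomp g (bsum (bid A') sigma) = bcomp (bsum (bid B) rho) (bsumCA A' B S).
Proof.
move=> gA.
have [A1 [S [jR [A1p Sp]]]] := pred_split (fun r : R => is_inl (binv g (inr r))).
have [B1 [S' [jR' [B1p S'p]]]] := pred_split (fun r : R' => is_inl (g (inr r))).
pose h := bcomp (bsumCA B A1 S) (bcomp (bsum (bid B) (bsym jR)) (bcomp g (bsum (bid A') jR'))).
have [hA [hBS eh]] : exists (hA : bij A' A1) (hBS : bij (B1 + S') (B + S)), h = bsum hA hBS.
  apply: bij_split => [x|x] /=.
    have [r e] := gA x; rewrite e /=; have := bVK jR r.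
    case: (binv jR r) => y er; first by exists y.
    by have := Sp y; rewrite er -e bK.
  case: x => [b|s] /=.
    by have := B1p b; case: (g _) => // b' _; exists (inl b').
  have := S'p s; case e: (g _) => [//|r] _ /=; have := bVK jR r.
  case: (binv jR r) => y er; last by exists (inr y).
  by have := A1p y; rewrite er -e bK.
have [hB [hS eBS]] : exists (hB : bij B1 B) (hS : bij S' S), hBS = bsum hB hS.
  apply: bij_split => [b|s].
    have := congr1 (fun k => bfun k (inr (inl b))) eh; rewrite /h /=.
    by have := B1p b; case: (g _) => // b' _ [<-]; exists b'.
  have := congr1 (fun k => bfun k (inr (inr s))) eh; rewrite /h /=.
  have := S'p s; case e: (g _) => [//|r] _ /=; have := bVK jR r.
  case: (binv jR r) => y er; last by case=> <-; exists y.
  by have := A1p y; rewrite er -e bK.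
exists (fsfin S), (bcomp jR (bsum hA (bid S))), (bcomp jR' (bsum (bsym hB) (bsym hS))).
subst hBS; apply: bij_ext => x.
have gE z : g (bsum (bid A') jR' z) = bsum (bid B) jR (bsumCA A1 B S (bsum hA (bsum hB hS) z)).
  rewrite -eh /h /=; case: (g _) => [y|y] //=.
  by have := bVK jR y; case: (binv jR y) => r /= <-.
case: x => [x|[x|x]].
- exact: (gE (inl x)).
- by have := gE (inr (inl (binv hB x))); rewrite /= bVK.
- by have := gE (inr (inr (binv hS x))); rewrite /= bVK.
Qed.

Section Marks.
Variables (C : Type) (X Y : finType).
Implicit Types (G K : port_graph C X Y).

Lemma initial_iso G K (p : pred C) : port_iso G K ->
  initial (fun u : bU G => p (bmark u)) -> initial (fun u : bU K => p (bmark u)).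
Proof.
move=> [f fw] ini o i e.
have /= e' : wiring G (inr (binv (fO f) o)) = inr (binv (fI f) i).
  have := fw (inr (binv (fO f) o)); rewrite /= bVK e.
  by case: (wiring G _) => //= j [->]; rewrite bK.
have := ini _ _ e'; rewrite -!(fmark f) -fsrc -ftgt !bVK.
exact.
Qed.

Lemma initial_peel (A B R : finType) (f : bij (A + R) X) (H : port_graph C (fsum B R) Y)
    (a : port_graph C A B)
    (p : pred C) :
  initial (fun u : bU (gpeel f H a) => p (bmark u)) -> initial (fun u : bU H => p (bmark u)).
Proof. by move=> ini o i e; apply: (ini (inr o) (inr i)); rewrite /= e. Qed.

Definition erase_marks G : port_graph unit X Y := set_marks (G := G) (fun=> tt).

Lemma unmark (G : port_graph unit X Y) (m : bU G -> C) K : port_iso (set_marks m) K -> port_iso G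
    (erase_marks K).
Proof.
case=> f fw; pose U : bij (bU G) (bU K) := fU f; pose O : bij (bOut G) (bOut K) := fO f;
pose I : bij (bIn G) (bIn K) := fI f; unshelve eexists.
  exists U O I => [u|u|o|i|o o'|i i'].
  - by case: (bmark u).
  - exact: (floop f). - exact: (fsrc f). - exact: (ftgt f). - exact: (fro f). - exact: (fri f).
exact: fw.
Qed.

Lemma erase_marks_iso G K : port_iso G K -> port_iso (erase_marks G) (erase_marks K).
Proof.
case=> f fw; pose U : bij (bU (erase_marks G)) (bU (erase_marks K)) := fU f; pose O : bij
    (bOut (erase_marks G)) (bOut (erase_marks K)) := fO f;
pose I : bij (bIn (erase_marks G)) (bIn (erase_marks K)) := fI f; unshelve eexists.
  exists U O I => [u|u|o|i|o o'|i i'].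
  - by []. - exact: (floop f). - exact: (fsrc f).
  - exact: (ftgt f). - exact: (fro f). - exact: (fri f).
exact: fw.
Qed.

Lemma erase_marks_peel (A B R : finType) (f : bij (A + R) X) (H : port_graph C (fsum B R) Y)
    (a : port_graph C A B) :
  port_iso (set_marks (G := gpeel f H a) (fun=> tt))
      (gpeel f (set_marks (G := H) (fun=> tt)) (set_marks (G := a) (fun=> tt))).
Proof.
unshelve eexists.
  exists (bid (bU a + bU H)) (bid (bOut a + bOut H)) (bid (bIn a + bIn H)) => //; by case.
by move=> x; rewrite /= !map_sum_id.
Qed.

(** Marks put on [G] pass to both parts of a given decomposition of [G]; two decompositions of one
    graph can thus be compared through the same marks. *)
Lemma peel_mark C' G (A B R : finType) (f : bij (A + R) X) (H : port_graph C (fsum B R) Y)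
    (a : port_graph C A B)
    (g : biso G (gpeel f H a)) (m : bU G -> C') :
  (forall x, wiring (gpeel f H a) (map_sum id (fO g) x) = map_sum id (fI g) (wiring G x)) ->
  port_iso (set_marks m) (gpeel f (set_marks (fun u => m (binv (fU g) (inr u))))
                           (set_marks (fun u => m (binv (fU g) (inl u))))).
Proof.
move=> gw; pose U : bij (bU G) (bU a + bU H) := fU g; pose O : bij (bOut G) (bOut a + bOut H)
    := fO g;
pose I : bij (bIn G) (bIn a + bIn H) := fI g; unshelve eexists.
  exists U O I => [u|u|o|i|o o'|i i'].
  - rewrite /= -[u in RHS](bK (fU g)).
    by case: (fU g u).
  - exact: (floop g). - exact: (fsrc g). - exact: (ftgt g). - exact: (fro g). - exact: (fri g).
exact: gw.
Qed.
End Marks.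

(** After the part marked 1 is peeled off, the part marked 2 is still closed under predecessors and
    can be peeled in turn. Neither feeds the other, so the decomposition can be put in the form to
    which [scons_swap] applies. *)
Lemma dec_swap (X Y : finType) (G : port_graph nat X Y) :
  initial (fun u : bU G => bmark u == 1%N) -> initial (fun u : bU G => bmark u == 2%N) ->
  exists (A B A' B' S : finType) (F : bij (A + (A' + S)) X)
    (Z : port_graph nat (fsum B' (fsum B S)) Y) (b : port_graph nat A' B') (a : port_graph nat A B),
    [/\ port_iso G (gpeel F (gpeel (bsumCA A' B S) Z b) a),
        noIO a /\ noIO b, forall u : bU a, bmark u == 1%N, forall u : bU b, bmark u == 2%N
      & forall u : bU Z, (bmark u != 1%N) && (bmark u != 2%N)].
Proof.
move=> ini1 ini2.
have [A [B [R [f [H [a [Ga na a1 H1]]]]]]] := dec_ex (p := pred1 1%N) ini1.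
have ini2H : initial (fun u : bU H => bmark u == 2%N).
  exact: initial_peel (initial_iso (p := pred1 2%N) Ga ini2).
have [A' [B' [R' [g [Z [b [Hb nb b2 Z2]]]]]]] := dec_ex (p := pred1 2%N) ini2H.
(* A wire from [B] into [b] would be an edge of [G] from a vertex marked 1 to a vertex marked 2,
   whose predecessors are all marked 2. *)
have gA x : exists r, g (inl x) = inr r.
  case e: (g (inl x)) => [y|r]; last by exists r.
  have [i ei] := nb x.
  have := bVK (wiring a) (inl y); case: (binv _ _) => [z|o] eo.
    by have [j ej] := na z; rewrite ej in eo.
  have Gab : port_iso G (gpeel f (gpeel g Z b) a).
    have eH : cl H = cl (gpeel g Z b) by apply/clP.
    by apply/clP; rewrite gpeel_cons -eH -gpeel_cons; apply/clP.
  have := initial_iso (p := pred1 2%N) Gab ini2 (o := inl o) (i := inr (inl i)).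
  rewrite /= eo /= -[inl y]/(inl y) -e /= bK /= ei /= => /(_ erefl (b2 _)).
  by rewrite (eqP (a1 _)).
have [S [rho [sigma erho]]] := swap_split gA.
have Z1 (u : bU Z) : bmark u != 1%N.
  have [k _] := port_iso_sym Hb.
  by rewrite -[bmark u]/(@bmark _ (gpeel g Z b) (inr u)) -(fmark k) H1.
exists A, B, A', B', S, (bcomp f (bsum (bid _) rho)),
  (grl (bsum (bid _) (bsym sigma)) (bid _) Z), b, a.
split=> //; last by move=> u; rewrite Z1; exact: Z2.
apply/clP; rewrite !gpeel_cons -crl_cl.
have -> : cl G = cl (gpeel f H a) by apply/clP.
have eH : cl H = cl (gpeel g Z b) by apply/clP.
rewrite gpeel_cons eH gpeel_cons (scons_rlr _ _ _ rho) srl_scons srl1.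
rewrite [X in scons _ X _](scons_rlr _ _ _ sigma).
suff -> : bcomp (bcomp (bsum (bid B) (bsym rho)) g) (bsum (bid A') sigma) = bsumCA A' B S by [].
rewrite -[RHS]bcomp1l -(bcompVl (bsum (bid B) rho)).
apply: bij_ext => x; have := congr1 (fun k => bfun k x) erho.
by rewrite /= => ->.
Qed.

Section Initial.
Variables (C : Type) (X Y : finType).
Implicit Types G K : port_graph C X Y.

Lemma initial_pull G K (f : biso G K) (P : pred (bU G)) :
  (forall x, wiring K (map_sum id (fO f) x) = map_sum id (fI f) (wiring G x)) ->
  initial P -> initial (fun u : bU K => P (binv (fU f) u)).
Proof.
move=> fw ini o i e.
have /= e' : wiring G (inr (binv (fO f) o)) = inr (binv (fI f) i).
  have := fw (inr (binv (fO f) o)); rewrite /= bVK e.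
  by case: (wiring G _) => //= j [->]; rewrite bK.
have := ini _ _ e'.
rewrite -[in btgt i](bVK (fI f) i) -[in bsrc o](bVK (fO f) o) fsrc ftgt !bK.
exact.
Qed.

Lemma initial_push G K (f : biso G K) (P : pred (bU K)) :
  (forall x, wiring K (map_sum id (fO f) x) = map_sum id (fI f) (wiring G x)) ->
  initial P -> initial (fun u : bU G => P (fU f u)).
Proof.
move=> fw ini o i e; rewrite -ftgt -fsrc; apply: ini.
by have := fw (inr o); rewrite e.
Qed.

(** No wire leads from [H] back to [a], so the predecessors of a vertex of [a] all lie in [a]. *)
Lemma initial_inl (A B R : finType) (f : bij (A + R) X) (H : port_graph C (fsum B R) Y)
    (a : port_graph C A B)
    (P : pred (bU a)) :
  initial P -> initial (G := gpeel f H a) (sum_case P xpred0).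
Proof.
move=> ini [o|o] [i|i] //=.
  by case e: (wiring a _) => [b|j] /=; [case: (wiring H _) | move=> [<-]; apply: ini].
by case: (wiring H _).
Qed.

Lemma initial_part (A B R : finType) (f : bij (A + R) X) (H : port_graph C (fsum B R) Y)
    (a : port_graph C A B)
    (P : pred (bU (gpeel f H a))) :
  initial P -> initial (fun u : bU a => P (inl u)).
Proof. by move=> ini o i e; apply: (ini (inl o) (inl i)); rewrite /= e. Qed.
End Initial.

(** A set of vertices of [a] closed under predecessors is so in [G] too; minimality of the peeled
    set leaves no proper nonempty one, and [a] is connected. *)
Lemma peel_ex (X Y : finType) (G : port_graph unit X Y) : (0 < #|bU G|)%N ->
  exists (A B R : finType) (f : bij (A + R) X) (H : port_graph unit (fsum B R) Y)
      (a : port_graph unit A B),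
    port_iso G (gpeel f H a) /\ atom a.
Proof.
move=> /card_gt0P[u0 _].
pose Pr (S : {set bU G}) := `[< initial (fun u => u \in S) /\ S != set0 >].
have [S /minsetP[/asboolP[iniS /set0Pn[u1 Su1]] minS]] : {S | minset Pr S}.
  apply: ex_minset; exists [set: bU G]; apply/asboolP; split; last by apply/set0Pn; exists u0.
  by move=> o i _ _; rewrite inE.
have [A [B [R [f [H [a [[g gw] na aS HS]]]]]]] :=
  dec_ex (G := set_marks (G := G) (fun u => u \in S)) (p := id) iniS.
exists A, B, R, f, (erase_marks H), (erase_marks a); split.
  apply: (port_iso_trans (unmark (ex_intro _ g gw))); exact: erase_marks_peel.
have inS u v : fU g u = inl v -> u \in S.
  by move=> e; have /= := fmark g u; rewrite e /= aS => /esym.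
have inS' u : u \in S -> exists v, fU g u = inl v.
  move=> Su; have /= := fmark g u; rewrite Su; case: (fU g u) => [v _|v /= e]; first by exists v.
  by have := HS v; rewrite e.
have con : connected a.
  split; first by have [v _] := inS' _ Su1; exists v.
  move=> P iniP [v0 Pv0] v.
  pose Q u := sum_case P xpred0 (fU g u).
  have iniQ : initial (G := G) Q by exact: (initial_push gw (initial_inl (f := f) (H := H) iniP)).
  have QS : [set u | Q u] = S.
    apply: minS.
      apply/asboolP; split; first by move=> o i e; rewrite !inE; exact: iniQ.
      by apply/set0Pn; exists (binv (fU g) (inl v0)); rewrite inE /Q bVK.
    apply/subsetP => u; rewrite inE /Q; case e: (fU g u) => //= _; exact: inS e.
  have : binv (fU g) (inl v) \in S by apply: (inS _ v); rewrite bVK.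
  have memQ u : (u \in S) = Q u by have /setP/(_ u) := QS; rewrite inE.
  by rewrite memQ /Q bVK.
exact: conj na con.
Qed.

(** * Two peelings of the same graph *)

Section Same.
Variables (X Y : finType).

Definition same_dec (A B R A' B' R' : finType)
    (f : bij (A + R) X) (h : G1 (fsum B R) Y) (a : G1 A B)
    (f' : bij (A' + R') X) (h' : G1 (fsum B' R') Y) (a' : G1 A' B') :=
  exists (u : bij A A') (v : bij B B') (w : bij R R'),
    [/\ f' = bcomp f (bsym (bsum u w)), a' = srl u v a & h' = srl (bsum v w) (bid Y) h].

Lemma dec_same C (A B R A' B' R' : finType)
    (f : bij (A + R) X) (H : port_graph C (fsum B R) Y) (a : port_graph C A B)
    (f' : bij (A' + R') X) (H' : port_graph C (fsum B' R') Y) (a' : port_graph C A' B')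
        (p : pred C) :
  (forall u : bU a, p (bmark u)) -> (forall u : bU a', p (bmark u)) ->
  (forall u : bU H, ~~ p (bmark u)) -> (forall u : bU H', ~~ p (bmark u)) ->
  noIO a -> noIO a' -> port_iso (gpeel f H a) (gpeel f' H' a') ->
  same_dec f (cl (erase_marks H)) (cl (erase_marks a)) f' (cl (erase_marks H'))
      (cl (erase_marks a')).
Proof.
move=> pa pa' pH pH' na na' e.
have [u [v [w [ef ea eH]]]] := dec_uniq pa pa' pH pH' na na' e.
exists u, v, w; split=> //; rewrite /srl /= crl_cl; apply/clP/port_iso_sym.
  exact: (erase_marks_iso ea).
exact: (erase_marks_iso eH).
Qed.

Lemma erase_set_marks C X' Y' (G : port_graph unit X' Y') (m : bU G -> C) : cl
    (erase_marks (set_marks m)) = cl G.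
Proof. by apply/clP/port_iso_sym; apply: (unmark (m := m)); exact: port_iso_refl. Qed.

(* Two minimal sets closed under predecessors coincide or are disjoint; in the *)
(* second case both can be peeled off, in either order. *)
Lemma peel_two (G : port_graph unit X Y) (A1 B1 R1 A2 B2 R2 : finType)
    (f1 : bij (A1 + R1) X) (H1 : port_graph unit (fsum B1 R1) Y) (a1 : port_graph unit A1 B1)
    (f2 : bij (A2 + R2) X) (H2 : port_graph unit (fsum B2 R2) Y) (a2 : port_graph unit A2 B2) :
  port_iso G (gpeel f1 H1 a1) -> port_iso G (gpeel f2 H2 a2) -> atom a1 -> atom a2 ->
  same_dec f1 (cl H1) (cl a1) f2 (cl H2) (cl a2) \/
  exists (A B A' B' S : finType) (F : bij (A + (A' + S)) X)
    (z : G1 (fsum B' (fsum B S)) Y) (b : G1 A' B') (a : G1 A B),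
    same_dec F (scons (bsumCA A' B S) z b) a f1 (cl H1) (cl a1) /\
    same_dec (bcomp F (bsumCA A' A S))
      (scons (bsumCA A B' S) (srl (bsumCA B' B S) (bid Y) z) a) b f2 (cl H2) (cl a2).
Proof.
move=> [g1 gw1] [g2 gw2] [na1 [[v1 _] con1]] [na2 [[v2 _] con2]].
pose m1 (u : bU G) := is_inl (fU g1 u); pose m2 (u : bU G) := is_inl (fU g2 u).
have is_inlE T T' (x : T + T') : sum_case xpredT xpred0 x = is_inl x by case: x.
have ini1 : initial m1.
  move=> o i e; rewrite /m1 -!is_inlE.
  exact: (initial_push gw1 (initial_inl (f := f1) (H := H1) (a := a1) (P := xpredT)
      (fun _ _ _ _ => isT)) e).
have ini2 : initial m2.
  move=> o i e; rewrite /m2 -!is_inlE.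
  exact: (initial_push gw2 (initial_inl (f := f2) (H := H2) (a := a2) (P := xpredT)
      (fun _ _ _ _ => isT)) e).
have m1l v : m1 (binv (fU g1) (inl v)) by rewrite /m1 bVK.
have m2l v : m2 (binv (fU g2) (inl v)) by rewrite /m2 bVK.
have m1r v : m1 (binv (fU g1) (inr v)) = false by rewrite /m1 bVK.
have m2r v : m2 (binv (fU g2) (inr v)) = false by rewrite /m2 bVK.
case: (pselect (exists u, m1 u /\ m2 u)) => [[u0 [m1u0 m2u0]]|dis].
  left.
  (* The second set cuts out a subset of [a1] that is closed under predecessors and nonempty;
     connectedness makes it all of [a1]. *)
  have m12 u : m1 u -> m2 u.
    rewrite /m1; case e: (fU g1 u) => [v|//] _.
    have := con1 _ (initial_part (initial_pull gw1 ini2)) _ v.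
    rewrite -e bK; apply.
    move: m1u0; rewrite /m1; case e0: (fU g1 u0) => [v0|//] _.
    by exists v0; rewrite -e0 bK.
  have m21 u : m2 u -> m1 u.
    rewrite /m2; case e: (fU g2 u) => [v|//] _.
    have := con2 _ (initial_part (initial_pull gw2 ini1)) _ v.
    rewrite -e bK; apply.
    move: m2u0; rewrite /m2; case e0: (fU g2 u0) => [v0|//] _.
    by exists v0; rewrite -e0 bK.
  have e := port_iso_trans (port_iso_sym (peel_mark m1 gw1)) (peel_mark m1 gw2).
  have := dec_same (p := id) _ _ _ _ _ _ e; rewrite !erase_set_marks; apply => //.
  - by move=> v; apply: m21; exact: m2l.
  - by move=> v; rewrite /= m1r.
  - by move=> v; apply/negP => /m12; rewrite m2r.
(* The sets are disjoint, so the marks 1 and 2 record both of them exactly; 0 marks the remaining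
   vertices. *)
right; pose m u := if m1 u then 1%N else if m2 u then 2%N else 0%N.
have mE1 u : (m u == 1%N) = m1 u by rewrite /m; case: (m1 u) (m2 u) => [] [].
have mE2 u : (m u == 2%N) = m2 u.
  rewrite /m; case e1: (m1 u); last by case: (m2 u).
  by case e2: (m2 u) => //; case: dis; exists u.
have [||A [B [A' [B' [S [F [Z [b [a [e [na nb] pa pb pZ]]]]]]]]]] := dec_swap (G := set_marks m).
- by move=> o i /ini1; rewrite /= !mE1.
- by move=> o i /ini2; rewrite /= !mE2.
have e' : port_iso (set_marks m) (gpeel (bcomp F (bsumCA A' A S))
    (gpeel (bsumCA A B' S) (grl (bsumCA B' B S) (bid Y) Z) a) b).
  apply/clP; move/clP: e => ->; rewrite !gpeel_cons -crl_cl.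
  exact: (@scons_swap_at (port_setProP nat)).
have e1 := port_iso_trans (port_iso_sym e) (peel_mark m gw1).
have e2 := port_iso_trans (port_iso_sym e') (peel_mark m gw2).
have gp (X' Y' A3 B3 R3 : finType) (f : bij (A3 + R3) X') (H : port_graph nat (fsum B3 R3) Y')
    (c : port_graph nat A3 B3) :
    cl (erase_marks (gpeel f H c)) = scons (D := G1) f (cl (erase_marks H)) (cl (erase_marks c)).
  rewrite -gpeel_cons; apply/clP; exact: erase_marks_peel.
exists A, B, A', B', S, F, (cl (erase_marks Z)), (cl (erase_marks b)), (cl (erase_marks a)); split.
  have := dec_same (p := pred1 1%N) _ _ _ _ na _ e1; rewrite !erase_set_marks gp; apply => //.
  - by move=> v; rewrite /= mE1.
  - case=> v /=; first by rewrite (eqP (pb v)).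
    by have /andP[] := pZ v.
  - by move=> v; rewrite /= mE1 m1r.
have := dec_same (p := pred1 2%N) _ _ _ _ nb _ e2; rewrite !erase_set_marks gp /srl /= crl_cl;
    apply => //.
- by move=> v; rewrite /= mE2.
- case=> v /=; first by rewrite (eqP (pa v)).
  by have /andP[] := pZ v.
- by move=> v; rewrite /= mE2 m2r.
Qed.
End Same.

(** * Evaluation of graphs *)

Definition gsize X Y (c : G1 X Y) : nat := #|bU (clrep c)|.

Lemma gsize_cl X Y (G : port_graph unit X Y) : gsize (cl G) = #|bU G|.
Proof. by have [f _] := clrepP G; exact: bij_eq_card (bij_bijective (fU f)). Qed.

Lemma gsize_scons (X Y A B R : finType) (f : bij (A + R) X) (h : G1 (fsum B R) Y) (a : G1 A B) :
  gsize (scons f h a) = (gsize a + gsize h)%N.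
Proof.
elim/cl_ind: h => H; elim/cl_ind: a => a.
by rewrite -gpeel_cons !gsize_cl card_sum.
Qed.

Lemma gsize_sperm (X Y : finType) (f : bij X Y) : gsize (sperm G1 f) = 0%N.
Proof. by rewrite /sperm /srl /sid /= crl_cl gsize_cl card_void. Qed.

(** Isomorphisms fix the boundary pointwise, so a graph without vertices remembers its bijection. *)
Lemma sperm_inj (X Y : finType) (f g : bij X Y) : sperm G1 f = sperm G1 g -> f = g.
Proof.
rewrite /sperm /srl /sid /= !crl_cl => /clP[h hw]; apply: bij_ext => x.
by have [] := hw (inl x).
Qed.

(** Without vertices there are no half-edges, and the wiring is a bijection from [X] to [Y]. *)
Lemma gsize0 X Y (c : G1 X Y) : gsize c = 0%N -> exists f, c = sperm G1 f.
Proof.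
elim/cl_ind: c => G; rewrite gsize_cl => /card0_eq U0.
have fU : bU G -> False by move=> u; have := U0 u.
have fO : bOut G -> False by move=> o; apply: fU (bsrc o).
have fI : bIn G -> False by move=> i; apply: fU (btgt i).
have [f [g e]] : exists (f : bij X Y) (g : bij (bOut G) (bIn G)), wiring G = bsum f g.
  by apply: bij_split => [x|o]; [case: (wiring G _) => [y|/fI//]; exists y | case: (fO o)].
have v0 := @Empty_set_rect (fun=> False).
exists f; rewrite /sperm /srl /sid /= crl_cl; apply/clP/port_iso_sym.
unshelve eexists.
  by exists (bvoid v0 fU) (bvoid v0 fO) (bvoid v0 fI) => [[]|[]|[]|[]|[]|[]].
by case=> [x|[]]; rewrite e.
Qed.

Definition catom X Y (c : G1 X Y) := atom (clrep c).
Lemma catomE X Y (G : port_graph unit X Y) : catom (cl G) <-> atom G.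
Proof. by split; apply: atom_iso; [|apply: port_iso_sym]; exact: clrepP. Qed.

Lemma catom_rl (X Y X' Y' : finType) (f : bij X X') (g : bij Y Y') (c : G1 X Y) : catom c -> catom
    (srl f g c).
Proof.
by elim/cl_ind: c => G; rewrite /srl /= crl_cl !catomE; exact: atom_rl.
Qed.

Lemma catom_gt0 X Y (c : G1 X Y) : catom c -> (0 < gsize c)%N.
Proof. by move=> [_ [[u _] _]]; apply/card_gt0P; exists u. Qed.

Section Eval.
Variables (Q : setProP) (CC : forall X Y, G1 X Y -> Prop).
Variable phi : forall X Y, G1 X Y -> Q X Y.
Hypothesis CC_rl : forall (X Y X' Y' : finType) (f : bij X X') (g : bij Y Y') c,
  @CC X Y c -> @CC X' Y' (srl f g c).
Hypothesis CC_scons : forall (X Y A B R : finType) (f : bij (A + R) X)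
  (h : G1 (fsum B R) Y) (a : G1 A B), CC (scons f h a) -> CC h /\ CC a.
Hypothesis phi_rl : forall (X Y X' Y' : finType) (f : bij X X') (g : bij Y Y') c,
  @CC X Y c -> catom c -> @phi X' Y' (srl f g c) = srl f g (phi c).

(** A derivation is one way of exhausting a graph by peelings. [phi] is consulted only at atoms of
    the class [CC], the place where it is known to be equivariant. *)
Inductive evaluates : forall X Y, G1 X Y -> Q X Y -> Prop :=
| ev_perm (X Y : finType) (f : bij X Y) : evaluates (sperm G1 f) (sperm Q f)
| ev_cons (X Y A B R : finType) (f : bij (A + R) X) (h : G1 (fsum B R) Y) y (a : G1 A B) :
    catom a -> CC a -> evaluates h y -> evaluates (scons f h a) (scons f y (phi a)).

Lemma ev_rl (X Y X' Y' : finType) (f : bij X X') (g : bij Y Y') c x :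
  @evaluates X Y c x -> @evaluates X' Y' (srl f g c) (srl f g x).
Proof.
move=> e; elim: e X' Y' f g => {X Y c x} [X Y h|X Y A B R h c y a at_a Ca _ IH] X' Y' f g.
  by rewrite !srl_sperm; exact: ev_perm.
by rewrite !srl_scons; apply: ev_cons => //; exact: IH.
Qed.

(** The peelings of the lower graph [c] come first, and those of [d] take the place of its final
    bijection, as in concatenation of lists. *)
Lemma ev_vc X Y Z c x d y : @evaluates Y Z d y -> @evaluates X Y c x -> evaluates (svc d c)
    (svc y x).
Proof.
move=> ed e; elim: e d y ed => {X Y c x} [X Y h|X Y A B R h c x a at_a Ca _ IH] d y ed.
  by rewrite !svc_sperm; exact: ev_rl.
by rewrite !svc_scons; apply: ev_cons => //; exact: IH.
Qed.

Lemma ev_hcid X Y (R : finType) c x : @evaluates X Y c x -> evaluates (shc c (sid R))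
    (shc x (sid R)).
Proof.
elim=> {X Y c x} [X Y h|X Y A B S h c x a at_a Ca _ IH].
  by rewrite !shc_sperm_id; exact: ev_perm.
by rewrite !shc_scons_id; apply: ev_cons => //; exact: ev_rl.
Qed.

Lemma ev_hc X Y X' Y' c x d y :
  @evaluates X Y c x -> @evaluates X' Y' d y -> evaluates (shc c d) (shc x y).
Proof.
move=> ec ed; rewrite (shc_split c) (shc_split x).
by apply: ev_vc; [|apply: ev_rl]; exact: ev_hcid.
Qed.

Lemma ev_id (X : finType) : @evaluates X X (sid X) (sid X).
Proof. by have := ev_perm (bid X); rewrite /sperm !srl1. Qed.

Lemma ev_total X Y c : @CC X Y c -> exists x, evaluates c x.
Proof.
have [n le_n] := ubnP (gsize c); elim: n X Y c le_n => // n IHn X Y c le_n Cc.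
have [s0|s_gt0] := posnP (gsize c).
  by have [f ->] := gsize0 s0; exists (sperm Q f); exact: ev_perm.
move: Cc le_n s_gt0; elim/cl_ind: c => G Cc le_n; rewrite gsize_cl.
move=> /peel_ex[A [B [R [f [H [a [e at_a]]]]]]].
have eG : cl G = scons (D := G1) f (cl H) (cl a) by rewrite -gpeel_cons; apply/clP.
rewrite eG in Cc le_n *; have [CH Ca] := CC_scons Cc.
have cat_a : catom (cl a) by apply/catomE.
have [|y ey] := IHn _ _ (cl H) _ CH.
  move: le_n; rewrite gsize_scons ltnS; apply: leq_trans.
  by rewrite -add1n leq_add2r catom_gt0.
by exists (scons f y (phi (cl a))); exact: ev_cons.
Qed.

Lemma ev_inv X Y c x : @evaluates X Y c x ->
  (exists f, c = sperm G1 f /\ x = sperm Q f) \/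
  exists (A B R : finType) (f : bij (A + R) X) (h : G1 (fsum B R) Y) y (a : G1 A B),
    [/\ catom a, CC a, evaluates h y, c = scons f h a & x = scons f y (phi a)].
Proof.
case=> {X Y c x} [X Y h|X Y A B S h c x a at_a Ca ec]; [left|right].
  by exists h.
by exists A, B, S, h, c, x, a.
Qed.

(** A diamond argument, by induction on the number of vertices: by [peel_two] the two first peelings
    either agree up to renaming or can be completed, in both orders, over a common remainder. *)
Lemma ev_fun X Y c x y : @CC X Y c -> evaluates c x -> evaluates c y -> x = y.
Proof.
have [n le_n] := ubnP (gsize c); elim: n X Y c x y le_n => // n IHn X Y c x y le_n Cc ex ey.
case: (ev_inv ex) => [[f [ec ->]]|[A1 [B1 [R1 [f1 [h1 [y1 [a1 [at1 Ca1 eh1 ec1 ->]]]]]]]]].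
  case: (ev_inv ey) => [[g [ec' ->]]|[A [B [R [g [h [z [a [at_a _ _ ec' _]]]]]]]]].
    by congr sperm; apply: sperm_inj; rewrite -ec.
  have := catom_gt0 at_a; have := gsize_scons g h a; rewrite -ec' ec gsize_sperm.
  by case: (gsize a).
case: (ev_inv ey) => [[g [ec' ->]]|[A2 [B2 [R2 [f2 [h2 [y2 [a2 [at2 Ca2 eh2 ec2 ->]]]]]]]]].
  have := catom_gt0 at1; have := gsize_scons f1 h1 a1; rewrite -ec1 ec' gsize_sperm.
  by case: (gsize a1).
have lt1 : (gsize h1 < n)%N.
  move: le_n; rewrite ec1 gsize_scons ltnS; apply: leq_trans.
  by rewrite -add1n leq_add2r catom_gt0.
have lt2 : (gsize h2 < n)%N.
  move: le_n; rewrite ec2 gsize_scons ltnS; apply: leq_trans.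
  by rewrite -add1n leq_add2r catom_gt0.
have [Ch1 _] : CC h1 /\ CC a1 by apply: (CC_scons (f := f1)); rewrite -ec1.
have [Ch2 _] : CC h2 /\ CC a2 by apply: (CC_scons (f := f2)); rewrite -ec2.
(* Equal decompositions give equal values: the renaming of [a] is absorbed by the equivariance of
   [phi], that of [h] by the induction hypothesis. *)
have key (A B R A' B' R' : finType) (f : bij (A + R) X) (h : G1 (fsum B R) Y) (a : G1 A B)
    (f' : bij (A' + R') X) (h' : G1 (fsum B' R') Y) (a' : G1 A' B') z z' :
    same_dec f h a f' h' a' -> evaluates h z -> evaluates h' z' -> CC a -> catom a ->
        (gsize h' < n)%N -> CC h' ->
    scons f z (phi a) = scons f' z' (phi a').
  move=> [u [v [w [-> -> eh']]]] ez ez' Ca at_a lt_h' Ch'.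
  have -> : z' = srl (bsum v w) (bid Y) z.
    by apply: (IHn _ _ h') => //; rewrite eh'; exact: ev_rl.
  by rewrite phi_rl // scons_rl.
move: Cc le_n ec1 ec2 {ex ey}; elim/cl_ind: c => G Cc le_n ec1 ec2.
move: h1 h2 a1 a2 at1 at2 Ca1 Ca2 eh1 eh2 ec1 ec2 lt1 lt2 Ch1 Ch2.
elim/cl_ind => H1; elim/cl_ind => H2; elim/cl_ind => a1; elim/cl_ind => a2.
move=> at1 at2 Ca1 Ca2 eh1 eh2 ec1 ec2 lt1 lt2 Ch1 Ch2.
have e1 : port_iso G (gpeel f1 H1 a1) by apply/clP; rewrite gpeel_cons.
have e2 : port_iso G (gpeel f2 H2 a2) by apply/clP; rewrite gpeel_cons.
have [same|] := peel_two e1 e2 (iffLR (catomE _) at1) (iffLR (catomE _) at2).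
  exact: key same eh1 eh2 Ca1 at1 lt2 Ch2.
move=> [A [B [A' [B' [S [F [z [b [a [s1 s2]]]]]]]]]].
have inv_rl (T T' U U' : finType) (p : bij T U) (q : bij T' U') (c : G1 T T') d :
    d = srl p q c -> c = srl (bsym p) (bsym q) d by move=> ->; rewrite srlK.
have [Ca at_a] : CC a /\ catom a.
  case: s1 => u [v [w [_ ea _]]]; rewrite (inv_rl _ _ _ _ _ _ _ _ ea).
  by split; [apply: CC_rl | apply: catom_rl].
have [Cb at_b] : CC b /\ catom b.
  case: s2 => u [v [w [_ eb _]]]; rewrite (inv_rl _ _ _ _ _ _ _ _ eb).
  by split; [apply: CC_rl | apply: catom_rl].
have Cz : CC z.
  case: s1 => u [v [w [_ _ eh]]].
  have : CC (scons (bsumCA A' B S) z b) by rewrite (inv_rl _ _ _ _ _ _ _ _ eh); apply: CC_rl.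
  by move/CC_scons => [].
(* A value of the common remainder [z] yields evaluations that begin with [a] then [b] and with [b]
   then [a]. By [key] they agree with the two given values, and by [scons_swap_at] with each
   other. *)
have [y0 ey0] := ev_total Cz.
rewrite -(key _ _ _ _ _ _ _ _ _ _ _ _ _ _ s1 (ev_cons _ at_b Cb ey0) eh1 Ca at_a lt1 Ch1).
rewrite -(key _ _ _ _ _ _ _ _ _ _ _ _ _ _ s2 (ev_cons _ at_a Ca
    (ev_rl _ _ ey0)) eh2 Cb at_b lt2 Ch2).
exact: scons_swap_at.
Qed.

End Eval.

(** * Indecomposable graphs *)

Lemma card_sfin0 (T : sfin) : (T -> False) -> card_sfin T = 0%N.
Proof. by move=> T0; apply: eq_card0 => x; case: (T0 x). Qed.
Lemma card_sfin_inh (T : sfin) (x : T) : card_sfin T <> 0%N.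
Proof. by move/card0_eq/(_ x). Qed.
Lemma card_sfin0_elim (T : sfin) : card_sfin T = 0%N -> T -> False.
Proof. by move=> T0 x; exact: card_sfin_inh T0. Qed.
Lemma card_sfinP (T : sfin) : card_sfin T = 0%N \/ inhabited T.
Proof.
case: (pselect (inhabited T)) => [i|ni]; first by right.
by left; apply: card_sfin0 => x; apply: ni.
Qed.

Lemma catom_cls k l (G : pgraph k l) : catom (cls G) <-> atom (port G).
Proof. exact: catomE. Qed.

Lemma port_edge k l (G : pgraph k l) o i : wiring (port G) (inr o) = inr i ->
  exists e, o = inl e /\ i = inl e.
Proof. by case: o => [e|o]; [rewrite portE => -[<-]; exists e | rewrite portO]. Qed.

Section Indecomposable.
Variables (k l : nat) (G : pgraph k l).

(** No edge ends at a loop, so a loop alone is closed under predecessors and must be the whole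
    atom. *)
Lemma atom_loop : atom (port G) -> gL G -> single_loop G.
Proof.
move=> [nio [_ con]] L0.
have all_loop (u : bU (port G)) : u = inr L0.
  apply/eqP; apply: (con (pred1 (inr L0 : bU (port G)))).
    by move=> o i _ /= /eqP.
  by exists (inr L0); rewrite /= eqxx.
have V0 : gV G -> False by move=> v; have := all_loop (inl v).
split; do ?[split].
- exact: card_sfin0.
- by apply: card_sfin0 => e; apply: V0; exact: (gs G (inl e)).
- by apply: card_sfin0 => e; apply: V0; exact: (gt G (inr e)).
- by apply: card_sfin0 => e; apply: V0; exact: (gs G (inr e)).
- apply: card_sfin0 => e; have [i] := nio (galpha G (inr e)).
  by rewrite portIO.
- apply: (eq_card1 (x := L0)) => L; have [->] := all_loop (inr L).
  by rewrite !inE; apply/esym/eqP.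
Qed.

(** In a vertical composite the vertices of the lower factor are closed under predecessors, and in a
    horizontal one so are those of each factor; connectedness then forces a factor without
    vertices. *)
Lemma atom_indecomposable : atom (port G) -> indecomposable G.
Proof.
move=> at_G; have [nio [[u0 _] con]] := at_G.
have loops : card_sfin (gL G) = 0%N \/ single_loop G.
  by have [|[L]] := card_sfinP (gL G); [left | right; exact: atom_loop].
split=> //.
- case: u0 => [v|L]; first by left; exact: card_sfin_inh v.
  by right; exact: atom_loop.
- apply: card_sfin0 => e; have [i] := nio (galpha G (inr e)).
  by rewrite portIO.
- move=> m G' G'' [f].
  have [|[v']] := card_sfinP (gV G'); first by left.
  have [|[v'']] := card_sfinP (gV G''); first by right.
  have [fV' fK f'K] := isoV_bij f.
  (* The left summand consists of the vertices of [G''], the factor applied first. *)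
  pose P (u : bU (port G)) := match u with inl v => is_inl (isoV f v) | inr _ => false end.
  have iniP : initial P.
    move=> o i /port_edge[e [-> ->]] /=.
    rewrite -(iso_t f) -(iso_s f) /=.
    by case: (isoE f e) => [[e'|e']|e'].
  have exP : exists u, P u by exists (inl (fV' (inl v''))); rewrite /= f'K.
  by have := con P iniP exP (inl (fV' (inr v'))); rewrite /= f'K.
- move=> k' l' k'' l'' G' G'' s t [f].
  have [|[v']] := card_sfinP (gV G'); first by left.
  have [|[v'']] := card_sfinP (gV G''); first by right.
  have [fV' fK f'K] := isoV_bij f.
  pose P (u : bU (port G)) := match u with inl v => is_inl (isoV f v) | inr _ => false end.
  have iniP : initial P.
    move=> o i /port_edge[e [-> ->]] /=.
    rewrite -(iso_t f) -(iso_s f) /=.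
    by case: (isoE f e) => e'.
  have exP : exists u, P u by exists (inl (fV' (inl v'))); rewrite /= f'K.
  by have := con P iniP exP (inl (fV' (inr v''))); rewrite /= f'K.
Qed.

Lemma port_inh k' l' (H : pgraph k' l') X Y (K : port_graph unit X Y) (u : bU K) :
  (exists f : biso K (port H), True) -> ~~ bloop u -> card_sfin (gV H) <> 0%N.
Proof.
move=> [f _] nl; have := floop f u.
case: (fU f u) => [v _|L /= e]; first exact: card_sfin_inh v.
by rewrite -e in nl.
Qed.

(** A proper nonempty set closed under predecessors would exhibit [G] as [H] after [a] beside an
    identity, both factors having vertices. *)
Lemma indecomposable_atom : indecomposable G -> atom (port G).
Proof.
move=> [vtx io loops indv _].
have nio' (z : 'I_k + (gE G + gO G)) : match z return Prop with inl y => exists i, wiring (port G)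
    (inl y) = inr i | _ => True end.
  elim/port_ind: z => // e; first by exists (inr e); rewrite portI.
  by case: (card_sfin0_elim io e).
have nio : noIO (port G) by move=> x; exact: (nio' (inl x)).
case: vtx => [V0|sl]; last first.
  case: sl => V0 _ _ _ [_ L1].
  split=> //; split.
    have [L0|[L]] := card_sfinP (gL G); first by rewrite L0 in L1.
    by exists (inr L).
  move=> P _ [[v|L] PL]; first by case: (card_sfin0_elim V0 v).
  move=> [v|L']; first by case: (card_sfin0_elim V0 v).
  have [x xE] := fintype1 L1.
  by rewrite (_ : L' = L) // (xE L) (xE L').
have L0 : card_sfin (gL G) = 0%N by case: loops => // -[].
split=> //; split.
  by have [//|[v]] := card_sfinP (gV G); exists (inl v).
move=> P iniP [u1 Pu1] u2; apply: contrapT => /negP nPu2.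
have [A [B [R [f [H [a [[g gw] na aP HP]]]]]]] :=
  dec_ex (G := set_marks (G := port G) P) (p := id) iniP.
have e : cls G = scons (D := G1) f (cl (erase_marks H)) (cl (erase_marks a)).
  rewrite -gpeel_cons; apply/clP/(port_iso_trans (unmark (ex_intro _ g gw))).
  exact: erase_marks_peel.
(* The middle interface [B + R] is numbered by [er] so that both factors come from actual planar
   graphs. *)
have [G' eG'] := cls_surj (srl (s := G1) (Y' := ford l) (er (fsum B R)) (bid (ford l))
    (cl (erase_marks H))).
have [G'' eG''] := cls_surj (srl (s := G1) (X' := ford k) f (er (fsum B R))
    (shc (s := G1) (cl (erase_marks a)) (sid R))).
have : cls G = cls (pvcat G' G'').
  by rewrite cls_vcat eG' eG'' svc_rl.
move=> /clsP[h _].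
(* Without loops, the elements [u2] of the upper factor and [u1] of the lower one are genuine
   vertices. *)
have nl (u : bU (port G)) : ~~ bloop u.
  by case: u => // L; case: (card_sfin0_elim L0 L).
have [] := indv _ _ _ (inhabits h).
- move: eG'; rewrite /srl /= crl_cl => /clP/port_iso_sym[h' _].
  case e2: (fU g u2) => [v|v].
    by have /= := fmark g u2; rewrite e2 /= aP => /esym; move/negP: nPu2.
  have nlv : ~~ bloop v.
    have /= := floop g u2; rewrite e2 /= => ->; exact: nl.
  apply: (port_inh (K := grl (er (fsum B R)) (bid (ford l)) (erase_marks H)) (u := v)) => //.
- move: eG''; rewrite /srl /shc /sid /= chc_cl crl_cl => /clP/port_iso_sym[h' _].
  case e1: (fU g u1) => [v|v]; last first.
    by have /= := fmark g u1; rewrite e1 /= Pu1 => e'; have := HP v; rewrite e'.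
  have nlv : ~~ bloop v.
    have /= := floop g u1; rewrite e1 /= => ->; exact: nl.
  apply: (port_inh (K := grl f (er (fsum B R)) (ghc (erase_marks a) (gid unit R))) (u := inl v))
      => //.
Qed.
End Indecomposable.

(** * Acyclic graphs and corollas *)

(** Acyclicity expressed by a function increasing along edges: such a function restricts to the
    parts of a peeling and is easily built on composites, whereas cycles would have to be followed
    through glued edges. *)
Definition ranked X Y (G : port_graph unit X Y) :=
  exists rho : bU G -> nat,
    (forall o i, wiring G (inr o) = inr i -> (rho (bsrc o) < rho (btgt i))%N) /\
    forall u : bU G, ~~ bloop u.

Lemma ranked_iso X Y (G K : port_graph unit X Y) : port_iso G K -> ranked G -> ranked K.
Proof.
move=> /port_iso_sym[f fw] [rho [lt_rho nl]]; exists (fun u => rho (fU f u)); split.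
  move=> o i e; rewrite -ftgt -fsrc; apply: lt_rho.
  by have := fw (inr o); rewrite e.
by move=> u; rewrite -(floop f).
Qed.

Definition cranked X Y (c : G1 X Y) := ranked (clrep c).
Lemma crankedE X Y (G : port_graph unit X Y) : cranked (cl G) <-> ranked G.
Proof. by split; apply: ranked_iso; [|apply: port_iso_sym]; exact: clrepP. Qed.

Lemma cranked_rl (X Y X' Y' : finType) (f : bij X X') (g : bij Y Y') (c : G1 X Y) :
  cranked c -> cranked (srl f g c).
Proof.
elim/cl_ind: c => G; rewrite /srl /= crl_cl !crankedE => -[rho [lt_rho nl]].
exists rho; split=> // o i e; apply: lt_rho; move: e => /=.
by case: (wiring G _) => // j [->].
Qed.

Lemma cranked_scons (X Y A B R : finType) (f : bij (A + R) X) (h : G1 (fsum B R) Y) (a : G1 A B) :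
  cranked (scons f h a) -> cranked h /\ cranked a.
Proof.
elim/cl_ind: h => H; elim/cl_ind: a => a.
rewrite -gpeel_cons !crankedE => -[rho [lt_rho nl]]; split.
  exists (fun u => rho (inr u)); split=> [o i e|u]; last exact: (nl (inr u)).
  by apply: (lt_rho (inr o) (inr i)); rewrite /= e.
exists (fun u => rho (inl u)); split=> [o i e|u]; last exact: (nl (inl u)).
by apply: (lt_rho (inl o) (inl i)); rewrite /= e.
Qed.

Lemma cranked_id (X : finType) : cranked (sid (s := G1) X).
Proof. by apply/crankedE; exists (fun=> 0%N); split=> [[]|[]]. Qed.

Lemma cranked_hc (X Y X' Y' : finType) (c : G1 X Y) (d : G1 X' Y') :
  cranked c -> cranked d -> cranked (shc c d).
Proof.
elim/cl_ind: c => G; elim/cl_ind: d => H; rewrite /shc /= chc_cl !crankedE.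
move=> [rho [lt_rho nl]] [rho' [lt_rho' nl']]; exists (sum_case rho rho'); split.
  move=> [o|o] [i|i] /=; case e: (wiring _ _) => [y|j] //= [<-].
    exact: lt_rho. exact: lt_rho'.
by case.
Qed.

Lemma cranked_vc (X Y Z : finType) (c : G1 Y Z) (d : G1 X Y) :
  cranked c -> cranked d -> cranked (svc c d).
Proof.
elim/cl_ind: c => H; elim/cl_ind: d => G; rewrite /svc /= cvc_cl !crankedE.
move=> [rho' [lt_rho' nl']] [rho [lt_rho nl]].
(* The ranks of the upper graph are shifted above all those of the lower one, so that the edges
   created by gluing increase too. *)
pose m := \max_(u : bU G) rho u.
exists (sum_case rho (fun u => (rho' u + m.+1)%N)); split; last by case.
move=> [o|o] [i|i] /=.
- case e: (wiring _ _) => [y|j] /=; last by move=> [<-]; exact: lt_rho.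
  by case: (wiring H _).
- move=> _; rewrite addnS ltnS; apply: leq_trans (leq_addl _ _).
  exact: leq_bigmax.
- by case: (wiring H _).
- case e: (wiring _ _) => [y|j] //= [<-]; rewrite ltn_add2r; exact: lt_rho'.
Qed.

Section Acyclic.
Variables (k l : nat) (G : pgraph k l).

Lemma ranked_acyclic : ranked (port G) -> acyclic G.
Proof.
move=> [rho [lt_rho nl]]; split; last by apply: card_sfin0 => L; have := nl (inr L).
move=> [[//|e c] _ /=].
pose r (e e' : gE G) := (rho (inl (gs G (inl e))) < rho (inl (gs G (inl e'))))%N.
have r_trans : transitive r by move=> x y z; exact: ltn_trans.
move=> cyc; have : path r e (rcons c e).
  apply: sub_path cyc => x y /eqP xy; rewrite /r -xy.
  exact: (lt_rho (inl x) (inl x)).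
move/(order_path_min r_trans)/allP/(_ e); rewrite mem_rcons mem_head /r ltnn.
by move/(_ isT).
Qed.

(** The rank of a vertex is the number of edges that begin a path ending there. Along an edge [e]
    this set grows, and strictly: [e] belongs to the set of its target, and belonging to that of its
    source would close a cycle. *)
Lemma acyclic_ranked : acyclic G -> ranked (port G).
Proof.
move=> [nocyc L0].
pose re : rel (gE G) := fun e e' => gt G (inl e) == gs G (inl e').
pose S (v : gV G) := [set e : gE G | [exists e', connect re e e' && (gt G (inl e') == v)]].
exists (fun u => if u is inl v then #|S v| else 0%N); split; last first.
  by case=> // L; case: (card_sfin0_elim L0 L).
move=> o i /port_edge[e [-> ->]] /=.
apply: proper_card; apply/properP; split.
  apply/fintype.subsetP => e1; rewrite !inE => /existsP[e2 /andP[c12 /eqP t2]].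
  apply/existsP; exists e; rewrite eqxx andbT.
  by apply: connect_trans c12 _; apply: connect1; rewrite /re t2.
exists e.
  by rewrite inE; apply/existsP; exists e; rewrite connect0 eqxx.
rewrite inE; apply/negP => /existsP[e2 /andP[/connectP[p pe ->] t2]].
apply: nocyc; exists (e :: p) => //=.
by rewrite rcons_path pe.
Qed.

Lemma acyclicP : acyclic G <-> cranked (cls G).
Proof.
rewrite crankedE; split; [exact: acyclic_ranked | exact: ranked_acyclic].
Qed.
End Acyclic.

Lemma order_enum (T : finType) (r : rel T) n : #|T| = n ->
  (forall x y, r x y || r y x) -> antisymmetric r -> transitive r ->
  exists h : bij T 'I_n, forall x y, (h x <= h y)%N = r x y.
Proof.
move=> cT tot anti tr; subst n.
have rr x : r x x by have := tot x x; rewrite orbb.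
(* The position of an element is the number of its strict predecessors. *)
pose D x := [set z | r z x && (z != x)].
have ltD x : (#|D x| < #|T|)%N.
  rewrite -cardsT; apply: proper_card; apply/properP; split; first exact: subsetT.
  by exists x; rewrite !inE ?eqxx ?andbF.
have mono x y : r x y -> x != y -> (#|D x| < #|D y|)%N.
  move=> rxy nxy; apply: proper_card; apply/properP; split.
    apply/fintype.subsetP => z; rewrite !inE => /andP[zx nzx].
    rewrite (tr _ _ _ zx rxy) /=; apply: contra_neq nzx => zy.
    by apply: anti; rewrite zx zy rxy.
  by exists x; rewrite !inE ?rxy ?nxy // eqxx andbF.
pose h x := Ordinal (ltD x).
have hE x y : (h x <= h y)%N = r x y.
  have [->|nxy] := eqVneq x y; first by rewrite leqnn rr.
  have /orP[rxy|ryx] := tot x y; first by rewrite rxy ltnW // mono.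
  rewrite leqNgt /= (mono _ _ ryx) 1?eq_sym //=; apply/esym/negbTE/negP => rxy.
  by case/eqP: nxy; apply: anti; rewrite rxy.
have h_inj : injective h.
  by move=> x y e; apply: anti; rewrite -!hE e leqnn.
have hb : bijective h by apply: inj_card_bij => //; rewrite card_ord.
by exists (bijc hb) => x y; rewrite bijcE hE.
Qed.

(** This rules out symmetries of a corolla: an automorphism must preserve the order of its inputs
    and of its outputs. *)
Lemma mono_bij_id n (h : bij 'I_n 'I_n) : {mono h : i j / (i <= j)%N} -> h = bid _.
Proof.
move=> mono; apply: bij_ext => i /=.
have [m] := ubnP (val i); elim: m i => // m IHm i lt_im.
have lt_fix (j : 'I_n) : (j < i)%N -> h j = j by move=> ji; apply: IHm; exact: leq_trans ji _.
have [hi|ih|/val_inj //] := ltngtP (h i) i.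
  by have e := bij_inj_fun (lt_fix _ hi); move: hi; rewrite e ltnn.
have [j ej] : exists j, h j = i by exists (binv h i); rewrite bVK.
have [ji|ij|/val_inj ji] := ltngtP j i.
- by have := ji; rewrite -{1}(lt_fix _ ji) ej ltnn.
- have : (h i <= h j)%N by rewrite mono ltnW.
  by rewrite ej leqNgt ih.
- by rewrite -{2}ej ji.
Qed.

(** * Acyclic atoms are corollas up to permutation *)

Section Corolla.
Variables k l : nat.

Lemma port_corollaI j : wiring (port (corolla k l)) (inl j) = inr (inr (below_ord j)).
Proof.
have := portI (below_ord j : gI (corolla k l)).
by rewrite -[galpha _ _]/(ord_below (below_ord j)) below_ordK.
Qed.
Lemma port_corollaO o : wiring (port (corolla k l)) (inr (inr o)) = inl (ord_below o).
Proof. exact: portO. Qed.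

Lemma corolla_ranked : ranked (port (corolla k l)).
Proof. by exists (fun=> 0%N); split=> [o i /port_edge[[]]|[]//]. Qed.

Lemma corolla_atom : atom (port (corolla k l)).
Proof.
split; first by move=> x; eexists; exact: port_corollaI.
split; first by exists (inl tt).
by move=> P _ [[[]|[]] Ptt] [[]|[]].
Qed.

(** A vertex of least rank has no predecessor, hence is the whole atom, and no edge is internal.
    Listing the half-edges in their order at the vertex identifies the graph with a corolla. *)
Lemma atom_corolla (G : port_graph unit (ford k) (ford l)) : atom G -> ranked G ->
  exists (f : bij 'I_k 'I_k) (g : bij 'I_l 'I_l),
    port_iso G (@grl _ (ford k) (ford l) (ford k) (ford l) f g (port (corolla k l))).
Proof.
move=> [nio [[u0 _] con]] [rho [lt_rho nl]].
have [u1 all_u1] : exists u1, forall u : bU G, u = u1.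
  case: (arg_minnP rho (isT : xpredT u0)) => u1 _ min_u1.
  exists u1 => u; apply/eqP; apply: (con (pred1 u1)); last by exists u1 => /=.
  move=> o i /lt_rho lt_oi /eqP e; rewrite e in lt_oi.
  by have := min_u1 (bsrc o) isT; rewrite leqNgt lt_oi.
have noE o i : wiring G (inr o) = inr i -> False.
  by move/lt_rho; rewrite (all_u1 (bsrc o)) (all_u1 (btgt i)) ltnn.
have [f0 [g0 fg]] : exists (f0 : bij 'I_k (bIn G)) (g0 : bij (bOut G) 'I_l),
    bcomp (bsumC _ _) (wiring G) = bsum f0 g0.
  apply: bij_split => x /=; first by have [i ->] := nio x; exists i.
  by case e: (wiring G _) => [y|i]; [exists y | case: (noE _ _ e)].
have wI x : wiring G (inl x) = inr (f0 x).
  have := congr1 (fun k => bfun k (inl x)) fg; rewrite /=.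
  by case: (wiring G _) => // j [->].
have wO x : wiring G (inr x) = inl (g0 x).
  have := congr1 (fun k => bfun k (inr x)) fg; rewrite /=.
  by case: (wiring G _) => // j [->].
have cI : #|bIn G| = k by rewrite -(bij_eq_card (bij_bijective f0)) card_ord.
have cO : #|bOut G| = l by rewrite (bij_eq_card (bij_bijective g0)) card_ord.
have [hI hIE] : exists h : bij (bIn G) 'I_k, forall x y, (h x <= h y)%N = bri x y.
  apply: order_enum => //; [|exact: fib_anti (@briP _ G)|exact: fib_trans (@briP _ G)].
  by move=> x y; apply: (fib_total (@briP _ G)); rewrite (all_u1 (btgt x)) (all_u1 (btgt y)).
have [hO hOE] : exists h : bij (bOut G) 'I_l, forall x y, (h x <= h y)%N = bro x y.
  apply: order_enum => //; [|exact: fib_anti (@broP _ G)|exact: fib_trans (@broP _ G)].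
  by move=> x y; apply: (fib_total (@broP _ G)); rewrite (all_u1 (bsrc x)) (all_u1 (bsrc y)).
(* The permutations measure the discrepancy between the order at the vertex and the indices on the
   boundary. *)
exists (bsym (bcomp hI f0)), (bcomp g0 (bsym hO)); apply: port_iso_sym.
have uK : cancel (fun _ : unit + void => u1) (fun _ => inl tt) by case=> [[]|[]].
have uVK : cancel (fun _ : bU G => inl tt : unit + void) (fun _ => u1).
  by move=> u; rewrite (all_u1 u).
pose bb n : bij (void + below n) 'I_n := bcomp (Bij (@ord_belowK n) (@below_ordK n)) (bsum0 _).
unshelve eexists.
  exists (Bij uK uVK) (bcomp (bsym hO) (bb l)) (bcomp (bsym hI) (bb k)) => [u|u|o|i|o o'|i i'].
  - by case: (bmark _).
  - by case: u => // -[]; apply/negbTE/nl.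
  - by rewrite (all_u1 (bsrc _)).
  - by rewrite (all_u1 (btgt _)).
  - by rewrite -hOE /= !bVK; case: o o' => [[]|o] [[]|o'].
  - by rewrite -hIE /= !bVK; case: i i' => [[]|i] [[]|i'].
have grlE f g z : wiring (@grl _ (ford k) (ford l) (ford k) (ford l) f g (port (corolla k l))) z
  = map_sum g id (wiring (port (corolla k l)) (map_sum (binv f) id z)) by [].
case=> [x|[[]|o]]; rewrite grlE [map_sum (binv _) id _]/=.
  by rewrite port_corollaI /= below_ordK bK wI.
by rewrite port_corollaO /= wO.
Qed.
End Corolla.

(** * Freeness *)

From mathcomp Require Import classical_sets.
Local Open Scope classical_set_scope.

(** Any element is a peeling of itself, with [R] empty and only a bijection left over; on atoms this
    computes the extension. *)
Lemma scons_id (D : setProP) (X Y : finType) (a : D X Y) :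
  scons (bcomp (bsum0 X) (bsumC X fvoid)) (sperm D (bcomp (bsum0 Y) (bsumC Y fvoid))) a = a.
Proof.
rewrite /scons /sperm svc_lrl svc1l srlM bcomp1r bcomp1l.
by rewrite -srlM shcC shc0l.
Qed.

Section Span.
Variable K : fieldType.

Lemma lspan_gen (V : lmodType K) (A : set V) v : A v -> lspan A v.
Proof.
move=> Av; exists 1%N, (fun=> 1), (fun=> v); split=> //.
by rewrite big_ord1 scale1r.
Qed.

Lemma lspan0 (V : lmodType K) (A : set V) : lspan A 0.
Proof. by exists 0%N, (fun=> 0), (fun=> 0); split=> [[]//|]; rewrite big_ord0. Qed.

Lemma lspan_lin (V : lmodType K) (A : set V) a x y :
  lspan A x -> lspan A y -> lspan A (a *: x + y).
Proof.
move=> [n [b [v [Av ->]]]] [m [c [w [Aw ->]]]].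
exists (n + m)%N, (fun i => match split i with inl i => a * b i | inr i => c i end),
  (fun i => match split i with inl i => v i | inr i => w i end); split.
  by move=> i; case: (split i).
rewrite big_split_ord /= scaler_sumr; congr (_ + _); apply: eq_bigr => i _.
  by rewrite split_lshift scalerA.
by rewrite split_rshift.
Qed.

Lemma lspan_ind (V : lmodType K) (A : set V) (Pr : V -> Prop) :
  Pr 0 -> (forall a x y, A x -> lspan A y -> Pr y -> Pr (a *: x + y)) ->
  forall x, lspan A x -> Pr x.
Proof.
move=> P0 PS x [n [a [v [Av ->]]]].
elim: n a v Av => [|n IHn] a v Av; first by rewrite big_ord0.
rewrite big_ord_recl; apply: PS => //; last by apply: IHn => i; exact: Av.
by exists n, (fun i => a (lift ord0 i)), (fun i => v (lift ord0 i)); split.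
Qed.

Lemma eq_lspan (V : lmodType K) (A B : set V) : (forall x, A x <-> B x) -> lspan A = lspan B.
Proof. by move=> AB; congr lspan; apply/funext => x; apply/propext. Qed.

Lemma lin_lspan (V W : lmodType K) (B : set W) (C : set V) (L : V -> W) :
  lin L -> (forall v, C v -> lspan B (L v)) -> forall v, lspan C v -> lspan B (L v).
Proof.
move=> linL h; apply: lspan_ind; first by rewrite (lin0 linL); exact: lspan0.
by move=> a x y Cx _ By; rewrite linL; apply: lspan_lin => //; exact: h.
Qed.

Lemma lin_eq_on (V W : lmodType K) (C : set V) (L L' : V -> W) :
  lin L -> lin L' -> (forall v, C v -> L v = L' v) -> forall v, lspan C v -> L v = L' v.
Proof.
move=> linL linL' h; apply: lspan_ind; first by rewrite !lin0.
by move=> a x y Cx _ e; rewrite linL linL' e h.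
Qed.

End Span.

Definition graph_class := forall X Y : finType, G1 X Y -> Prop.

Section ClassSpan.
Variables (K : fieldType) (DD : graph_class).
Definition class_vecs (k l : nat) : set (PGr K k l)
    := [set x | exists2 c : G1 (ford k) (ford l), DD c & x = vec K c].
Definition class_span : family (PGr K) := fun k l => lspan (@class_vecs k l).

Hypothesis DD_rl : forall (X Y X' Y' : finType) (f : bij X X') (g : bij Y Y') c,
  @DD X Y c -> @DD X' Y' (srl f g c).

Lemma class_span_vec k l (c : G1 (ford k) (ford l)) : DD c -> class_span (vec K c).
Proof. by move=> Dc; apply: lspan_gen; exists c. Qed.

Lemma class_span_submodule : submodule class_span.
Proof.
split=> [k l|k l a x y|k l s x|k l s x].
- exact: lspan0.
- exact: lspan_lin.
- apply: lin_lspan => // [a y z|_ [c Dc ->]]; first exact: pgr_lact_lin.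
  by rewrite vec_lact; apply/class_span_vec/DD_rl.
- apply: (lin_lspan (L := fun x => ract x s)) => // [a y z|_ [c Dc ->]]; first exact: pgr_ract_lin.
  by rewrite vec_ract; apply/class_span_vec/DD_rl.
Qed.

Section Hom.
Variables (P : proPData K) (ax : isProP P) (F : hom_family (PGr K) P).
Hypothesis mF : module_morphism class_span F.

Lemma mor0 k l : F (0 : PGr K k l) = 0.
Proof.
have := mor_lin mF (-1) (lspan0 (@class_vecs k l)) (lspan0 (@class_vecs k l)).
by rewrite scaler0 addr0 scaleN1r addNr.
Qed.

Lemma mor_eq_on (F' : hom_family (PGr K) P) : module_morphism class_span F' ->
  (forall k l (c : G1 (ford k) (ford l)), DD c -> F (vec K c) = F' _ _ (vec K c)) ->
      eq_on class_span F F'.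
Proof.
move=> mF' e k l; apply: lspan_ind.
  rewrite mor0; have := mor_lin mF' (-1) (lspan0 (@class_vecs k l)) (lspan0 (@class_vecs k l)).
  by rewrite scaler0 addr0 scaleN1r addNr.
move=> a _ y [c Dc ->] fy ey.
have fx : class_span (vec K c) by exact: class_span_vec.
by rewrite (mor_lin mF) // (mor_lin mF') // ey e.
Qed.

Lemma mor_vec_rl k l k' l' (f : bij 'I_k 'I_k') (g : bij 'I_l 'I_l') (c : G1 (ford k) (ford l)) :
  DD c -> F (vec K (srl f g c)) = brl f g (F (vec K c)).
Proof.
move=> Dc; elim/bij_ordP: k' / f => s; elim/bij_ordP: l' / g => t.
have Dc' := DD_rl (permb s) (bid _) Dc.
rewrite brlE -(mor_ract mF); last exact: class_span_vec.
rewrite vec_ract invgK -(mor_lact mF); last exact: class_span_vec.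
by rewrite vec_lact srlM bcomp1r bcomp1l.
Qed.

(** A morphism read on set-indexed graphs, through the same enumerations that define
    [ProP_setProP]. *)
Definition hom_set (X Y : finType) (c : G1 X Y) : ProP_setProP ax X Y :=
  F (vec K (srl (er X) (er Y) c)).

Lemma hom_set_rl (X Y X' Y' : finType) (f : bij X X') (g : bij Y Y') (c : G1 X Y) :
  DD c -> hom_set (srl f g c) = srl f g (hom_set c).
Proof.
move=> Dc.
have e : srl (er X') (er Y') (srl f g c) = srl (ber f) (ber g) (srl (er X) (er Y) c).
  rewrite !srlM; congr srl; apply: bij_ext => x; by rewrite /= enum_rankK.
rewrite /hom_set e mor_vec_rl //; exact: DD_rl.
Qed.
End Hom.
End ClassSpan.

(** * Freeness for a class stable under the operations and under peeling *)

Section Free.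
Variables (K : fieldType) (CC : graph_class).
Hypothesis CC_rl : forall (X Y X' Y' : finType) (f : bij X X') (g : bij Y Y') c,
  @CC X Y c -> @CC X' Y' (srl f g c).
Hypothesis CC_scons : forall (X Y A B R : finType) (f : bij (A + R) X)
  (h : G1 (fsum B R) Y) (a : G1 A B), CC (scons f h a) -> CC h /\ CC a.
Hypothesis CC_id : forall X : finType, CC (sid (s := G1) X).
Hypothesis CC_hc : forall (X Y X' Y' : finType) (c : G1 X Y) (d : G1 X' Y'),
  CC c -> CC d -> CC (shc c d).
Hypothesis CC_vc : forall (X Y Z : finType) (c : G1 Y Z) (d : G1 X Y),
  CC c -> CC d -> CC (svc c d).

Definition atoms : graph_class := fun X Y c => CC c /\ catom c.

Lemma atoms_rl (X Y X' Y' : finType) (f : bij X X') (g : bij Y Y') c :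
  @atoms X Y c -> @atoms X' Y' (srl f g c).
Proof. by move=> [Cc cc]; split; [exact: CC_rl | exact: catom_rl]. Qed.

Lemma class_span_subProP : subProP (class_span (K := K) CC).
Proof.
split; first exact: class_span_submodule.
- by rewrite vec_unit0; apply: class_span_vec.
- by rewrite vec_unit1; apply: class_span_vec.
- move=> k l k' l' x y Sx Sy; move: x Sx.
  apply: (lin_lspan (L := fun x => hcat x y)) => [a x x'|_ [c Cc ->]]; first exact: pgr_hcat_linl.
  move: y Sy; apply: lin_lspan => [a x x'|_ [d Cd ->]]; first exact: pgr_hcat_linr.
  by rewrite vec_hcat; apply: class_span_vec; apply: CC_rl; exact: CC_hc.
- move=> k l m x y Sx Sy; move: x Sx.
  apply: (lin_lspan (L := fun x => vcat x y)) => [a x x'|_ [c Cc ->]]; first exact: pgr_vcat_linl.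
  move: y Sy; apply: lin_lspan => [a x x'|_ [d Cd ->]]; first exact: pgr_vcat_linr.
  by rewrite vec_vcat; apply: class_span_vec; exact: CC_vc.
Qed.

Section Target.
Variables (P : proPData K) (ax : isProP P) (phi : hom_family (PGr K) P).
Hypothesis mphi : module_morphism (class_span (K := K) atoms) phi.
Notation Q := (ProP_setProP ax).

Definition phiQ (X Y : finType) (c : G1 X Y) : Q X Y := hom_set ax phi c.

Lemma phiQ_rl (X Y X' Y' : finType) (f : bij X X') (g : bij Y Y') c :
  @CC X Y c -> catom c -> @phiQ X' Y' (srl f g c) = srl f g (phiQ c).
Proof. by move=> Cc cc; exact: (hom_set_rl atoms_rl). Qed.

Definition ofQ k l (x : Q (ford k) (ford l)) : P k l := brl (bsym (er 'I_k)) (bsym (er 'I_l)) x.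

Notation EvQ := (@evaluates Q CC phiQ).

(** On [CC] a value exists by [ev_total]. The default 0 can affect [extension] only outside the span
    of [CC], where morphisms are unconstrained. *)
Definition value (X Y : finType) (c : G1 X Y) : Q X Y :=
  if pselect (exists x, EvQ c x) is left h then sval (cid h) else 0.

Lemma valueE (X Y : finType) (c : G1 X Y) x : CC c -> EvQ c x -> value c = x.
Proof.
move=> Cc ex; rewrite /value; case: pselect => [h|]; last by case; exists x.
by case: (cid h) => y /= ey; apply: (ev_fun CC_rl CC_scons phiQ_rl Cc ey ex).
Qed.

Lemma value_ev (X Y : finType) (c : G1 X Y) : CC c -> EvQ c (value c).
Proof.
by move=> Cc; have [x ex] := ev_total phiQ CC_scons Cc; rewrite (valueE Cc ex).
Qed.

Definition extension k l (x : PGr K k l) : P k l :=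
  lext (fun c : isoclass k l => ofQ (value (cls (rep c)))) x.

Lemma extension_vec k l (c : G1 (ford k) (ford l)) : extension (vec K c) = ofQ (value c).
Proof. by elim/vec_ind: c => G; rewrite vecE /extension lextU cls_rep. Qed.

Lemma extension_lin k l : lin (@extension k l). Proof. exact: lext_lin. Qed.

Lemma ofQ_rl k l k' l' (f : bij 'I_k 'I_k') (g : bij 'I_l 'I_l') (x : Q (ford k) (ford l)) :
  ofQ (srl (s := Q) (X' := ford k') (Y' := ford l') f g x) = brl f g (ofQ x).
Proof.
rewrite /ofQ [srl _ _ _]/(brl (ber f) (ber g) x) !brlM //.
by congr brl; apply: bij_ext => i; rewrite /= enum_rankK.
Qed.

Lemma ofQ_id n : ofQ (sid (s := Q) (ford n)) = unitn P n.
Proof. exact: brl_unitn. Qed.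

Lemma ofQ_hc k l k' l' (x : Q (ford k) (ford l)) (y : Q (ford k') (ford l')) :
  ofQ (srl (s := Q) (X' := ford (k + k')) (Y' := ford (l + l')) (bunsplit _ _) (bunsplit _ _)
      (shc x y))
  = hcat (ofQ x) (ofQ y).
Proof.
rewrite /ofQ brl_hcat // [srl _ _ _]/(brl (ber (bunsplit k k')) (ber (bunsplit l l'))
  (brl (bcardD (ford k) (ford k')) (bcardD (ford l) (ford l')) (hcat x y))) !brlM //.
by congr brl; apply: bij_ext; apply: ord_addP => i;
    do ?rewrite /= ?(split_lshift, split_rshift, enum_rankK).
Qed.

Lemma ofQ_vc k l m (x : Q (ford l) (ford m)) (y : Q (ford k) (ford l)) :
  ofQ (svc x y) = vcat (ofQ x) (ofQ y).
Proof. by rewrite /ofQ brl_vcat. Qed.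

Lemma extension_rl k l k' l' (f : bij 'I_k 'I_k') (g : bij 'I_l 'I_l') (c : G1 (ford k) (ford l)) :
  CC c -> extension (vec K (srl (X' := ford k') (Y' := ford l') f g c)) = brl f g
      (extension (vec K c)).
Proof.
move=> Cc; rewrite !extension_vec -ofQ_rl; congr ofQ; apply: valueE; first exact: CC_rl.
apply: ev_rl; exact: value_ev.
Qed.

Lemma extension_morphism : proP_morphism (class_span (K := K) CC) extension.
Proof.
split.
- split=> [k l a x y _ _|k l s|k l s]; first exact: extension_lin.
  + apply: (lin_eq_on (L' := fun x => lact s (extension x))) => [a x y|a x y|_ [c Cc ->]].
    * by rewrite pgr_lact_lin extension_lin.
    * by rewrite extension_lin (lact_lin ax).
    * by rewrite vec_lact extension_rl // -permb1 brlE invg1 (ract1 ax).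
  + apply: (lin_eq_on (L := fun x => extension (ract x s)) (L' := fun x => ract (extension x) s))
      => [a x y|a x y|_ [c Cc ->]].
    * by rewrite pgr_ract_lin extension_lin.
    * by rewrite extension_lin (ract_lin ax).
    * by rewrite vec_ract extension_rl // -permb1 brlE invgK (lact1 ax).
- rewrite vec_unit0 extension_vec (valueE (x := sid (s := Q) (ford 0))) //; first exact: ofQ_id.
  exact: ev_id.
- rewrite vec_unit1 extension_vec (valueE (x := sid (s := Q) (ford 1))) //; last exact: ev_id.
  by rewrite ofQ_id unitn_1.
- move=> k l k' l' x y Sx Sy; move: x Sx.
  apply: (lin_eq_on (L := fun x => extension (hcat x y))
      (L' := fun x => hcat (extension x) (extension y)))
    => [a x x'|a x x'|_ [c Cc ->]].
  + by rewrite pgr_hcat_linl extension_lin.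
  + by rewrite extension_lin (hcat_linl ax).
  move: y Sy; apply: (lin_eq_on (L' := fun y => hcat (extension (vec K c)) (extension y))) =>
      [a x x'|a x x'|_ [d Cd ->]].
  + by rewrite pgr_hcat_linr extension_lin.
  + by rewrite extension_lin (hcat_linr ax).
  rewrite vec_hcat !extension_vec -ofQ_hc; congr ofQ; apply: valueE; first exact/CC_rl/CC_hc.
  by apply/ev_rl/ev_hc; exact: value_ev.
- move=> k l m x y Sx Sy; move: x Sx.
  apply: (lin_eq_on (L := fun x => extension (vcat x y))
      (L' := fun x => vcat (extension x) (extension y)))
    => [a x x'|a x x'|_ [c Cc ->]].
  + by rewrite pgr_vcat_linl extension_lin.
  + by rewrite extension_lin (vcat_linl ax).
  move: y Sy; apply: (lin_eq_on (L' := fun y => vcat (extension (vec K c)) (extension y))) =>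
      [a x x'|a x x'|_ [d Cd ->]].
  + by rewrite pgr_vcat_linr extension_lin.
  + by rewrite extension_lin (vcat_linr ax).
  rewrite vec_vcat !extension_vec -ofQ_vc; congr ofQ; apply: valueE; first exact: CC_vc.
  by apply: ev_vc; exact: value_ev.
Qed.

Lemma ofQ_hom (F : hom_family (PGr K) P) (DD : graph_class) k l (c : G1 (ford k) (ford l)) :
  (forall (X Y X' Y' : finType) (f : bij X X') (g : bij Y Y') c, @DD X Y c -> @DD X' Y'
      (srl f g c)) ->
  module_morphism (class_span (K := K) DD) F -> DD _ _ c -> ofQ (hom_set ax F c) = F _ _ (vec K c).
Proof.
move=> Drl mF Dc; rewrite /ofQ /hom_set (mor_vec_rl Drl mF) // brlM // !bcompVl brl1 //.
Qed.

Lemma extension_phi : eq_on (class_span (K := K) atoms) extension phi.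
Proof.
have mext : module_morphism (class_span (K := K) atoms) extension.
  have incl k l (x : PGr K k l) : class_span atoms x -> class_span CC x.
    by apply: (lin_lspan (L := id)) => // _ [c [Cc _] ->]; exact: class_span_vec.
  case: (mor_module extension_morphism) => h1 h2 h3; split.
  - by move=> k l a x y /incl ? /incl ?; exact: h1.
  - by move=> k l s x /incl; exact: h2.
  - by move=> k l s x /incl; exact: h3.
apply: (mor_eq_on mext mphi) => k l c [Cc cc].
rewrite extension_vec -(ofQ_hom atoms_rl mphi) //; congr ofQ; apply: valueE => //.
(* An atom is exhausted by a single peeling, so its value is [phi] itself. *)
rewrite -[c in EvQ c _](scons_id c) -[X in EvQ _ X]scons_id.
by apply: ev_cons => //; exact: ev_perm.
Qed.

(** A ProP morphism respects identities, relabelling and both concatenations, the ingredients of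
    [scons]; induction on the derivation then leaves only its values at atoms, given by [phi]. *)
Lemma hom_setE (Psi : hom_family (PGr K) P) : proP_morphism (class_span (K := K) CC) Psi ->
  eq_on (class_span (K := K) atoms) Psi phi ->
  forall (X Y : finType) (c : G1 X Y) x, EvQ c x -> CC c -> hom_set ax Psi c = x.
Proof.
move=> mPsi e; have mm := mor_module mPsi.
have Hrl := @hom_set_rl K CC CC_rl P ax Psi mm.
have Hunit n : Psi n n (vec K (sid (ford n))) = unitn P n.
  elim: n => [|n IHn]; first by rewrite -vec_unit0 (mor_unit0 mPsi).
  rewrite -vec_unitn [unitn (PGr K) _]/(hcat (unit1 (PGr K)) (unitn (PGr K) n)).
  apply: (etrans (mor_hcat mPsi (x := unit1 _) (y := unitn (PGr K) n) _ _)).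
  - by rewrite vec_unit1; exact: class_span_vec.
  - by rewrite vec_unitn; exact: class_span_vec.
  by rewrite vec_unitn IHn (mor_unit1 mPsi).
have Hid X : hom_set ax Psi (sid (s := G1) X) = sid X.
  by rewrite /hom_set srl_id; exact: Hunit.
have Hhc (X Y X' Y' : finType) (c : G1 X Y) (d : G1 X' Y') : CC c -> CC d ->
    hom_set ax Psi (shc c d) = shc (hom_set ax Psi c) (hom_set ax Psi d).
  move=> Cc Cd; rewrite -[RHS]/(brl (bcardD X X') (bcardD Y Y')
      (hcat (hom_set ax Psi c) (hom_set ax Psi d))).
  rewrite /hom_set -(mor_hcat mPsi); try exact/class_span_vec/CC_rl.
  rewrite vec_hcat -(mor_vec_rl CC_rl mm); last by apply: CC_rl; apply: CC_hc; exact: CC_rl.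
  congr (Psi _ _ (vec K _)); rewrite shc_rl !srlM; congr srl;
    by apply: bij_ext => -[] i; rewrite /= ?(split_lshift, split_rshift) /= enum_rankK.
have Hvc (X Y Z : finType) (c : G1 Y Z) (d : G1 X Y) : CC c -> CC d ->
    hom_set ax Psi (svc c d) = svc (hom_set ax Psi c) (hom_set ax Psi d).
  move=> Cc Cd; rewrite -[RHS]/(vcat (hom_set ax Psi c) (hom_set ax Psi d)) /hom_set.
  rewrite -(mor_vcat mPsi); try exact/class_span_vec/CC_rl.
  by rewrite vec_vcat svc_rl.
move=> X Y c x; elim=> {X Y c x} [X Y f|X Y A B R f h y a at_a Ca eh IH] Cc.
  by rewrite /sperm Hrl // Hid.
have [Ch _] := CC_scons Cc.
rewrite /scons Hrl; last by apply: CC_vc => //; exact: CC_hc.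
rewrite Hvc ?Hhc ?Hid ?IH //; try exact: CC_hc.
by rewrite {1}/hom_set e //; apply: class_span_vec; apply: atoms_rl.
Qed.

Lemma extension_unique (Psi : hom_family (PGr K) P) : proP_morphism (class_span (K := K) CC) Psi ->
  eq_on (class_span (K := K) atoms) Psi phi -> eq_on (class_span (K := K) CC) Psi extension.
Proof.
move=> mPsi e.
apply: (mor_eq_on (mor_module mPsi) (mor_module extension_morphism)) => k l c Cc.
rewrite extension_vec -(ofQ_hom CC_rl (mor_module mPsi)) //; congr ofQ.
by apply: hom_setE => //; exact: value_ev.
Qed.
End Target.

Lemma class_span_free : free_ProP (class_span (K := K) CC) (class_span (K := K) atoms).
Proof.
split.
- exact: isProP_PGr.
- exact: class_span_subProP.
- exact/class_span_submodule/atoms_rl.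
- move=> k l; apply: (lin_lspan (L := id)) => // _ [c [Cc _] ->]; exact: class_span_vec.
move=> P phi ax mphi; exists (extension ax phi); split.
- exact: extension_morphism.
- exact: extension_phi.
- exact: extension_unique.
Qed.
End Free.

Lemma family_eq (K : fieldType) (Q : proPData K) (M N : family Q) :
  (forall k l, M k l = N k l) -> M = N.
Proof. by move=> MN; apply: functional_extensionality_dep => k; apply:
    functional_extensionality_dep => l. Qed.

Lemma span_cls (K : fieldType) (DD : graph_class) k l (A : pgraph k l -> Prop) :
  (forall G, A G <-> DD _ _ (cls G)) ->
  lspan [set x : PGr K k l | exists2 G, A G & x = pgr_vec K G] = class_span DD (k := k) (l := l).
Proof.
move=> AD; apply: eq_lspan => x; split=> [[G /AD DG ->]|[c]].
  by exists (cls G) => //; rewrite vecE.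
by elim/vec_ind: c => G /AD AG ->; exists G => //; rewrite vecE.
Qed.

(** * The classes behind the two statements, and freeness of the module of corollas *)

Section Main.
Variable K : fieldType.

Definition all_graphs : graph_class := fun _ _ _ => True.

Lemma full_class_span : full (PGr K) = class_span all_graphs.
Proof.
apply: family_eq => k l; apply/funext => x; apply/propext; split=> // _.
rewrite (malg_lin x); elim: (msupp x : seq _) => [|c s IHs].
  by rewrite big_nil; exact: lspan0.
rewrite big_cons; apply: lspan_lin => //; apply: lspan_gen.
by exists (cls (rep c)); rewrite // -vec_basis.
Qed.

Lemma PGr_ind_class_span : @PGr_ind K = class_span (atoms all_graphs).
Proof.
apply: family_eq => k l; apply: span_cls => G; rewrite /atoms catom_cls.
by split=> [/indecomposable_atom|[_ /atom_indecomposable]].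
Qed.

Lemma PGr_up_class_span : @PGr_up K = class_span cranked.
Proof. by apply: family_eq => k l; apply: span_cls => G; exact: acyclicP. Qed.

Lemma PG_act k l (s : 'S_l) (t : 'S_k) :
  lact s (ract (PG K k l) t) = pgr_vec K (plact s (pract (corolla k l) t)).
Proof. by rewrite /PG -!vecE vec_ract vec_lact cls_lact cls_ract. Qed.

Lemma PGr_up_ind_class_span : @PGr_up_ind K = class_span (atoms cranked).
Proof.
apply: family_eq => k l; apply: eq_lspan => x; split.
  move=> [s [t ->]]; exists (cls (plact s (pract (corolla k l) t))); last by rewrite vecE PG_act.
  rewrite cls_lact cls_ract; do 2 apply: (atoms_rl cranked_rl).
  split; [apply/crankedE; exact: corolla_ranked | apply/catomE; exact: corolla_atom].
move=> [c]; elim/vec_ind: c => G [/crankedE rG /catomE aG] ->.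
have [f [g /clP e]] := atom_corolla aG rG.
have pb n (h : bij 'I_n 'I_n) : h = permb (perm (bij_inj_fun (f := h))).
  by apply: bij_ext => i; rewrite /= permE.
exists (perm (bij_inj_fun (f := g))), (perm (bij_inj_fun (f := f)))^-1%g.
rewrite PG_act -vecE; congr (vec K _).
rewrite cls_lact cls_ract invgK srlM bcomp1l bcomp1r -!pb.
by rewrite /cls e /srl /= crl_cl.
Qed.

(** An isomorphism respects the orders at the vertex, hence is the identity on inputs and outputs;
    compatibility with the indices then equates the permutations. *)
Lemma corolla_act_inj k l (s s' : 'S_l) (t t' : 'S_k) :
  piso (plact s (pract (corolla k l) t)) (plact s' (pract (corolla k l) t')) ->
  s = s' /\ t = t'.
Proof.
move=> [f [fi fo]].
pose bb n : bij (below n) 'I_n := Bij (@ord_belowK n) (@below_ordK n).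
pose hI : bij 'I_k 'I_k := bcomp (bb k) (bcomp (bijc (isoI_bij f)) (bsym (bb k))).
pose hO : bij 'I_l 'I_l := bcomp (bb l) (bcomp (bijc (isoO_bij f)) (bsym (bb l))).
have hI1 : hI = bid _.
  apply: mono_bij_id => i j /=; rewrite bijcE.
  exact: (fi (inr (below_ord i)) (inr (below_ord j))).
have hO1 : hO = bid _.
  apply: mono_bij_id => i j /=; rewrite bijcE.
  exact: (fo (inr (below_ord i)) (inr (below_ord j))).
split; last apply: invg_inj; apply/permP => i; apply: val_inj.
  have := iso_beta f (inl (below_ord i)).
  have := congr1 (fun k => bfun k i) hO1; rewrite /= bijcE => ->.
  by rewrite below_ordK => ->.
have := iso_alpha f (inl (below_ord i)).
have := congr1 (fun k => bfun k i) hI1; rewrite /= bijcE => ->.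
by rewrite below_ordK => ->.
Qed.

Lemma PG_free : free_module (@PGr_up_ind K) (@PG K).
Proof.
split.
- by rewrite PGr_up_ind_class_span; apply: class_span_submodule; exact: (atoms_rl cranked_rl).
- move=> k l; apply: lspan_gen; exists 1%g, 1%g.
  by rewrite (ract1 (isProP_PGr K)) (lact1 (isProP_PGr K)).
move=> k l x.
have ex : PGr_up_ind x -> exists a : {ffun 'S_l * 'S_k -> K},
    x = \sum_st a st *: lact st.1 (ract (PG K k l) st.2).
  move: x; apply: lspan_ind.
    by exists [ffun=> 0]; rewrite big1 // => st _; rewrite ffunE scale0r.
  move=> b _ y [s [t ->]] _ [a ->].
  (* Several terms of the given combination may involve the same pair of permutations, so their
     coefficients are accumulated. *)
  exists [ffun st => b * (st == (s, t))%:R + a st].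
  under [RHS]eq_bigr do rewrite ffunE scalerDl.
  rewrite big_split /=; congr (_ + _).
  rewrite (bigD1 (s, t)) //= eqxx mulr1 big1 ?addr0 // => st /negbTE ->.
  by rewrite mulr0 scale0r.
move=> /ex[a xa]; exists a; split=> // b xb; apply/ffunP => -[s t].
(* By [corolla_act_inj] the basis element [c] occurs only in the term of index [(s, t)], so its
   coefficient in [x] recovers the value at [(s, t)]. *)
pose c := \pi_(isoclass k l) (plact s (pract (corolla k l) t)).
have coefZ (e : K) (y : PGr K k l) : mcoeff c (e *: y : PGr K k l) = e * mcoeff c y.
  exact: mcoeffZ.
have coef (d : {ffun 'S_l * 'S_k -> K}) :
    x = \sum_st d st *: lact st.1 (ract (PG K k l) st.2) ->
    mcoeff c (x : {malg K[isoclass k l]}) = d (s, t).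
  move=> ->; rewrite (raddf_sum (mcoeff c)) (bigD1 (s, t)) // big1.
    apply: etrans (addr0 _) _; apply: etrans (coefZ _ _) _.
    by rewrite PG_act mcoeffUU mulr1.
  move=> [s' t'] /negP ne; apply: etrans (coefZ _ _) _; rewrite PG_act mcoeffU.
  case: eqP => [/piP/clsP/corolla_act_inj[es et]|_]; last by rewrite mulr0.
  by case: ne; move: es et => /= -> ->.
by rewrite -(coef a) // -(coef b).
Qed.

End Main.

Theorem theorem3p20 (K : fieldType) :
  free_ProP (full (PGr K)) (@PGr_ind K) /\
  (free_module (@PGr_up_ind K) (@PG K) /\
   free_ProP (@PGr_up K) (@PGr_up_ind K)).
Proof.
split; last split.
- by rewrite full_class_span PGr_ind_class_span; exact: class_span_free.
- exact: PG_free.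
- rewrite PGr_up_class_span PGr_up_ind_class_span; apply: class_span_free.
  + exact: cranked_rl.
  + exact: cranked_scons.
  + exact: cranked_id.
  + exact: cranked_hc.
  + exact: cranked_vc.
Qed.
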